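(* Let $k\ge 1$ be an integer, let $(a,b)\subset\mathbb{R}$ be an open bounded interval, and let $W\colon\mathbb{R}\to[0,+\infty)$ be a continuous function such that $W(-1)=W(1)=0$ and, for some $\alpha_W,\beta_W>0$, $W(z)\ge \alpha_W\min\{(z+1)^2,(z-1)^2,\beta_W\}$ for all $z\in\mathbb{R}$. For $\varepsilon>0$ and $u\in H^k(a,b)$ set $$F_\varepsilon(u)=\int_{(a,b)}\Big(\frac1\varepsilon W(u)+\varepsilon^{2k-1}(u^{(k)})^2\Big)\,dt.$$ Then the family $\{F_\varepsilon\}$ is equicoercive with respect to convergence in measure; that is, for all $\varepsilon_j\to0$ (with $\varepsilon_j>0$) and all $\{u_j\}\subset H^k(a,b)$ with $\sup_j F_{\varepsilon_j}(u_j)<+\infty$, there exists $u\in BV((a,b);\{-1,1\})$ such that, up to subsequences, $u_j\to u$ in measure. Moreover, as $\varepsilon\to0$ the family $\{F_\varepsilon\}$ $\Gamma$-converges, both with respect to convergence in measure and with respect to convergence in $L^1(a,b)$, to the functional $F$ with domain $BV((a,b);\{-1,1\})$ given there by $$F(u)=m_k\,\#S(u),$$ where $$m_k=\inf\Big\{\int_{-\infty}^{+\infty}\big(W(u)+(u^{(k)})^2\big)\,dt:\ u\in H^k_{\mathrm{loc}}(\mathbb{R}),\ \lim_{t\to\pm\infty}u(t)=\pm1\Big\}$$ and $S(u)$ denotes the jump set of $u$. More precisely, for all $u\in BV((a,b);\{-1,1\})$: (i) for all sequences $u_\varepsilon\to u$ in measure, $\displaystyle\liminf_{\varepsilon\to0}F_\varepsilon(u_\varepsilon)\ge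 m_k\,\#S(u)$; (ii) there exists a recovery sequence $u_\varepsilon\to u$ in $L^1(a,b)$ such that $\displaystyle\limsup_{\varepsilon\to0}F_\varepsilon(u_\varepsilon)= m_k\,\#S(u)$.
   Context: $u^{(k)}$ denotes the $k$-th (weak) derivative. $BV((a,b);\{-1,1\})$ is the space of functions of bounded variation $u$ on $(a,b)$ with $u(t)\in\{-1,1\}$ for almost every $t$, i.e. the piecewise-constant functions on $(a,b)$ (finitely many pieces) with values $-1$ or $1$; $S(u)$ is the (finite) set of jump points of $u$ in $(a,b)$ and $\#$ denotes cardinality. As usual in $\Gamma$-convergence, $F_\varepsilon$ is understood to be $+\infty$ outside $H^k(a,b)$, and a functional ''with domain $X$'' is understood to be $+\infty$ outside $X$. *)

(* Defs.v *)
From HB Require Import structures.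
From mathcomp Require Import all_boot all_order all_algebra.
From mathcomp Require Import all_classical all_reals all_analysis.

Set Implicit Arguments.
Unset Strict Implicit.
Unset Printing Implicit Defensive.

Import Order.TTheory GRing.Theory Num.Theory.
Import numFieldNormedType.Exports.

Local Open Scope classical_set_scope.
Local Open Scope ring_scope.

(* Functions on an open set D of the line are represented by total functions
   R -> R, of which only the values on D matter; functions that agree almost
   everywhere on D are not identified in the types. *)

Section sobolev.
Context {R : realType}.
Implicit Types (D : set R) (u v phi : R -> R) (j k : nat).

Local Notation mu := (@lebesgue_measure R).

Definition test_function D phi : Prop :=
  (forall n x, derivable (derive1n n phi) x 1) /\
  (exists K, [/\ compact K, K `<=` D & forall x, ~ K x -> phi x = 0]).

Definition is_weak_derivative D j u v : Prop :=
  [/\ locally_integrable D u, locally_integrable D v &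
      forall phi, test_function D phi ->
        \int[mu]_(t in D) (u t * derive1n j phi t) =
        (-1) ^+ j * \int[mu]_(t in D) (v t * phi t)].

(* Weak derivatives are unique up to a null set, so that integrals over D of
   expressions in [weak_derivative D j u] do not depend on the choice made. *)
Definition weak_derivative D j u : R -> R :=
  xget (cst 0) [set v | is_weak_derivative D j u v].

Definition square_integrable D u : Prop :=
  measurable_fun D u /\ (\int[mu]_(t in D) ((u t) ^+ 2)%:E < +oo)%E.

Definition locally_square_integrable D u : Prop :=
  measurable_fun D u /\
  forall K, K `<=` D -> compact K ->
    (\int[mu]_(t in K) ((u t) ^+ 2)%:E < +oo)%E.

Definition sobolevH D k u : Prop :=
  square_integrable D u /\
  forall j, (1 <= j <= k)%N ->
    exists v, is_weak_derivative D j u v /\ square_integrable D v.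

Definition sobolevH_loc D k u : Prop :=
  locally_square_integrable D u /\
  forall j, (1 <= j <= k)%N ->
    exists v, is_weak_derivative D j u v /\ locally_square_integrable D v.

End sobolev.

Section bounded_variation_pm1.
Context {R : realType}.
Implicit Types (a b x l r : R) (u v : R -> R).

Local Notation mu := (@lebesgue_measure R).

(* The library notion [bounded_variation] is about pointwise variation; a
   function is in BV(a, b) when some a.e. representative of it has bounded
   pointwise variation. The values of that representative at a and b play no
   role: changing them does not affect boundedness of the variation. *)
Definition BV_pm1 a b u : Prop :=
  [/\ measurable_fun `]a, b[ u,
      (exists v, bounded_variation a b v /\
        {ae mu, forall t, t \in `]a, b[ -> u t = v t}) &
      {ae mu, forall t, t \in `]a, b[ -> u t = 1 \/ u t = -1}].

Definition ess_left_limit u x l : Prop :=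
  forall e : R, 0 < e ->
    exists2 d, 0 < d & {ae mu, forall t, t \in `]x - d, x[ -> `|u t - l| < e}.

Definition ess_right_limit u x r : Prop :=
  forall e : R, 0 < e ->
    exists2 d, 0 < d & {ae mu, forall t, t \in `]x, x + d[ -> `|u t - r| < e}.

Definition jump_set a b u : set R :=
  [set x | (x \in `]a, b[) /\
    exists l r, [/\ ess_left_limit u x l, ess_right_limit u x r & l != r]].

End bounded_variation_pm1.

Section convergence.
Context {R : realType}.
Implicit Types (a b : R) (u : R -> R).

Local Notation mu := (@lebesgue_measure R).

Definition integrable_on a b u : Prop :=
  mu.-integrable `]a, b[ (EFin \o u).

Definition cvg_in_measure (I : Type) (G : set_system I) a b
    (u_ : I -> R -> R) u : Prop :=
  forall e : R, 0 < e ->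
    mu [set t | (t \in `]a, b[) /\ e < `|u_ i t - u t|] @[i --> G] --> 0%E.

Definition cvg_in_L1 (I : Type) (G : set_system I) a b
    (u_ : I -> R -> R) u : Prop :=
  (\int[mu]_(t in `]a, b[) (`|u_ i t - u t|)%:E)%E @[i --> G] --> 0%E.

(* Sequential Gamma-convergence, as eps -> 0+, of functionals on the space
   [X] of elements of [T], with respect to the sequential convergence [cv]. *)
Definition Gamma_cvg (T : Type) (X : set T) (cv : (nat -> T) -> T -> Prop)
    (F : R -> T -> \bar R) (F0 : T -> \bar R) : Prop :=
  forall eps : nat -> R, (forall j, 0 < eps j) -> eps @ \oo --> 0 ->
  forall u : T, X u ->
    (forall u_ : nat -> T, (forall j, X (u_ j)) -> cv u_ u ->
       (F0 u <= limn_einf (fun j => F (eps j) (u_ j)))%E) /\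
    (exists u_ : nat -> T, [/\ forall j, X (u_ j), cv u_ u &
       (limn_esup (fun j => F (eps j) (u_ j)) <= F0 u)%E]).

End convergence.

Section functionals.
Context {R : realType}.
Implicit Types (k : nat) (W u : R -> R) (a b eps : R).

Local Notation mu := (@lebesgue_measure R).

Definition F_eps k W a b eps u : \bar R :=
  if `[< sobolevH `]a, b[ k u >] then
    (\int[mu]_(t in `]a, b[)
      (eps^-1 * W (u t) +
       eps ^+ (2 * k - 1) * (weak_derivative `]a, b[ k u t) ^+ 2)%:E)%E
  else +oo%E.

(* The infimum is over all pointwise representatives with the prescribed
   limits. For k >= 1 this agrees with taking limits of the continuous
   representative, which is one of the competitors. *)
Definition m_opt k W : \bar R :=
  ereal_inf
    [set (\int[mu]_t (W (u t) + (weak_derivative setT k u t) ^+ 2)%:E)%E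
    | u in [set u : R -> R | [/\ sobolevH_loc setT k u,
                                 u t @[t --> +oo] --> (1 : R) &
                                 u t @[t --> -oo] --> (-1 : R)]]].

(* [counting] is the cardinality, with value +oo on infinite sets. *)
Definition F_lim k W a b u : \bar R :=
  if `[< BV_pm1 a b u >] then (m_opt k W * counting (jump_set a b u))%E
  else +oo%E.

End functionals.

(* Main.v *)
(* Blowing up by eps at a jump of u turns F_eps into the unscaled energy, so both bounds are
   about the optimal profile problem defining m_k.  On a unit cell with small energy where the
   function is close to a well at most points, iterated mean value theorems show that the
   derivatives of order < k are small (jet bounds); there the function can be cut off to the well
   at small cost.  Lower bound: if u_eps is close in measure to a jump and has bounded energy, the
   pigeonhole principle gives such a cell on each side among the order of 1/eps available ones, and
   cutting off at these cells produces a competitor for m_k.  Upper bound: the same argument gives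
   almost optimal profiles that are constant outside a compact set, and these are rescaled and
   placed at the jumps.  Equicoercivity: a cell of small energy carries a definite sign,
   neighbouring cells of small energy carry the same one, and there are boundedly many other cells;
   so u_eps is close in measure to a piecewise constant function with boundedly many jumps, whose
   positions converge along a subsequence.  By equicoercivity the liminf is infinite at functions
   that are not BV with values in {-1, 1}. *)

Require Import Defs.
From HB Require Import structures.
From mathcomp Require Import all_boot all_order all_algebra.
From mathcomp Require Import all_classical all_reals all_analysis.
From mathcomp Require Import measurable_realfun ring lra zify.
Import Order.TTheory GRing.Theory Num.Theory.
Import numFieldNormedType.Exports.

Set Implicit Arguments.
Unset Strict Implicit.
Unset Printing Implicit Defensive.

Local Open Scope classical_set_scope.
Local Open Scope ring_scope.

(** * Smooth functions and the smooth step *)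

(** Only W(u) and the k-th derivative enter the energy. The k-th derivative is small only in L^2,
    never pointwise, so the estimates treat the orders below k pointwise and the order k through an
    integral. The exponent 2k - 1 is the one for which both terms scale alike under t = x + eps s. A
    neighbourhood of width h becomes about h / eps unit cells, while the energy stays below M and
    the exceptional set has measure at most rho / eps. The pigeonhole principle needs (h / eps) tau
    to beat M + rho / eps, which makes rho a multiple of h tau and eps small compared with rho / M.
    Reflecting s exchanges the two orientations of a jump and preserves the square of the k-th
    derivative, so one constant m_k serves for both. *)

Lemma leibniz_step (R : comRingType) (p q : nat -> R) n :
  \sum_(i < n.+1) (p i.+1 * q (n - i)%N + p i * q (n - i).+1) *+ 'C(n, i) =
  \sum_(i < n.+2) (p i * q (n.+1 - i)%N) *+ 'C(n.+1, i).
Proof.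
rewrite (eq_bigr (fun i : 'I_n.+1 => p i.+1 * q (n - i)%N *+ 'C(n, i) +
   p i * q (n - i).+1 *+ 'C(n, i))); last by move=> i _; rewrite mulrnDl.
rewrite big_split/=.
rewrite [RHS]big_ord_recl/= bin0 subn0 mulr1n.
(* Pascal's rule splits the remaining sum in two; the second half lacks only its first term, and its
   last term carries a vanishing binomial coefficient. *)
have -> : \sum_(i < n.+1) p (bump 0 i) * q (n.+1 - bump 0 i)%N *+ 'C(n.+1, bump 0 i) =
    \sum_(i < n.+1) p i.+1 * q (n - i)%N *+ 'C(n, i) +
    \sum_(i < n.+1) p i.+1 * q (n - i)%N *+ 'C(n, i.+1).
  rewrite -big_split/=; apply: eq_bigr => i _.
  by rewrite /bump/= add1n subSS binS mulrnDr addrC.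
rewrite addrCA; congr (_ + _).
rewrite big_ord_recl/= bin0 subn0 mulr1n; congr (_ + _).
rewrite big_ord_recr/= bin_small// mulr0n addr0.
apply: eq_bigr => i _; rewrite /bump/= add1n.
by rewrite subnSK.
Qed.

Section smooth.
Context {R : realType}.
Implicit Types f g : R -> R.

Definition smooth f := forall n x, derivable (derive1n n f) x 1.

(** Exhibiting such a sequence proves smoothness of [F 0] and computes all its iterated derivatives
    at the same time. *)
Definition derivation_seq (F : nat -> R -> R) :=
  forall (n : nat) (x : R), is_derive x (1 : R) (F n) (F n.+1 x).

Lemma smooth_derivation_seq f : smooth f -> derivation_seq (fun n => derive1n n f).
Proof.
by move=> sf n x; apply: DeriveDef; [exact: sf|rewrite derive1nS derive1E].
Qed.

Lemma derivation_seq_derive1n F : derivation_seq F ->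
  forall n, derive1n n (F 0) = F n.
Proof.
move=> dF; elim=> [|n ih]; first by [].
rewrite derive1nS ih; apply/funext => x; rewrite derive1E.
by have [_ ->] := dF n x.
Qed.

Lemma derivation_seq_smooth F : derivation_seq F -> smooth (F 0).
Proof.
by move=> dF n x; rewrite derivation_seq_derive1n//; have [] := dF n x.
Qed.

(** Coinduction: a class of functions closed under differentiation contains only smooth functions.
    It is applied to classes of explicit shape, so that no formula for the n-th derivative has to be
    found. *)
Lemma smooth_coind (S : set (R -> R)) :
  (forall f, S f -> exists2 g, S g & forall x : R, is_derive x (1 : R) f (g x)) ->
  forall f, S f -> smooth f.
Proof.
move=> h f Sf n x.
suff : S (derive1n n f) by move=> /h[g _ /(_ x)[]].
elim: n => // n /h[g Sg dg]; rewrite derive1nS.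
suff -> : derive1 (derive1n n f) = g by [].
by apply/funext => y; rewrite derive1E; have [_ ->] := dg y.
Qed.

Lemma smooth_continuous f : smooth f -> continuous f.
Proof.
move=> sf x; apply: differentiable_continuous.
exact/derivable1_diffP/(sf 0%N).
Qed.

Lemma smooth_derive1n f n : smooth f -> smooth (derive1n n f).
Proof.
by move=> sf m x; rewrite /derive1n  -iterD; exact: sf.
Qed.

Lemma smooth_derive1 f : smooth f -> smooth (derive1 f).
Proof. by move=> sf; rewrite -derive1n1; exact: smooth_derive1n. Qed.

(** Formed from two arbitrary sequences rather than two functions, so that it also serves when one
    of them consists of weak derivatives. *)
Definition leibniz (F G : nat -> R -> R) n x :=
  \sum_(i < n.+1) F i x * G (n - i)%N x *+ 'C(n, i).

Lemma derivation_seqM F G : derivation_seq F -> derivation_seq G ->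
  derivation_seq (leibniz F G).
Proof.
move=> dF dG n x; rewrite /leibniz.
rewrite -(leibniz_step (F ^~ x) (G ^~ x)).
have -> : (fun x0 => \sum_(i < n.+1) F i x0 * G (n - i)%N x0 *+ 'C(n, i)) =
   \sum_(i < n.+1) ('C(n, i)%:R *: (F i * G (n - i)%N)).
  apply/funext => y; rewrite fct_sumE; apply: eq_bigr => i _.
  by rewrite -mulr_natl.
apply: is_derive_eq; first by apply: is_derive_sum => i; apply: is_deriveZ;
  apply: is_deriveM; [exact: dF|exact: dG].
apply: eq_bigr => i _; rewrite -scaler_nat/= /GRing.scale/=.
by rewrite mulr1 mulr_natl addrC [G _ x * _]mulrC.
Qed.

Lemma leibniz0 F G : leibniz F G 0 = F 0%N \* G 0%N.
Proof. by apply/funext => x; rewrite /leibniz big_ord1 bin0 mulr1n. Qed.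

Lemma smoothM f g : smooth f -> smooth g -> smooth (f \* g).
Proof.
move=> sf sg.
have := derivation_seqM (smooth_derivation_seq sf) (smooth_derivation_seq sg).
by move=> /derivation_seq_smooth; rewrite leibniz0.
Qed.

Lemma smooth_derive1nM f g n : smooth f -> smooth g ->
  derive1n n (f \* g) = leibniz (fun n => derive1n n f) (fun n => derive1n n g) n.
Proof.
move=> sf sg.
have := derivation_seqM (smooth_derivation_seq sf) (smooth_derivation_seq sg).
by move=> /derivation_seq_derive1n <-; rewrite leibniz0.
Qed.

Lemma smooth_cst (c : R) : smooth (cst c).
Proof.
apply: (@smooth_coind [set f | exists c, f = cst c]); last by exists c.
move=> _ [d ->]; exists (cst 0); first by exists 0.
by move=> x; exact: is_derive_cst.
Qed.

Lemma smoothD f g : smooth f -> smooth g -> smooth (f \+ g).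
Proof.
move=> sf sg.
apply: (@smooth_coind [set h | exists f g, [/\ smooth f, smooth g & h = f \+ g]]); last by exists f, g.
move=> _ [{sf sg}f [{}g [sf sg ->]]].
exists ((derive1 f) \+ (derive1 g)) => [|x].
  by exists (derive1 f), (derive1 g); split; [exact: smooth_derive1..|].
apply: is_deriveD; rewrite /= derive1E; apply: derivableP;
 [exact: (sf 0%N)|exact: (sg 0%N)].
Qed.

Lemma derive1_affine f (c d : R) x : derivable f (c * x + d) 1 ->
  is_derive x 1 (fun t => f (c * t + d)) (c * (derive1 f) (c * x + d)).
Proof.
move=> df.
have dh : is_derive x 1 (fun t => c * t + d) c.
  apply: is_derive_eq; rewrite addr0.
  by rewrite -[RHS]mulr1; congr (_ * _).
have {}df : is_derive (c * x + d) (1 : R) f (derive1 f (c * x + d)).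
  by rewrite derive1E; exact: derivableP.
have := @is_derive1_comp _ f (fun t : R => c * t + d) x _ _ df dh.
by rewrite mulrC; exact.
Qed.

Lemma derivation_seq_affine F (c d : R) : derivation_seq F ->
  derivation_seq (fun n x => c ^+ n * F n (c * x + d)).
Proof.
move=> dF n x.
have h : derivable (F n) (c * x + d) 1 by have [] := dF n (c * x + d).
have := derive1_affine h; rewrite derive1E; have [_ ->] := dF n (c * x + d).
move=> /(is_deriveZ (c ^+ n)); rewrite /GRing.scale/=.
by rewrite mulrA -exprSr.
Qed.

Lemma smooth_affine f (c d : R) : smooth f -> smooth (fun x => f (c * x + d)).
Proof.
move=> /smooth_derivation_seq /(derivation_seq_affine c d).
by move=> /derivation_seq_smooth; under [X in smooth X]eq_fun do rewrite mul1r.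
Qed.

Lemma derive1n_affine f (c d : R) n : smooth f ->
  derive1n n (fun x => f (c * x + d)) = (fun x => c ^+ n * derive1n n f (c * x + d)).
Proof.
move=> /smooth_derivation_seq /(derivation_seq_affine c d).
move=> /derivation_seq_derive1n /(_ n) <-.
by congr (derive1n n _); apply/funext => x; rewrite mul1r.
Qed.

Lemma is_derive1X f (x df : R) m : is_derive x (1 : R) f df ->
  is_derive x (1 : R) (fun y => f y ^+ m) (m%:R * f x ^+ m.-1 * df).
Proof.
move=> hf; elim: m => [|m ih].
  by rewrite mul0r mul0r; apply: is_derive_cst.
have -> : (fun y => f y ^+ m.+1) = f * (fun y => f y ^+ m).
  by apply/funext => y; rewrite exprS.
apply: is_derive_eq; rewrite /= /GRing.scale/=.
case: m {ih} => [|m]; first by rewrite !expr0; ring.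
by rewrite /= !exprS -!natr1; ring.
Qed.

(** The class of products of a smooth [p] with a power of [1 / f] is closed under differentiation:
    the exponent grows by one and the new factor is p' f - m p f'. *)
Lemma smoothV f : smooth f -> (forall x, f x != 0) -> smooth (fun x => (f x)^-1).
Proof.
move=> sf f0.
apply: (@smooth_coind [set h | exists p m, smooth p /\
   h = (fun x => p x * (f x)^-1 ^+ m)]); last first.
  exists (cst 1), 1%N; split; first exact: smooth_cst.
  by apply/funext => x; rewrite /= mul1r.
move=> _ [p [m [sp ->]]].
exists (fun x => (derive1 p x * f x - m%:R * p x * derive1 f x) * (f x)^-1 ^+ m.+1).
  exists (derive1 p \* f \+ (cst (- m%:R) \* p) \* derive1 f), m.+1; split.
    apply: smoothD; first by apply: smoothM; [exact: smooth_derive1|].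
    apply: smoothM; last exact: smooth_derive1.
    by apply: smoothM; [exact: smooth_cst|].
  by apply/funext => x /=; rewrite !mulNr.
move=> x.
have dp : is_derive x (1 : R) p (derive1 p x).
  by rewrite derive1E; apply: derivableP; exact: (sp 0%N).
have df : is_derive x (1 : R) f (derive1 f x).
  by rewrite derive1E; apply: derivableP; exact: (sf 0%N).
have dV : is_derive x (1 : R) (fun x => (f x)^-1) (- (f x) ^- 2 * derive1 f x).
  exact: is_deriveV.
have dX := is_derive1X m dV.
apply: is_derive_eq; rewrite /= /GRing.scale/=.
case: m {dX} => [|m]; first by field.
by rewrite /= !exprS; field; rewrite f0.
Qed.

(** The classical flat function exp(-1/x), with a polynomial factor in 1/x that makes the class
    stable under differentiation. *)
Let flat (P : {poly R}) (x : R) : R :=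
  if 0 < x then P.[x^-1] * expR (- x^-1) else 0.

(** From exp(y) >= y^(i+2) / (i+2)! at y = 1/x, each monomial of [P] in 1/x, multiplied by
    exp(-1/x), is at most a constant times x^2. Quadratic decay is what gives derivative 0 at the
    origin. *)
Let flat_bound (P : {poly R}) : exists2 C, 0 <= C &
  forall x : R, `|flat P x| <= C * x ^+ 2.
Proof.
exists (\sum_(i < size P) `|P`_i| * (i.+2)`!%:R).
  by apply: sumr_ge0 => i _; rewrite mulr_ge0.
move=> x; rewrite /flat; case: ifPn => x0; last first.
  rewrite normr0 mulr_ge0 ?sqr_ge0//.
  by apply: sumr_ge0 => i _; rewrite mulr_ge0.
have y0 : 0 < x^-1 by rewrite invr_gt0.
rewrite normrM (ger0_norm (expR_ge0 _)) horner_coef mulr_suml.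
apply: (@le_trans _ _ ((\sum_(i < size P) `|P`_i| * x^-1 ^+ i) * expR (- x^-1))).
  rewrite ler_wpM2r ?expR_ge0//; apply: le_trans (ler_norm_sum _ _ _) _.
  by apply: ler_sum => i _; rewrite normrM normrX (gtr0_norm y0).
rewrite mulr_suml; apply: ler_sum => i _.
rewrite -!mulrA ler_wpM2l// expRN ler_pdivrMr ?expR_gt0//.
have := expR_ge1Dxn i.+1 (ltW y0).
set e := expR _ => h.
have {}h : x^-1 ^+ i.+2 <= (i.+2)`!%:R * e.
  rewrite -ler_pdivrMl ?ltr0n ?fact_gt0// mulrC; apply: le_trans h.
  by rewrite lerDr ler01.
rewrite [_ * e]mulrC mulrA mulrC mulrA [_ * e]mulrC mulrC -ler_pdivrMl ?exprn_gt0//.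
rewrite ler_pdivrMl ?ltr0n ?fact_gt0// mulrA.
rewrite -ler_pdivrMr ?exprn_gt0//; apply: le_trans h.
by rewrite -exprVn -[i.+2]addn2 exprD.
Qed.

Let is_derive_flat (P : {poly R}) (x : R) :
  is_derive x (1 : R) (flat P) (flat ('X^2 * (P - P^`())) x).
Proof.
have [x0|x0|->] := ltgtP x 0.
- rewrite {2}/flat ltNge (ltW x0)/=.
  apply: (@near_eq_is_derive _ _ _ (cst 0)).
  near=> y; rewrite /flat ltNge.
  suff -> : y <= 0 by [].
  by near: y; exact: lt_le_nbhsl.
- rewrite {2}/flat x0.
  apply: (@near_eq_is_derive _ _ _ (fun x : R => P.[x^-1] * expR (- x^-1) : R)).
    near=> y; rewrite /flat.
    suff -> : 0 < y by []. 
    by near: y; exact: lt_nbhsr.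
  have xn0 : x != 0 by rewrite gt_eqF.
  have dV : is_derive x (1 : R) (fun x => x^-1) (- x ^- 2 * 1).
    exact: is_deriveV.
  have dP : is_derive x^-1 (1 : R) (horner P) (P^`()).[x^-1].
    by rewrite derivE derive1E; apply: derivableP; exact: derivable_horner.
  have d1 : is_derive x (1 : R) (fun x => P.[x^-1]) ((P^`()).[x^-1] * (- x ^- 2 * 1)).
    exact: (@is_derive1_comp _ (horner P)).
  have d2 : is_derive x (1 : R) (fun x => expR (- x^-1)) (expR (- x^-1) * (x ^- 2)).
    apply: (@is_derive1_comp _ expR).
    have -> : x ^- 2 = - (- x ^- 2 * 1) by rewrite mulr1 opprK.
    exact: is_deriveN.
  apply: is_derive_eq; rewrite /= /GRing.scale/=.
  by rewrite hornerM hornerXn hornerD hornerN; field.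
(* At the origin the difference quotient is at most C |h| by the quadratic bound. *)
- rewrite {2}/flat ltxx.
  have [C C0 hC] := flat_bound P.
  have f00 : flat P 0 = 0 by rewrite /flat ltxx.
  suff h : h^-1 *: ((flat P \o shift 0) (h *: (1 : R)) - flat P 0) @[h --> (0:R)^'] --> (0 : R).
    by apply: DeriveDef; [apply/cvg_ex; exists 0|exact/cvg_lim].
  apply/cvgr0Pnorm_le => e e0; near=> h.
  rewrite /= /GRing.scale/= mulr1 addr0 f00 subr0 normrM normfV.
  rewrite ler_pdivrMl; last by rewrite normr_gt0; near: h; exact: nbhs_dnbhs_neq.
  apply: le_trans (hC h) _; rewrite -real_normK ?num_real// expr2 mulrCA ler_wpM2l//.
  apply: (@le_trans _ _ ((C + 1) * `|h|)); first by rewrite ler_wpM2r ?lerDl.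
  rewrite mulrC -ler_pdivlMr ?ltr_wpDl//; near: h.
  by apply: dnbhs0_le; rewrite divr_gt0// ltr_wpDl.
Unshelve. all: by end_near. Qed.

Let smooth_flat (P : {poly R}) : smooth (flat P).
Proof.
apply: (@smooth_coind [set f | exists P, f = flat P]); last by exists P.
move=> _ [Q ->]; exists (flat ('X^2 * (Q - Q^`()))); first by eexists.
by move=> x; exact: is_derive_flat.
Qed.

Let flat1E (x : R) : flat 1 x = if 0 < x then expR (- x^-1) else 0.
Proof. by rewrite /flat hornerE mul1r. Qed.

Let flat1_ge0 (x : R) : 0 <= flat 1 x.
Proof. by rewrite flat1E; case: ifP => // _; exact: expR_ge0. Qed.

Let flat1_gt0 (x : R) : 0 < x -> 0 < flat 1 x.
Proof. by rewrite flat1E => ->; exact: expR_gt0. Qed.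

Let flat1_le0 (x : R) : x <= 0 -> flat 1 x = 0.
Proof. by rewrite flat1E ltNge => ->. Qed.

(** The denominator is positive because x and 1 - x are never both nonpositive. *)
Definition smooth_step (x : R) : R := flat 1 x / (flat 1 x + flat 1 (1 - x)).

Let smooth_step_den (x : R) : 0 < flat 1 x + flat 1 (1 - x).
Proof.
have [x0|x0] := ltP 0 x; first by rewrite ltr_pwDl ?flat1_gt0.
by rewrite ltr_wpDl// flat1_gt0// subr_gt0 (le_lt_trans x0).
Qed.

Lemma smooth_smooth_step : smooth smooth_step.
Proof.
apply: (@smoothM (flat 1) (fun x : R => (flat 1 x + flat 1 (1 - x))^-1)).
  exact: smooth_flat.
apply: (@smoothV (fun x : R => flat 1 x + flat 1 (1 - x))) => [|x]; last first.
  by rewrite gt_eqF.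
apply: (@smoothD (flat 1) (fun x => flat 1 (1 - x))); first exact: smooth_flat.
have := @smooth_affine (flat 1) (-1) 1 (@smooth_flat 1).
by under eq_fun do rewrite mulN1r addrC.
Qed.

Lemma smooth_step_le0 (x : R) : x <= 0 -> smooth_step x = 0.
Proof. by move=> x0; rewrite /smooth_step flat1_le0// mul0r. Qed.

Lemma smooth_step_ge1 (x : R) : 1 <= x -> smooth_step x = 1.
Proof.
move=> x1; rewrite /smooth_step [X in _ + X]flat1_le0 ?subr_le0// addr0 divff//.
by rewrite gt_eqF// flat1_gt0// (lt_le_trans _ x1).
Qed.

Lemma smooth_step_ge0 (x : R) : 0 <= smooth_step x.
Proof. by rewrite divr_ge0// ltW. Qed.

Lemma smooth_step_le1 (x : R) : smooth_step x <= 1.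
Proof. by rewrite ler_pdivrMr// mul1r lerDl. Qed.

Lemma derive1n_smooth_step_eq0 n (x : R) : x < 0 \/ 1 < x ->
  derive1n n.+1 smooth_step x = 0.
Proof.
(* The induction is on being constant near x, an open condition that passes to derivatives, rather
   than on the value at x. *)
move=> x01; have [c hc] : exists c, \forall y \near x, derive1n n smooth_step y = c.
  elim: n => [|n [c hc]].
    case: x01 => [x0|x1].
      exists 0; near=> y; rewrite /= smooth_step_le0//.
      by near: y; exact: lt_le_nbhsl.
    exists 1; near=> y; rewrite /= smooth_step_ge1//.
    by near: y; exact: lt_le_nbhsr.
  exists 0; move: (near_join hc); apply: filterS => y hy.
  rewrite derive1nS derive1E (@near_eq_derive _ _ _ _ (cst c)) ?derive_cst//.
rewrite derive1nS derive1E (@near_eq_derive _ _ _ _ (cst c)) ?derive_cst//.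
Unshelve. all: by end_near. Qed.

Lemma derive1n_smooth_step_bounded n :
  exists2 K, 0 <= K & forall x : R, `|derive1n n smooth_step x| <= K.
Proof.
case: n => [|n].
  exists 1; first by []. 
  by move=> x; rewrite /= ger0_norm ?smooth_step_ge0// smooth_step_le1.
have c : continuous (derive1n n.+1 smooth_step).
  by apply/smooth_continuous/smooth_derive1n; exact: smooth_smooth_step.
have /compact_bounded[M [_ hM]] : compact (derive1n n.+1 smooth_step @` `[0, 1]%classic).
  apply: continuous_compact; last exact: segment_compact.
  exact: continuous_subspaceT.
exists (`|M| + 1) => [|x]; first by rewrite addr_ge0.
have [x01|] := boolP (x \in `[0, 1]).
  by apply: hM; [rewrite ltr_pwDr// ler_norm|exists x].
rewrite in_itv/= negb_and -!ltNge => /orP h.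
have := derive1n_smooth_step_eq0 n h; rewrite /= => ->.
by rewrite normr0 addr_ge0.
Qed.

End smooth.

(** * Test functions and their integrals *)

Section test_functions.
Context {R : realType}.
Implicit Types (D : set R) (u v phi f : R -> R).
Local Notation mu := (@lebesgue_measure R).

Lemma test_function_smooth D phi : test_function D phi -> smooth phi.
Proof. by case. Qed.

Lemma test_functionS D D' phi : D `<=` D' ->
  test_function D phi -> test_function D' phi.
Proof.
move=> DD' [sphi [K [cK KD K0]]]; split; first exact: sphi.
by exists K; split => //; exact: subset_trans DD'.
Qed.

Lemma test_function_derive1 D phi :
  test_function D phi -> test_function D (derive1 phi).
Proof.
move=> [sphi [K [cK KD K0]]]; split; first exact: smooth_derive1.
exists K; split => // x Kx.
have oK : open (~` K) by apply: closed_openC; exact: compact_closed.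
rewrite derive1E (@near_eq_derive _ _ _ _ (cst 0)) ?derive_cst//.
have : nbhs x (~` K) by exact: open_nbhs_nbhs.
by apply: filterS => y; exact: K0.
Qed.

Lemma test_functionM D chi phi : smooth chi -> test_function D phi ->
  test_function D (chi \* phi).
Proof.
move=> schi [sphi [K [cK KD K0]]]; split; first exact: smoothM.
by exists K; split => // x Kx; rewrite /= K0// mulr0.
Qed.

Lemma smooth_measurable f (A : set R) : smooth f -> measurable_fun A f.
Proof.
move=> sf; apply: (@measurable_funS _ _ _ _ setT) => //.
by apply: continuous_measurable_fun; exact: smooth_continuous.
Qed.

Lemma test_function_bounded D phi : test_function D phi ->
  exists2 M : R, 0 <= M & forall x : R, `|phi x| <= M.
Proof.
move=> [sphi [K [cK KD K0]]].
have /compact_bounded[M [_ hM]] : compact (phi @` K).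
  apply: continuous_compact => //; apply: continuous_subspaceT.
  exact: smooth_continuous.
exists (`|M| + 1) => [|x]; first by rewrite addr_ge0.
have [Kx|Kx] := pselect (K x).
  by apply: hM; [rewrite ltr_pwDr// ler_norm|exists x].
by rewrite K0// normr0 addr_ge0.
Qed.

Lemma Rintegral_support (D E : set R) f : (forall x, D x -> ~ E x -> f x = 0) ->
  (forall x, E x -> ~ D x -> f x = 0) ->
  (\int[mu]_(x in D) f x = \int[mu]_(x in E) f x)%R.
Proof.
move=> DE ED; rewrite Rintegral_mkcond [RHS]Rintegral_mkcond.
congr (Rintegral _ _ _); apply/funext => x; rewrite !patchE.
case: ifPn => [/set_mem Dx|/negP Dx]; case: ifPn => [/set_mem Ex|/negP Ex] //.
- by apply: DE => // Ex'; apply: Ex; exact: mem_set.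
- by apply/esym; apply: ED => // Dx'; apply: Dx; exact: mem_set.
Qed.

Lemma integrable_supp (D K : set R) f : measurable D -> measurable K ->
  measurable_fun D f -> (forall x, D x -> ~ K x -> f x = 0) ->
  mu.-integrable (D `&` K) (EFin \o f) -> mu.-integrable D (EFin \o f).
Proof.
move=> mD mK mf f0 /integrable_mkcond.
move=> /(_ (measurableI _ _ mD mK)).
move=> h; have := @integrableS _ _ _ mu _ D _ measurableT mD (@subsetT _ _) h.
apply: eq_integrable => // x /set_mem Dx.
rewrite patchE; case: ifPn => // /negP Kx /=.
by rewrite f0// => Kx'; apply: Kx; exact: mem_set.
Qed.

Lemma test_integrable D u phi : locally_integrable D u -> test_function D phi ->
  mu.-integrable D (EFin \o (fun t => u t * phi t)).
Proof.
move=> [mu_ oD iu] tphi; have [M M0 hM] := test_function_bounded tphi.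
have [sphi [K [cK KD K0]]] := tphi.
have mD : measurable D := open_measurable oD.
have mK : measurable K := compact_measurable cK.
apply: (integrable_supp mD mK).
- by apply: measurable_funM => //; exact: smooth_measurable.
- by move=> x Dx Kx; rewrite K0// mulr0.
- rewrite setIidr//.
  have h : mu.-integrable K (EFin \o u).
    apply/integrableP; split; last exact: iu.
    by apply/measurable_EFinP; exact: measurable_funS mu_.
  have := @integrableMl _ _ _ mu K mK (EFin \o u) phi h.
  apply; first exact: smooth_measurable.
  exists M; split; first exact: num_real.
  by move=> x Mx y _; apply: (le_trans (hM y)); exact: ltW.
Qed.

Lemma continuous_FTC (F f : R -> R) a b : a < b ->
  (forall x : R, is_derive x (1 : R) F (f x)) -> continuous f ->
  (\int[mu]_(x in `[a, b]) f x = F b - F a)%R.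
Proof.
move=> ab dF cf; rewrite /Rintegral.
have cF : continuous F.
  move=> x; apply: differentiable_continuous; apply/derivable1_diffP.
  by have [] := dF x.
rewrite (@continuous_FTC2 _ f F)//.
- exact: continuous_subspaceT.
- split; first by move=> x _; have [] := dF x.
  + by apply: cvg_at_right_filter; exact: cF.
  + by apply: cvg_at_left_filter; exact: cF.
- by move=> x _; rewrite derive1E; have [_ ->] := dF x.
Qed.

Lemma Rintegral_derive1_test D phi : test_function D phi ->
  (\int[mu]_(x in D) (derive1 phi x) = 0)%R.
Proof.
move=> tphi; have [sphi [K [cK KD K0]]] := tphi.
have /compact_bounded[M [_ hM]] := cK.
pose N : R := `|M| + 1.
have hN x : K x -> `|x| <= N.
  by move=> Kx; apply: hM => //; rewrite ltr_pwDr// ler_norm.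
have [_ [K' [_ K'D K'0]]] := test_function_derive1 tphi.
have d0 x : ~ K x -> derive1 phi x = 0.
  move=> Kx; have oK : open (~` K) by apply: closed_openC; exact: compact_closed.
  rewrite derive1E (@near_eq_derive _ _ _ _ (cst 0)) ?derive_cst//.
  have : nbhs x (~` K) by exact: open_nbhs_nbhs.
  by apply: filterS => y; exact: K0.
have Nlt x : N < `|x| -> ~ K x by rewrite ltNge => /negP h /hN.
(* The bound [N] of the support is enlarged by 1, so that [phi] vanishes at both ends and the
   fundamental theorem of calculus gives 0. *)
rewrite (@Rintegral_support D `[- (N + 1), N + 1]%classic).
- have dphi (x : R) : is_derive x (1 : R) phi (derive1 phi x).
    by rewrite derive1E; apply: derivableP; exact: (sphi 0%N).
  rewrite (continuous_FTC _ dphi).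
  + rewrite !K0 ?subrr//; apply: Nlt; rewrite ?normrN ger0_norm ?ltrDl//;
      by rewrite !addr_ge0.
  + by rewrite gtrN// !ltr_wpDl// addr_ge0.
  + by apply: smooth_continuous; exact: smooth_derive1.
- move=> x _ /= xN; apply: d0; apply: Nlt; move: xN.
  rewrite in_itv/= -ler_norml => /negP; rewrite -ltNge; apply: lt_trans.
  by rewrite ltrDl.
- by move=> x _ Dx; apply: d0 => /KD.
Qed.

End test_functions.

(** * Local square integrability *)

Section local_square_integrability.
Context {R : realType}.
Implicit Types (D : set R) (u v phi f : R -> R).
Local Notation mu := (@lebesgue_measure R).
Local Notation lsi := locally_square_integrable.

Lemma lsi_locally_integrable D u : open D -> lsi D u -> locally_integrable D u.
Proof.
move=> oD [mu_ hu]; split => // K KD cK.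
have mK : measurable K := compact_measurable cK.
have mKu : measurable_fun K u by apply: measurable_funS mu_ => //; exact: open_measurable.
(* On a set of finite measure, |u| <= 1 + u^2 replaces the Cauchy-Schwarz inequality. *)
apply: (@le_lt_trans _ _ (\int[mu]_(x in K) (1 + (u x) ^+ 2)%:E)%E).
  apply: ge0_le_integral => //=.
  - by apply/measurable_EFinP; exact: measurableT_comp.
  - by apply/measurable_EFinP; apply: measurable_funD => //; exact: measurable_funX.
  - move=> x _; rewrite lee_fin -[u x ^+ 2]real_normK ?num_real//.
    by have := sqr_ge0 (`|u x| - 1); have := normr_ge0 (u x); nra.
under eq_integral do rewrite EFinD.
rewrite ge0_integralD//=.
- rewrite integral_cst// mul1e lte_add_pinfty//; last exact: hu.
  exact: compact_finite_measure.
- by move=> x _; rewrite lee_fin sqr_ge0.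
- by apply/measurable_EFinP; exact: measurable_funX.
Qed.

Lemma lsi_dominated D u v (C : R) : open D -> measurable_fun D v ->
  (forall x, D x -> v x ^+ 2 <= C * u x ^+ 2) -> lsi D u -> lsi D v.
Proof.
move=> oD mv vu [mu_ hu]; split => // K KD cK.
have mK : measurable K := compact_measurable cK.
have mD := open_measurable oD.
have mKu : measurable_fun K u by apply: measurable_funS mu_.
have mKv : measurable_fun K v by apply: measurable_funS mv.
apply: (@le_lt_trans _ _ (\int[mu]_(x in K) (`|C|%:E * (u x ^+ 2)%:E))%E).
  apply: ge0_le_integral => //=.
  - by move=> x _; rewrite lee_fin sqr_ge0.
  - by apply/measurable_EFinP; exact: measurable_funX.
  - apply: measurable_funeM.
    by apply/measurable_EFinP; exact: measurable_funX.
  - move=> x Kx; rewrite -EFinM lee_fin (le_trans (vu _ (KD _ Kx)))//.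
    by rewrite ler_wpM2r ?sqr_ge0// ler_norm.
rewrite ge0_integralZl//.
- by rewrite lte_mul_pinfty//; exact: hu.
- by apply/measurable_EFinP; exact: measurable_funX.
- by move=> x _; rewrite lee_fin sqr_ge0.
Qed.

(** The function sqrt(u^2 + v^2) has an additive square, hence is locally square integrable, and it
    dominates u + v: (u + v)^2 <= 2 (u^2 + v^2). *)
Lemma lsiD D u v : open D -> lsi D u -> lsi D v -> lsi D (u \+ v).
Proof.
move=> oD [mu_ hu] [mv hv].
have mD := open_measurable oD.
have : lsi D (fun x => Num.sqrt (u x ^+ 2 + v x ^+ 2)).
  have muv : measurable_fun D (fun x => u x ^+ 2 + v x ^+ 2).
    by apply: measurable_funD; exact: measurable_funX.
  split.
    apply: (@measurable_comp _ _ _ _ _ _ setT) => //.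
    by apply: continuous_measurable_fun; exact: sqrt_continuous.
  move=> K KD cK.
  have mK : measurable K := compact_measurable cK.
  have mKu : measurable_fun K u by apply: measurable_funS mu_.
  have mKv : measurable_fun K v by apply: measurable_funS mv.
  under eq_integral do rewrite sqr_sqrtr ?addr_ge0 ?sqr_ge0// EFinD.
  rewrite ge0_integralD//=.
  - by rewrite lte_add_pinfty//; [exact: hu|exact: hv].
  - by move=> x _; rewrite lee_fin sqr_ge0.
  - by apply/measurable_EFinP; exact: measurable_funX.
  - by move=> x _; rewrite lee_fin sqr_ge0.
  - by apply/measurable_EFinP; exact: measurable_funX.
apply: (@lsi_dominated D _ _ 2) => //; first exact: measurable_funD.
move=> x _; rewrite sqr_sqrtr ?addr_ge0 ?sqr_ge0//=.
by have := sqr_ge0 (u x - v x); nra.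
Qed.

Lemma lsi_boundedM D u (f : R -> R) : open D -> measurable_fun D f ->
  (exists M, forall x, `|f x| <= M) -> lsi D u -> lsi D (u \* f).
Proof.
move=> oD mf [M fM] lu; have [mu_ _] := lu.
apply: (@lsi_dominated D u _ (M ^+ 2)) => //; first exact: measurable_funM.
move=> x _; rewrite /= exprMn mulrC ler_wpM2r ?sqr_ge0//.
rewrite -[f x ^+ 2]real_normK ?num_real// lerXn2r// ?nnegrE//.
exact: le_trans (fM x).
Qed.

Lemma lsi_cst D (c : R) : open D -> lsi D (cst c).
Proof.
move=> oD; split => // K KD cK.
rewrite -[ltLHS]/(\int[mu]_(t in K) (cst (c ^+ 2)%:E t))%E.
rewrite integral_cst; last exact: compact_measurable.
by rewrite lte_mul_pinfty ?lee_fin ?sqr_ge0//; exact: compact_finite_measure.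
Qed.

Lemma lsi_bounded D (f : R -> R) : open D -> measurable_fun D f ->
  (exists M, forall x, `|f x| <= M) -> lsi D f.
Proof.
move=> oD mf Mf; have := lsi_boundedM oD mf Mf (lsi_cst 1 oD).
by congr lsi; apply/funext => x; rewrite /= mul1r.
Qed.

Lemma lsiS D D' u : open D -> D' `<=` D -> measurable D' -> lsi D u -> lsi D' u.
Proof.
move=> oD D'D mD' [mu_ hu]; split.
  by apply: measurable_funS mu_ => //; exact: open_measurable.
by move=> K KD' cK; apply: hu => //; exact: subset_trans D'D.
Qed.

Lemma lsi_extend D K u : open D -> K `<=` D -> compact K ->
  (forall x, ~ K x -> u x = 0) -> lsi D u -> lsi setT u.
Proof.
move=> oD KD cK u0 [mu_ hu].
have mK : measurable K := compact_measurable cK.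
have mD := open_measurable oD.
have mKu : measurable_fun K u by apply: measurable_funS mu_.
split.
  have := (measurable_restrictT u mK).1 mKu.
  congr measurable_fun; apply/funext => x; rewrite patchE.
  case: ifPn => // /negP Kx; rewrite u0// => Kx'.
  by apply: Kx; exact: mem_set.
move=> L _ cL; have mL : measurable L := compact_measurable cL.
apply: (@le_lt_trans _ _ (\int[mu]_(x in K) ((u x) ^+ 2)%:E)%E); last exact: hu.
rewrite integral_mkcond [leRHS]integral_mkcond.
have -> : (fun x => ((u x) ^+ 2)%:E) \_ L =
   (fun x => (((u x) ^+ 2)%:E)) \_ (L `&` K).
  apply/funext => x; rewrite !patchE in_setI.
  case: (x \in L) => //=; case: ifPn => // /negP Kx.
  by rewrite u0 ?expr0n// => Kx'; apply: Kx; exact: mem_set.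
rewrite -[leLHS]integral_mkcond -[leRHS]integral_mkcond.
apply: ge0_subset_integral => //.
- exact: measurableI.
- by apply/measurable_EFinP; exact: measurable_funX.
- by move=> x _; rewrite lee_fin sqr_ge0.
Qed.

Lemma square_integrable_lsi D u : open D -> square_integrable D u -> lsi D u.
Proof.
move=> oD [mu_ hu]; split => // K KD cK; apply: le_lt_trans hu.
apply: ge0_subset_integral => //.
- exact: compact_measurable.
- exact: open_measurable.
- by apply/measurable_EFinP; exact: measurable_funX.
- by move=> x _; rewrite lee_fin sqr_ge0.
Qed.

Lemma lsi_square_integrable a b u : lsi setT u -> square_integrable `]a, b[ u.
Proof.
move=> [mu_ hu]; split; first by apply: measurable_funS mu_.
apply: (@le_lt_trans _ _ (\int[mu]_(x in `[a, b]) ((u x) ^+ 2)%:E)%E).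
  apply: ge0_subset_integral => //.
  - by apply/measurable_EFinP; apply: measurable_funX; apply: measurable_funS mu_.
  - by move=> x _; rewrite lee_fin sqr_ge0.
  - by move=> x /=; exact: subset_itv_oo_cc.
by apply: hu => //; exact: segment_compact.
Qed.

End local_square_integrability.

(** * Chains of first-order weak derivatives *)

Section weak_chains.
Context {R : realType}.
Implicit Types (D : set R) (u v w phi f : R -> R) (y z : nat -> R -> R).
Local Notation mu := (@lebesgue_measure R).
Local Notation lsi := locally_square_integrable.

Definition weak_derivative1 D u v := forall phi, test_function D phi ->
  (\int[mu]_(t in D) (u t * derive1 phi t) =
   - \int[mu]_(t in D) (v t * phi t))%R.

(* Working with all the intermediate derivatives turns k-th order weak derivatives into
   first-order ones. *)
Definition weak_chain D k z :=
  (forall j, (j <= k)%N -> lsi D (z j)) /\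
  (forall j, (j < k)%N -> weak_derivative1 D (z j) (z j.+1)).

Lemma weak_chain_is_weak_derivative D k j z : open D -> (j <= k)%N ->
  weak_chain D k z -> is_weak_derivative D j (z 0%N) (z j).
Proof.
move=> oD jk [lz dz]; split.
- by apply: lsi_locally_integrable => //; exact: lz.
- by apply: lsi_locally_integrable => //; exact: lz.
move=> phi; elim: j jk phi => [|j ih] jk phi tphi.
  by rewrite expr0 mul1r.
have -> : derive1n j.+1 phi = derive1n j (derive1 phi) by rewrite /derive1n iterSr.
rewrite ih//; [|exact: ltnW|exact: test_function_derive1].
by rewrite dz// mulrN exprS mulN1r mulNr.
Qed.

(** The same integral of u against the derivative of order j + 1 of [phi] is read once as a j-th
    derivative tested with phi' and once as a derivative of order j + 1 tested with [phi]. *)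
Lemma is_weak_derivative_step D j u v w : open D ->
  is_weak_derivative D j u v -> is_weak_derivative D j.+1 u w ->
  weak_derivative1 D v w.
Proof.
move=> oD [_ _ hv] [_ _ hw] phi tphi.
have /= h1 := hv _ (test_function_derive1 tphi).
have h2 := hw _ tphi.
move: h2; rewrite (_ : derive1n j.+1 phi = derive1n j (derive1 phi)); last first.
  by rewrite /derive1n iterSr.
rewrite h1 exprS mulN1r mulNr -mulrN; apply: mulfI.
by rewrite signr_eq0.
Qed.

Lemma weak_derivative1D D u v u' v' : open D ->
  lsi D u -> lsi D v -> lsi D u' -> lsi D v' ->
  weak_derivative1 D u v -> weak_derivative1 D u' v' ->
  weak_derivative1 D (u \+ u') (v \+ v').
Proof.
move=> oD lu lv lu' lv' h h' phi tphi.
have mD := open_measurable oD.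
have ti w : lsi D w -> mu.-integrable D (EFin \o (fun t => w t * phi t)).
  by move=> lw; apply: test_integrable => //; exact: lsi_locally_integrable.
have ti' w : lsi D w -> mu.-integrable D (EFin \o (fun t => w t * derive1 phi t)).
  move=> lw; apply: test_integrable; first exact: lsi_locally_integrable.
  exact: test_function_derive1.
under eq_Rintegral do rewrite /= mulrDl.
under [in RHS]eq_Rintegral do rewrite /= mulrDl.
rewrite RintegralD//; [|exact: ti'..].
rewrite [X in - X]RintegralD//; [|exact: ti..].
by rewrite h// h'// opprD.
Qed.

Lemma weak_derivative1Z D u v c : open D -> lsi D u -> lsi D v ->
  weak_derivative1 D u v ->
  weak_derivative1 D (fun x => c * u x) (fun x => c * v x).
Proof.
move=> oD lu lv h phi tphi.
have mD := open_measurable oD.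
under eq_Rintegral do rewrite /= -mulrA.
under [in RHS]eq_Rintegral do rewrite /= -mulrA.
rewrite RintegralZl//; last first.
  apply: test_integrable; first exact: lsi_locally_integrable.
  exact: test_function_derive1.
rewrite [X in - X]RintegralZl//; last first.
  by apply: test_integrable => //; exact: lsi_locally_integrable.
by rewrite h// mulrN.
Qed.

Lemma lsiZ D u c : open D -> lsi D u -> lsi D (fun x => c * u x).
Proof.
move=> oD lu; have [mu_ _] := lu.
apply: (@lsi_dominated _ D u _ (c ^+ 2)) => //; last by move=> x _; rewrite exprMn.
by apply: measurable_funM.
Qed.

Lemma weak_chainD D k y z : open D -> weak_chain D k y -> weak_chain D k z ->
  weak_chain D k (fun j => y j \+ z j).
Proof.
move=> oD [ly dy] [lz dz]; split => j jk; first by apply: lsiD; [|exact: ly|exact: lz].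
have jk' := ltnW jk.
by apply: weak_derivative1D; [|exact: ly|exact: ly|exact: lz|exact: lz|exact: dy|exact: dz].
Qed.

Lemma weak_chain0 D k : open D -> weak_chain D k (fun=> cst 0).
Proof.
move=> oD; split => [j _|j _ phi _]; first exact: lsi_cst.
under eq_Rintegral do rewrite /= mul0r.
under [in RHS]eq_Rintegral do rewrite /= mul0r.
by rewrite Rintegral_cst ?mul0r ?oppr0//; exact: open_measurable.
Qed.

Lemma weak_chainS D D' k z : open D -> open D' -> D' `<=` D ->
  weak_chain D k z -> weak_chain D' k z.
Proof.
move=> oD oD' D'D [lz dz]; split => j jk.
  by apply: lsiS (lz _ jk) => //; exact: open_measurable.
move=> phi tphi; have [_ [K [cK KD' K0]]] := tphi.
have [_ [K' [_ K'D' K'0]]] := test_function_derive1 tphi.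
have := dz _ jk _ (test_functionS D'D tphi).
rewrite (@Rintegral_support _ D D'); first last.
- by move=> x /D'D.
- by move=> x _ D'x; rewrite K'0 ?mulr0// => /K'D'.
rewrite [in RHS](@Rintegral_support _ D D')//; first last.
- by move=> x /D'D.
- by move=> x _ D'x; rewrite K0 ?mulr0// => /KD'.
Qed.

(** The product of [H] with a test function is a test function, and its derivative has integral
    0. *)
Lemma weak_derivative1_smooth D (H : R -> R) : open D -> smooth H ->
  (exists M, forall x, `|H x| <= M) -> (exists M, forall x, `|derive1 H x| <= M) ->
  weak_derivative1 D H (derive1 H).
Proof.
move=> oD sH bH bH' phi tphi.
have mD := open_measurable oD.
have lH : lsi D H by apply: lsi_bounded => //; exact: smooth_measurable.
have lH' : lsi D (derive1 H).
  by apply: lsi_bounded => //; apply: smooth_measurable; exact: smooth_derive1.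
have := Rintegral_derive1_test (test_functionM sH tphi).
have sphi := test_function_smooth tphi.
have -> : derive1 (H \* phi) = (fun x => derive1 H x * phi x + H x * derive1 phi x).
  have := smooth_derive1nM 1 sH sphi; rewrite derive1n1 => ->.
  apply/funext => x; rewrite /leibniz big_ord_recl big_ord1/= !bin0 binn !mulr1n.
  by rewrite /bump/= addrC.
rewrite RintegralD//; last 2 first.
- by apply: test_integrable => //; exact: lsi_locally_integrable.
- apply: test_integrable; first exact: lsi_locally_integrable.
  exact: test_function_derive1.
by move=> /eqP; rewrite addrC addr_eq0 => /eqP.
Qed.

Lemma weak_chain_smooth D k (H : R -> R) : open D -> smooth H ->
  (forall n, exists M, forall x, `|derive1n n H x| <= M) ->
  weak_chain D k (fun n => derive1n n H).
Proof.
move=> oD sH bH; split => j _.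
  by apply: lsi_bounded => //; apply: smooth_measurable; exact: smooth_derive1n.
exact: (@weak_derivative1_smooth D _ oD (@smooth_derive1n _ H j sH) (bH j) (bH j.+1)).
Qed.

Lemma weak_chain_cst D k (c : R) : open D ->
  weak_chain D k (fun n => cst (if n is 0%N then c else 0)).
Proof.
move=> oD; have := @weak_chain_smooth D k (cst c) oD (@smooth_cst _ c).
have e n : derive1n n (cst c : R -> R) = cst (if n is 0%N then c else 0).
  elim: n => // n ih; rewrite derive1nS ih; apply/funext => x.
  by rewrite derive1_cst.
rewrite (_ : (fun n => derive1n n _) = (fun n => cst (if n is 0%N then c else 0))).
  by apply => n; rewrite e; exists `|if n is 0%N then c else 0|.
by apply/funext => n; rewrite e.
Qed.

Lemma smooth_compact_test D (f phi : R -> R) : smooth f -> test_function D phi ->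
  test_function D (phi \* f).
Proof.
move=> sf tphi; have [sphi [K [cK KD K0]]] := tphi.
by split; [exact: smoothM|exists K; split => // x Kx; rewrite /= K0// mul0r].
Qed.

(** The weak derivative of u is tested with the product of [X] and [phi]. As [X] has compact support
    in [D], the resulting relation holds on the whole line and for test functions with no support
    condition relative to [D]. *)
Lemma weak_derivative1M D u v (X : R -> R) : open D -> lsi D u -> lsi D v ->
  weak_derivative1 D u v -> test_function D X ->
  weak_derivative1 setT (u \* X) (fun x => v x * X x + u x * derive1 X x).
Proof.
move=> oD lu lv h tX phi tphi.
have mD := open_measurable oD.
have tX' := test_function_derive1 tX.
have [sX [K [cK KD K0]]] := tX.
have [sX' [K' [cK' K'D K'0]]] := tX'.
have sphi := test_function_smooth tphi.
have sphi' : smooth (derive1 phi) := smooth_derive1 sphi.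
have := h _ (smooth_compact_test sphi tX).
have -> : derive1 (X \* phi) = (fun x => derive1 X x * phi x + X x * derive1 phi x).
  have := smooth_derive1nM 1 sX sphi; rewrite derive1n1 => ->.
  apply/funext => x; rewrite /leibniz big_ord_recl big_ord1/= !bin0 binn !mulr1n.
  by rewrite /bump/= addrC.
under eq_Rintegral do rewrite mulrDr.
have lIu := lsi_locally_integrable oD lu; have lIv := lsi_locally_integrable oD lv.
have i1 : mu.-integrable D (EFin \o (fun t => u t * (derive1 X t * phi t))).
  by apply: test_integrable; [exact: lIu|exact: smooth_compact_test].
have i2 : mu.-integrable D (EFin \o (fun t => u t * (X t * derive1 phi t))).
  by apply: test_integrable; [exact: lIu|exact: smooth_compact_test].
have i3 : mu.-integrable D (EFin \o (fun t => v t * (X t * phi t))).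
  by apply: test_integrable; [exact: lIv|exact: smooth_compact_test].
rewrite RintegralD// => {}h.
rewrite (@Rintegral_support _ setT D)//=; last first.
  by move=> x _ Dx; rewrite K0 ?mulr0 ?mul0r// => /KD.
rewrite [in RHS](@Rintegral_support _ setT D)//=; last first.
  by move=> x _ Dx; rewrite K0 ?K'0 ?mulr0 ?addr0 ?mul0r//; [move=> /K'D|move=> /KD].
under eq_Rintegral do rewrite /= -mulrA.
under [in RHS]eq_Rintegral do rewrite /= mulrDl -!mulrA.
rewrite [X in - X]RintegralD//.
rewrite opprD -[X in _ = X - _]h.
by rewrite [X in _ = X - _]addrC addrK.
Qed.

Lemma weak_derivative1_sum D n (u v : 'I_n -> R -> R) : open D ->
  (forall i, lsi D (u i)) -> (forall i, lsi D (v i)) ->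
  (forall i, weak_derivative1 D (u i) (v i)) ->
  lsi D (fun x => \sum_(i < n) u i x) /\
  weak_derivative1 D (fun x => \sum_(i < n) u i x) (fun x => \sum_(i < n) v i x).
Proof.
move=> oD lu lv h.
suff [] : [/\ lsi D (fun x => \sum_(i < n) u i x), lsi D (fun x => \sum_(i < n) v i x) &
  weak_derivative1 D (fun x => \sum_(i < n) u i x) (fun x => \sum_(i < n) v i x)] by [].
elim: n u v lu lv h => [|n ih] u v lu lv h.
  have -> : (fun x => \sum_(i < 0) u i x) = cst 0.
    by apply/funext => x; rewrite big_ord0.
  have -> : (fun x => \sum_(i < 0) v i x) = cst 0.
    by apply/funext => x; rewrite big_ord0.
  have [l0 d0] := weak_chain0 1 oD.
  by split; [exact: (l0 0%N)|exact: (l0 0%N)|exact: (d0 0%N)].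
have [l1 l2 l3] := ih (fun i => u (lift ord0 i)) (fun i => v (lift ord0 i))
  (fun i => lu _) (fun i => lv _) (fun i => h _).
have e (w : 'I_n.+1 -> R -> R) : (fun x => \sum_(i < n.+1) w i x) =
    w ord0 \+ (fun x => \sum_(i < n) w (lift ord0 i) x).
  by apply/funext => x; rewrite big_ord_recl.
rewrite !e.
by split; [exact: lsiD|exact: lsiD|exact: weak_derivative1D].
Qed.

(** Cutting off inside [D] moves a chain from [D] to the whole line, which is where the competitors
    for m_k live. *)
Lemma weak_chain_leibniz D k y (X : R -> R) : open D -> weak_chain D k y ->
  test_function D X -> weak_chain setT k (leibniz y (fun n => derive1n n X)).
Proof.
move=> oD [ly dy] tX.
have tXn n : test_function D (derive1n n X).
  by elim: n => // n ih; rewrite derive1nS; exact: test_function_derive1.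
have lyX i n : (i <= k)%N -> lsi setT (y i \* derive1n n X).
  move=> ik; have [sX [K [cK KD K0]]] := tXn n.
  apply: (lsi_extend oD KD cK); first by move=> x Kx; rewrite /= K0// mulr0.
  apply: lsi_boundedM => //; first exact: smooth_measurable.
    by have [M _ hM] := test_function_bounded (tXn n); exists M.
  exact: ly.
have lyXC i n m : (i <= k)%N -> lsi setT (fun x => y i x * derive1n n X x *+ m).
  move=> ik; under eq_fun do rewrite -mulr_natl.
  by apply: lsiZ; [exact: openT|exact: lyX].
have dyX (j : nat) (i : 'I_j.+1) : (j < k)%N ->
  weak_derivative1 setT (fun x => y i x * derive1n (j - i) X x *+ 'C(j, i))
    (fun x => (y i.+1 x * derive1n (j - i) X x + y i x * derive1n (j - i).+1 X x)
               *+ 'C(j, i)).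
  move=> jk; have ik : (i < k)%N by rewrite (leq_ltn_trans _ jk)// -ltnS.
  have e (f : R -> R) m : (fun x => f x *+ m) = (fun x => m%:R * f x).
    by apply/funext => x; rewrite mulr_natl.
  rewrite !e.
  apply: weak_derivative1Z; [exact: openT|exact/lyX/ltnW| |].
    by apply: lsiD; [exact: openT|exact: lyX|exact/lyX/ltnW].
  exact: (@weak_derivative1M D (y i) (y i.+1) (derive1n (j - i) X) oD
    (ly _ (ltnW ik)) (ly _ ik) (dy _ ik) (tXn _)).
split => j jk.
  (* The order [n] is separated from the number of summands, so that the induction on the latter
     goes through. *)
  rewrite /leibniz; suff /(_ j) : forall n, lsi setT (fun x => \sum_(i < j.+1)
     y i x * derive1n (n - i) X x *+ 'C(n, i)) by [].
  move=> n; elim: j jk => [|j ih] jk.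
    by under eq_fun do rewrite big_ord1; exact: lyXC.
  under eq_fun do rewrite big_ord_recr/=; apply: lsiD; first exact: openT.
    exact/ih/ltnW.
  exact: lyXC.
have [||_] := @weak_derivative1_sum setT j.+1
  (fun i x => y i x * derive1n (j - i) X x *+ 'C(j, i))
  (fun i x => (y i.+1 x * derive1n (j - i) X x + y i x * derive1n (j - i).+1 X x)
     *+ 'C(j, i)) openT _ _ (fun i => dyX j i jk).
- by move=> i; apply: lyXC; rewrite (leq_trans _ (ltnW jk))// -ltnS.
- move=> i; under eq_fun do rewrite mulrnDl.
  have ik : (i < k)%N by rewrite (leq_ltn_trans _ jk)// -ltnS.
  by apply: lsiD; [exact: openT|apply: lyXC..] => //; exact: ltnW.
have -> : leibniz y (fun n => derive1n n X) j.+1 = (fun x => \sum_(i < j.+1)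
  (y i.+1 x * derive1n (j - i) X x + y i x * derive1n (j - i).+1 X x) *+ 'C(j, i)).
  apply/funext => x; rewrite /leibniz.
  by rewrite -(leibniz_step (y ^~ x) (fun n => derive1n n X x)).
by [].
Qed.

End weak_chains.

(** * Affine changes of variables *)

Section affine_change_of_variables.
Context {R : realType}.
Implicit Types (D : set R) (c d : R).
Local Notation mu := (@lebesgue_measure R).

Definition affine c d (t : R) : R := c * t + d.

Lemma affine_smooth c d : smooth (affine c d).
Proof.
have sid : smooth (id : R -> R).
  apply: (@smooth_coind _ [set f | f = id \/ exists e, f = cst e]); last by left.
  move=> _ [->|[e ->]].
    by exists (cst 1); [right; exists 1|move=> x; exact: is_derive_id].
  by exists (cst 0); [right; exists 0|move=> x; exact: is_derive_cst].
exact: (smooth_affine sid).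
Qed.

Lemma measurable_affine c d (A : set R) : measurable_fun A (affine c d).
Proof. by apply: smooth_measurable; exact: affine_smooth. Qed.

Lemma continuous_affine c d : continuous (affine c d).
Proof. by apply: smooth_continuous; exact: affine_smooth. Qed.

Lemma affineK c d : c != 0 -> cancel (affine c d) (affine c^-1 (- (c^-1 * d))).
Proof. by move=> c0 x; rewrite /affine; field. Qed.

Lemma affineVK c d : c != 0 -> cancel (affine c^-1 (- (c^-1 * d))) (affine c d).
Proof. by move=> c0 x; rewrite /affine; field. Qed.

Lemma measurable_preimage_affine c d D : measurable D ->
  measurable (affine c d @^-1` D).
Proof.
by move=> mD; rewrite -[X in measurable X]setTI; exact: measurable_affine.
Qed.

(** Lebesgue measure is determined by its values on half-open intervals, and |c| times the image
    measure has the right ones. For c < 0 the preimage is closed on the other side, which does not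
    change its length. *)
Lemma lebesgue_measure_affine c d (A : set R) : c != 0 -> measurable A ->
  mu (affine c d @^-1` A) = (`|c|^-1%:E * mu A)%E.
Proof.
move=> c0 mA; have mT : measurable_fun setT (affine c d : measurableTypeR R -> measurableTypeR R).
  exact: measurable_affine.
have nc0 : 0 < `|c| by rewrite normr_gt0.
suff -> : mu A = (mscale (NngNum (normr_ge0 c)) (@pushforward _ _ (measurableTypeR R) (measurableTypeR R) R mu (affine c d))) A.
  by rewrite /mscale/= muleA -EFinM mulVf ?gt_eqF// mul1e.
move=> m; refine (@lebesgue_measure_unique R (mscale (NngNum (normr_ge0 c)) (@pushforward _ _ (measurableTypeR R) (measurableTypeR R) R mu (affine c d))) _ A mA) => _ [[p q] _ <-].
rewrite -[RHS]/(`|c|%:E * mu (affine c d @^-1` `]p, q]%classic))%E.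
have [cpos|cneg|ceq] := ltgtP 0 c; last by rewrite -ceq eqxx in c0.
- have -> : affine c d @^-1` `]p, q] = `](p - d) / c, (q - d) / c]%classic.
    apply/seteqP; split => x; rewrite /= !in_itv/= /affine => /andP[h1 h2];
      rewrite ?ltr_pdivrMr ?ler_pdivlMr// in h1 h2 *; lra.
  rewrite !lebesgue_measure_itv/= !lte_fin ltr_pM2r ?invr_gt0// ltrD2r.
  case: ifPn => // pq; rewrite ?mule0// -!EFinD -EFinM gtr0_norm//.
  by congr EFin; field; rewrite gt_eqF.
- have -> : affine c d @^-1` `]p, q] = `[(q - d) / c, (p - d) / c[%classic.
    apply/seteqP; split => x; rewrite /= !in_itv/= /affine => /andP[h1 h2];
      rewrite ?ltr_ndivlMr ?ler_ndivrMr// in h1 h2 *; lra.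
  rewrite !lebesgue_measure_itv/= !lte_fin ltr_nM2r ?invr_lt0// ltrD2r.
  case: ifPn => // pq; rewrite ?mule0// -!EFinD -EFinM ltr0_norm//.
  by congr EFin; field; rewrite lt_eqF.
Qed.

Lemma ge0_integral_affine c d D (f : R -> \bar R) : c != 0 -> measurable D ->
  measurable_fun D f -> (forall x, D x -> (0 <= f x)%E) ->
  (\int[mu]_(t in affine c d @^-1` D) f (affine c d t) =
   `|c|^-1%:E * \int[mu]_(x in D) f x)%E.
Proof.
move=> c0 mD mf f0.
have mT : measurable_fun setT (affine c d : measurableTypeR R -> measurableTypeR R).
  exact: measurable_affine.
have nc0 : 0 <= `|c|^-1 by rewrite invr_ge0.
rewrite -(@ge0_integral_mscale _ _ _ mu D mD (NngNum nc0))//.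
rewrite -(@ge0_integral_pushforward _ _ _ _ R _ mT (@lebesgue_measure R) D f)//; last first.
  by move=> y /set_mem; exact: f0.
apply: eq_measure_integral => A mA _ /=.
by rewrite /pushforward /mscale/= lebesgue_measure_affine.
Qed.

Lemma Rintegral_affine c d D (f : R -> R) : c != 0 -> measurable D ->
  mu.-integrable D (EFin \o f) ->
  \int[mu]_(t in affine c d @^-1` D) f (affine c d t) =
  `|c|^-1 * \int[mu]_(x in D) f x.
Proof.
move=> c0 mD intf; have /measurable_int mf := intf.
rewrite /Rintegral integralE [in RHS]integralE.
have e1 := @ge0_integral_affine c d D (EFin \o f)^\+%E c0 mD
  (measurable_funepos mf) (fun x _ => funepos_ge0 _ x).
have e2 := @ge0_integral_affine c d D (EFin \o f)^\-%E c0 mD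
  (measurable_funeneg mf) (fun x _ => funeneg_ge0 _ x).
have fp := @integrable_pos_fin_num _ _ _ mu D mD _ intf.
have fn := @integrable_neg_fin_num _ _ _ mu D mD _ intf.
transitivity (fine (`|c|^-1%:E * \int[mu]_(x in D) (EFin \o f)^\+ x -
    `|c|^-1%:E * \int[mu]_(x in D) (EFin \o f)^\- x)%E); last first.
  by rewrite -(fineK fp) -(fineK fn) -!EFinM -!EFinB/= mulrBr.
rewrite -e1 -e2; congr (fine (_ - _)%E).
- by apply: eq_integral => t _; rewrite -[fun=> _]/((EFin \o f) \o affine c d) funepos_comp.
- by apply: eq_integral => t _; rewrite -[fun=> _]/((EFin \o f) \o affine c d) funeneg_comp.
Qed.

Lemma open_preimage_affine c d D : open D -> open (affine c d @^-1` D).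
Proof. by move=> oD; apply: open_comp => // x _; exact: continuous_affine. Qed.

Lemma lsi_affine c d D (u : R -> R) : c != 0 -> open D ->
  locally_square_integrable D u ->
  locally_square_integrable (affine c d @^-1` D) (u \o affine c d).
Proof.
move=> c0 oD [mu_ hu]; have mD := open_measurable oD; split.
  apply: (@measurable_comp _ _ _ _ _ _ D) => //.
    by move=> _ [t Dt <-].
  exact: measurable_affine.
move=> K KD cK; pose L := affine c^-1 (- (c^-1 * d)) @^-1` K.
have KL : K = affine c d @^-1` L.
  by apply/seteqP; split => x; rewrite /L/= affineK.
have LE : L = affine c d @` K.
  apply/seteqP; split => x.
    by move=> Lx; exists (affine c^-1 (- (c^-1 * d)) x) => //; exact: affineVK.
  by move=> [y Ky <-]; rewrite /L/= affineK.
have cL : compact L.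
  rewrite LE; apply: continuous_compact => //; apply: continuous_subspaceT.
  exact: continuous_affine.
have LD : L `<=` D by rewrite LE => _ [y /KD Dy <-].
have mL : measurable L := compact_measurable cL.
rewrite KL (@ge0_integral_affine c d L (fun x => (u x ^+ 2)%:E))//.
- by rewrite lte_mul_pinfty// hu.
- by apply/measurable_EFinP; apply: measurable_funX; apply: measurable_funS mu_.
- by move=> x _; rewrite lee_fin sqr_ge0.
Qed.

Lemma test_function_affine c d D (phi : R -> R) : c != 0 ->
  test_function D phi -> test_function (affine c d @^-1` D) (phi \o affine c d).
Proof.
move=> c0 [sphi [K [cK KD K0]]]; split; first exact: (smooth_affine sphi).
exists (affine c^-1 (- (c^-1 * d)) @` K); split.
- apply: continuous_compact => //; apply: continuous_subspaceT.
  exact: continuous_affine.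
- by move=> _ [y Ky <-]; rewrite /= affineVK//; exact: KD.
- move=> x Kx; rewrite /= K0// => h; apply: Kx.
  by exists (affine c d x) => //; exact: affineK.
Qed.

(** The powers of c are those of the chain rule. A test function on the preimage is transported to
    [D] by the inverse affine map. *)
Lemma weak_chain_affine c d D k z : c != 0 -> open D -> weak_chain D k z ->
  weak_chain (affine c d @^-1` D) k (fun j t => c ^+ j * z j (affine c d t)).
Proof.
move=> c0 oD [lz dz]; have mD := open_measurable oD.
have oD' := @open_preimage_affine c d D oD.
split => j jk.
  by apply: lsiZ => //; apply: lsi_affine => //; exact: lz.
move=> phi tphi.
pose psi := phi \o affine c^-1 (- (c^-1 * d)).
have sphi := test_function_smooth tphi.
have tpsi : test_function D psi.
  have cV0 : c^-1 != 0 by rewrite invr_eq0.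
  have := @test_function_affine c^-1 (- (c^-1 * d)) _ _ cV0 tphi.
  by congr test_function; apply/seteqP; split => x /=; rewrite affineVK.
have dpsi x : derive1 phi x = c * derive1 psi (affine c d x).
  have : is_derive (affine c d x) (1 : R) psi
      (c^-1 * derive1 phi (affine c^-1 (- (c^-1 * d)) (affine c d x))).
    by apply: derive1_affine; exact: (sphi 0%N).
  by rewrite affineK// => -[_ h]; rewrite [derive1 psi _]derive1E h mulrA divff// mul1r.
have phiE x : phi x = psi (affine c d x) by rewrite /psi/= affineK.
under eq_Rintegral do rewrite dpsi mulrACA -exprSr.
under [in RHS]eq_Rintegral do rewrite phiE -mulrA.
have lI i (ik : (i <= k)%N) := lsi_locally_integrable oD (lz _ ik).
have i1 : mu.-integrable D (EFin \o (fun x => z j x * derive1 psi x)).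
  by apply: test_integrable; [exact/lI/ltnW|exact: test_function_derive1].
have i2 : mu.-integrable D (EFin \o (fun x => z j.+1 x * psi x)).
  by apply: test_integrable; [exact/lI|].
have h C f : mu.-integrable D (EFin \o f) ->
  \int[mu]_(t in affine c d @^-1` D) (C * f (affine c d t)) =
  `|c|^-1 * (C * \int[mu]_(x in D) f x).
  move=> intf; rewrite -RintegralZl//.
  rewrite (@Rintegral_affine c d D (fun x => C * f x))//.
  by have := @integrableZl _ _ _ mu D mD C _ intf.
rewrite (h _ (fun x => z j x * derive1 psi x))//.
rewrite (h _ (fun x => z j.+1 x * psi x))//.
by rewrite dz// !mulrN.
Qed.

End affine_change_of_variables.

(** * Continuous representatives *)

Section du_bois_reymond.
Context {R : realType}.
Implicit Types (D : set R) (u v F G : R -> R) (p q s t h : R).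
Local Notation mu := (@lebesgue_measure R).
Local Notation psi := (@smooth_step R).

Lemma Rintegral_supportT (E : set R) (f : R -> R) : (forall x, ~ E x -> f x = 0) ->
  \int[mu]_x f x = \int[mu]_(x in E) f x.
Proof.
by move=> f0; apply: Rintegral_support => x h; [exact: f0|move=> /(_ I)].
Qed.

Lemma smooth_is_derive (f : R -> R) (x : R) : smooth f -> is_derive x (1 : R) f (derive1 f x).
Proof. by move=> sf; rewrite derive1E; apply: derivableP; exact: (sf 0%N). Qed.

(** For h > 0 it rises from 0 to 1 across [s, s + h], so its derivative is a mollifier of mass 1
    that concentrates at s from the right. *)
Let step s h : R -> R := psi \o affine h^-1 (- (h^-1 * s)).

Let stepE s h x : step s h x = psi ((x - s) / h).
Proof. by rewrite /step /affine/=; congr psi; ring. Qed.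

Let smooth_step_comp s h : smooth (step s h).
Proof. exact: (smooth_affine (@smooth_smooth_step R)). Qed.

Let derive1_step s h x : derive1 (step s h) x = h^-1 * derive1 psi ((x - s) / h).
Proof.
have d : is_derive x (1 : R) (step s h) (h^-1 * derive1 psi (h^-1 * x + - (h^-1 * s))).
  by apply: derive1_affine; exact: (@smooth_smooth_step R 0%N).
have [_ e] := d; rewrite [LHS]derive1E e.
by rewrite -[h^-1 * x - _]mulrBr [h^-1 * (x - s)]mulrC.
Qed.

Let derive1_step0 s h x : 0 < h -> ~ `[s, s + h]%classic x -> derive1 (step s h) x = 0.
Proof.
move=> h0; rewrite /= in_itv/= => /negP; rewrite negb_and -!ltNge => /orP xs.
rewrite derive1_step -derive1n1 derive1n_smooth_step_eq0 ?mulr0//.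
rewrite ltr_pdivlMr// ltr_pdivrMr// mul1r mul0r.
by case: xs => xs; [left|right]; lra.
Qed.

Let Rintegral_derive1_step s h : 0 < h -> \int[mu]_x derive1 (step s h) x = 1.
Proof.
move=> h0; rewrite (@Rintegral_supportT `[s, s + h]%classic); last first.
  by move=> x; exact: derive1_step0.
have dstep (x : R) : is_derive x (1 : R) (step s h) (derive1 (step s h) x).
  by apply: smooth_is_derive; exact: smooth_step_comp.
rewrite (continuous_FTC _ dstep) ?ltrDl//; last first.
  by apply: smooth_continuous; apply: smooth_derive1; exact: smooth_step_comp.
have -> : step s h s = 0 by rewrite stepE subrr mul0r smooth_step_le0.
rewrite subr0 stepE smooth_step_ge1//.
by rewrite addrC addKr divff// gt_eqF.
Qed.

(** The kernel has mass 1, is bounded by K / h, and is supported in the open ball of radius 2h about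
    s. The error is thus at most K / h times the integral of |F - F(s)| over a ball of measure 4h,
    which is 4K times its average there. *)
Let mollify_le F s h : 0 < h -> mu.-integrable setT (EFin \o F) ->
  exists a : R, [/\ davg F s (2 * h) = a%:E &
  forall K : R, (forall x, `|derive1 psi x| <= K) ->
  `|\int[mu]_x (F x * derive1 (step s h) x) - F s| <= 4 * K * a].
Proof.
move=> h0 iF.
have h20 : 0 < 2 * h by rewrite mulr_gt0.
have mF : measurable_fun setT F by apply/measurable_EFinP; exact: measurable_int iF.
have mB := @measurable_ball R s (2 * h).
have muB : mu (ball s (2 * h)) = (4 * h)%:E.
  rewrite lebesgue_measure_ball ?(ltW h20)//; congr EFin.
  by rewrite -mulr_natr; ring.
pose I := \int[mu]_(x in ball s (2 * h)) `|F x - F s|.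
have iFs : mu.-integrable (ball s (2 * h)) (EFin \o (fun x => F x - F s)).
  have := @integrableB _ _ _ mu _ mB (EFin \o F) (EFin \o cst (F s)).
  apply; first exact: (@integrableS _ _ _ mu setT).
  apply: measurable_bounded_integrable => //; first by have := ltry (4 * h); rewrite -muB.
  by exists `|F s|; split => // M /ltW FM y _.
have iFsn : mu.-integrable (ball s (2 * h)) (EFin \o (fun x => `|F x - F s|)).
  exact: integrable_norm iFs.
have IE : (\int[mu]_(x in ball s (2 * h)) `|F x - F s|%:E)%E = I%:E.
  by rewrite /I /Rintegral fineK//; exact: integrable_fin_num iFsn.
exists ((4 * h)^-1 * I); split.
  rewrite /davg /iavg muB /= inver gt_eqF ?mulr_gt0//= EFinM; congr (_ * _)%E.
  by rewrite -IE.
move=> K hK; have K0 : 0 <= K by apply: le_trans (hK 0).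
have dstep_le x : `|derive1 (step s h) x| <= K / h.
  rewrite derive1_step normrM gtr0_norm ?invr_gt0// mulrC.
  by rewrite ler_wpM2r ?invr_ge0 ?(ltW h0)//.
have tstep : test_function setT (derive1 (step s h)).
  split; first by apply: smooth_derive1; exact: smooth_step_comp.
  exists `[s, s + h]%classic; split => //; first exact: segment_compact.
  by move=> x; exact: derive1_step0.
have lF : locally_integrable setT F by apply: open_integrable_locally => //; exact: openT.
have lc : locally_integrable setT (cst (F s) : R -> R).
  by apply: lsi_locally_integrable; [exact: openT|apply: lsi_cst; exact: openT].
have i1 := test_integrable lF tstep.
have i2 := test_integrable lc tstep.
have -> : F s = \int[mu]_x (cst (F s) x * derive1 (step s h) x).
  rewrite RintegralZl// ?Rintegral_derive1_step ?mulr1//.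
  have l1 : locally_integrable setT (cst 1 : R -> R).
    by apply: lsi_locally_integrable; [exact: openT|apply: lsi_cst; exact: openT].
  have := test_integrable l1 tstep; apply: eq_integrable => // x _ /=.
  by rewrite mul1r.
rewrite -RintegralB//.
under eq_Rintegral do rewrite -mulrBl.
have sb x : ~ ball s (2 * h) x -> derive1 (step s h) x = 0.
  move=> hx; apply: derive1_step0 => //; rewrite /= in_itv/= => /andP[h1 h2].
  by apply: hx; rewrite /ball/= ltr_norml; apply/andP; split; lra.
rewrite (@Rintegral_supportT (ball s (2 * h))); last first.
  by move=> x /sb ->; rewrite mulr0.
have i3 : mu.-integrable (ball s (2 * h))
    (EFin \o (fun x => (F x - cst (F s) x) * derive1 (step s h) x)).
  have := @integrableB _ _ _ mu _ measurableT _ _ i1 i2.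
  move=> /(@integrableS _ _ _ mu _ _ _ measurableT mB (@subsetT _ _)).
  by apply: eq_integrable => // x _ /=; rewrite -EFinB mulrBl.
apply: (le_trans (@le_normr_Rintegral _ _ _ mu _ _ mB i3)).
have -> : 4 * K * ((4 * h)^-1 * I) = K / h * I by field; rewrite gt_eqF.
rewrite /I -RintegralZl//; apply: le_Rintegral => //.
- exact: integrable_norm i3.
- by have := @integrableZl _ _ _ mu _ mB (K / h) _ iFsn.
- by move=> x _; rewrite normrM /= mulrC ler_wpM2r.
Qed.

Let hn (n : nat) : R := n.+1%:R^-1.

Let hn_gt0 n : 0 < hn n. Proof. by rewrite invr_gt0. Qed.

Let hn_cvg : hn @ \oo --> (0 : R).
Proof. exact: cvg_harmonic. Qed.

Let mollify_cvg F s : mu.-integrable setT (EFin \o F) -> lebesgue_pt F s ->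
  (\int[mu]_x (F x * derive1 (step s (hn n)) x)) @[n --> \oo] --> F s.
Proof.
move=> iF Fs; have [K K0 hK] := @derive1n_smooth_step_bounded R 1.
have /choice[a ha] n := @mollify_le F s _ (hn_gt0 n) iF.
have ca : a @ \oo --> (0 : R).
  have /cvge_at_rightP := Fs => /(_ (fun n => 2 * hn n)).
  have -> : (fun n => davg F s (2 * hn n)) = EFin \o a.
    by apply/funext => n; have [-> _] := ha n.
  move=> h; apply: (fine_cvg (h _)); split; first by move=> n; rewrite mulr_gt0.
  by rewrite -[X in _ --> X](mulr0 2); apply: cvgMr; exact: hn_cvg.
apply/cvgrPdist_le => e e0.
have /cvgrPdist_le := ca.
move=> /(_ (e / (4 * K + 1))); rewrite divr_gt0 ?ltr_wpDl ?mulr_ge0// => /(_ isT).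
apply: filterS => n; rewrite sub0r normrN => an.
rewrite distrC; have [_ /(_ K hK) h] := ha n.
apply: (le_trans h); apply: (@le_trans _ _ ((4 * K + 1) * `|a n|)).
  apply: (@le_trans _ _ (4 * K * `|a n|)).
    by rewrite ler_wpM2l ?mulr_ge0// ler_norm.
  by rewrite ler_wpM2r// lerDl.
by rewrite mulrC -ler_pdivlMr ?ltr_wpDl ?mulr_ge0.
Qed.

(** Each step vanishes at its own left end, so the limit is exactly the indicator of the half-open
    interval, at every point and not only almost everywhere. *)
Let step_cvg x s t : s < t ->
  (step s (hn n) x - step t (hn n) x) @[n --> \oo] --> (\1_(`]s, t]%classic) x : R).
Proof.
move=> st.
have h r : step r (hn n) x @[n --> \oo] --> (if r < x then 1 else 0 : R).
  have [rx|rx] := ltP r x; last first.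
    rewrite (_ : (fun n => _) = cst 0); first exact: cvg_cst.
    apply/funext => n; rewrite stepE smooth_step_le0//.
    by rewrite pmulr_lle0 ?invr_gt0// subr_le0.
  apply: cvg_near_cst; have /cvgrPdist_le := hn_cvg.
  move=> /(_ (x - r)); rewrite subr_gt0 => /(_ rx); apply: filterS => n.
  rewrite sub0r normrN gtr0_norm// => hx.
  by rewrite stepE smooth_step_ge1// ler_pdivlMr// mul1r.
suff -> : \1_(`]s, t]%classic) x =
   (if s < x then 1 else 0) - (if t < x then 1 else 0) :> R by exact: cvgB.
rewrite indicE mem_setE in_itv/=.
by have [sx|sx] := ltP s x; have [tx|tx] := ltP t x; rewrite ?subr0 ?subrr//;
  have := lt_trans st tx; rewrite ltNge sx.
Qed.

(* Test u' = v with the difference of two steps of width h at s and t, whose derivatives are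
   approximate identities, and let h tend to 0. *)
Lemma weak_derivative1_repr D u v p q s t : open D -> `[p, q] `<=` D ->
  locally_integrable D u -> locally_integrable D v -> weak_derivative1 D u v ->
  p < s -> s < t -> t < q ->
  lebesgue_pt (u \_ `[p, q]) s -> lebesgue_pt (u \_ `[p, q]) t ->
  u t - u s = \int[mu]_(x in `[s, t]) v x.
Proof.
move=> oD pqD lu lv duv ps st tq ls lt.
(* Mollification needs functions integrable on the whole line. Truncating to [p, q] loses nothing,
   because the test functions below are supported there once the width of the steps is at most q -
   t. *)
set U := u \_ `[p, q] in ls lt; set V := v \_ `[p, q].
have mpq : measurable (`[p, q] : set R) by [].
have ipq w : locally_integrable D w -> mu.-integrable `[p, q] (EFin \o w).
  move=> [mw _ hw]; apply/integrableP; split.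
    apply/measurable_EFinP; apply: measurable_funS mw => //.
    exact: open_measurable.
  by apply: hw => //; exact: segment_compact.
have iT w : locally_integrable D w -> mu.-integrable setT (EFin \o (w \_ `[p, q])).
  move=> /ipq iw; rewrite -restrict_EFin.
  by have := (@integrable_mkcond _ _ _ mu _ (EFin \o w) mpq).1 iw.
have iU := iT _ lu; have iV := iT _ lv.
pose phi n x := step s (hn n) x - step t (hn n) x.
have sphi n : smooth (phi n).
  apply: (@smoothD _ (step s (hn n)) (fun x => - step t (hn n) x)).
    exact: smooth_step_comp.
  have -> : (fun x => - step t (hn n) x) = (cst (-1) \* step t (hn n)).
    by apply/funext => x; rewrite /= mulN1r.
  by apply: smoothM; [exact: smooth_cst|exact: smooth_step_comp].
have phi0 n x : t + hn n <= q -> ~ `[p, q]%classic x -> phi n x = 0.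
  move=> tnq; rewrite /= in_itv/= => /negP; rewrite negb_and -!ltNge => /orP h.
  rewrite /phi !stepE; case: h => h.
    by rewrite !smooth_step_le0 ?subrr// pmulr_lle0 ?invr_gt0// subr_le0; lra.
  rewrite !smooth_step_ge1 ?subrr// ler_pdivlMr ?mul1r//;
    by rewrite lerBrDr; have := hn_gt0 n; lra.
have tphi n : t + hn n <= q -> test_function D (phi n).
  move=> tnq; split; first exact: sphi.
  exists `[p, q]%classic; split => //; first exact: segment_compact.
  by move=> x; exact: phi0.
have dphi n x : derive1 (phi n) x = derive1 (step s (hn n)) x - derive1 (step t (hn n)) x.
  have d r : is_derive x (1 : R) (step r (hn n)) (derive1 (step r (hn n)) x).
    by apply: smooth_is_derive; exact: smooth_step_comp.
  rewrite [LHS]derive1E; have [_ <-] := is_deriveB (d s) (d t).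
  by [].
have phi_le n x : `|phi n x| <= 1.
  rewrite /phi !stepE ler_norml.
  have := smooth_step_ge0 ((x - s) / hn n); have := smooth_step_le1 ((x - s) / hn n).
  have := smooth_step_ge0 ((x - t) / hn n); have := smooth_step_le1 ((x - t) / hn n).
  by move=> *; apply/andP; split; lra.
have eU n : t + hn n <= q -> \int[mu]_(x in D) (u x * derive1 (phi n) x) =
   \int[mu]_x (U x * derive1 (step s (hn n)) x) -
   \int[mu]_x (U x * derive1 (step t (hn n)) x).
  move=> tnq.
  have lU : locally_integrable setT U by apply: open_integrable_locally => //; exact: openT.
  have tst r : test_function setT (derive1 (step r (hn n))).
    split; first by apply: smooth_derive1; exact: smooth_step_comp.
    exists `[r, r + hn n]%classic; split => //; first exact: segment_compact.
    by move=> x; exact: derive1_step0.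
  rewrite -RintegralB//; [|exact: test_integrable..].
  under [RHS]eq_Rintegral do rewrite -mulrBr -dphi.
  have d0 x : ~ `[p, q]%classic x -> derive1 (phi n) x = 0.
    move=> h; rewrite dphi !derive1_step0 ?subrr//; apply: contra_not h;
      by rewrite /= !in_itv/= => /andP[h1 h2]; apply/andP; split; lra.
  rewrite (@Rintegral_support _ _ `[p, q]%classic)//; first last.
  - by move=> x /pqD.
  - by move=> x _ /d0 ->; rewrite mulr0.
  rewrite [RHS](@Rintegral_supportT `[p, q]%classic); last first.
    by move=> x /d0 ->; rewrite mulr0.
  by apply: eq_Rintegral => x xpq; rewrite /U patchE xpq.
have eV n : t + hn n <= q -> \int[mu]_(x in D) (v x * phi n x) =
   \int[mu]_x (V x * phi n x).
  move=> tnq.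
  rewrite (@Rintegral_support _ _ `[p, q]%classic)//; first last.
  - by move=> x /pqD.
  - by move=> x _ /(phi0 n x tnq) ->; rewrite mulr0.
  rewrite [RHS](@Rintegral_supportT `[p, q]%classic); last first.
    by move=> x /(phi0 n x tnq) ->; rewrite mulr0.
  by apply: eq_Rintegral => x xpq; rewrite /V patchE xpq.
have mV : measurable_fun setT V by apply/measurable_EFinP; exact: measurable_int iV.
have mphi n : measurable_fun setT (phi n) by exact: smooth_measurable.
have cV : (\int[mu]_x (V x * phi n x)) @[n --> \oo] -->
    \int[mu]_x (V x * \1_(`]s, t]%classic) x).
  have [] := @dominated_convergence _ _ _ mu setT measurableT
    (fun n x => (V x * phi n x)%:E) (fun x => (V x * \1_(`]s, t]%classic) x)%:E)
    (fun x => `|V x|%:E).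
  - move=> n; apply/measurable_EFinP; apply: measurable_funM; first exact: mV.
    exact: mphi.
  - by apply/measurable_EFinP; apply: measurable_funM.
  - apply: aeW => x _; apply: cvg_EFin; first exact: nearW.
    by apply: cvgMr; exact: step_cvg.
  - exact: integrable_norm iV.
  - apply: aeW => x n _; rewrite lee_fin normrM ler_piMr//.
  move=> iVs _ cv; apply: fine_cvg.
  by rewrite fineK//; exact: integrable_fin_num iVs.
have ntq : \forall n \near \oo, t + hn n <= q.
  have /cvgrPdist_le := hn_cvg.
  move=> /(_ (q - t)); rewrite subr_gt0 => /(_ tq); apply: filterS => n.
  by rewrite sub0r normrN gtr0_norm// lerBrDl.
have cU : (\int[mu]_(x in D) (u x * derive1 (phi n) x)) @[n --> \oo] --> U s - U t.
  apply: (@cvg_trans _ ((\int[mu]_x (U x * derive1 (step s (hn n)) x) -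
   \int[mu]_x (U x * derive1 (step t (hn n)) x)) @[n --> \oo])).
    by apply: near_eq_cvg; move: ntq; apply: filterS => n /eU ->.
  by apply: cvgB; exact: mollify_cvg.
have cU' : (\int[mu]_(x in D) (u x * derive1 (phi n) x)) @[n --> \oo] -->
    - \int[mu]_x (V x * \1_(`]s, t]%classic) x).
  apply: (@cvg_trans _ ((- \int[mu]_x (V x * phi n x)) @[n --> \oo])).
    apply: near_eq_cvg; move: ntq; apply: filterS => n tnq.
    by rewrite duv ?eV//; exact: tphi.
  exact: cvgN.
have := @cvg_unique _ (@Rhausdorff R) _ _ _ _ cU cU'.
rewrite /U !patchE !mem_setE !in_itv/=.
have -> : (p <= s <= q) by rewrite !ltW// (lt_trans st).
have -> : (p <= t <= q) by rewrite !ltW// (lt_trans ps).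
move=> usut; suff -> : \int[mu]_(x in `[s, t]) v x = \int[mu]_x (V x * \1_(`]s, t]%classic) x).
  by rewrite -[RHS]opprK -usut opprB.
apply/esym.
rewrite (@Rintegral_supportT `]s, t]%classic); last first.
  by move=> x /negP; rewrite indicE mem_setE/= => /negbTE ->; rewrite mulr0.
rewrite -[RHS]Rintegral_itv_obnd_cbnd; last first.
  apply: (@integrableS _ _ _ mu `[p, q]) => //; last exact: ipq.
  by move=> x; rewrite /= !in_itv/= => /andP[h1 h2]; apply/andP; split; lra.
apply: eq_Rintegral => x xst; rewrite indicE xst mulr1 /V patchE.
move: xst; rewrite !mem_setE !in_itv/= => /andP[h1 h2].
by have -> : p <= x <= q by apply/andP; split; lra.
Qed.

End du_bois_reymond.

(** * Uniqueness of weak derivatives, and representatives that are primitives *)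

Section weak_derivative_uniqueness.
Context {R : realType}.
Implicit Types (D : set R) (u v w : R -> R) (z : nat -> R -> R) (p q s t : R).
Local Notation mu := (@lebesgue_measure R).

Lemma locally_integrable_segment D u p q : `[p, q] `<=` D ->
  locally_integrable D u -> mu.-integrable `[p, q] (EFin \o u).
Proof.
move=> pqD [mw oD hw]; apply/integrableP; split.
  apply/measurable_EFinP; apply: measurable_funS mw => //.
  exact: open_measurable.
by apply: hw => //; exact: segment_compact.
Qed.

(** The representation formula for the zero function says that [w] has integral 0 over every segment
    in [D]. At a Lebesgue point, [w] is the derivative of its primitive, hence 0. *)
Lemma weak_derivative1_0 D w : open D -> locally_integrable D w ->
  weak_derivative1 D (cst 0) w -> {ae mu, forall t, D t -> w t = 0}.
Proof.
move=> oD lw d0.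
have l0 : locally_integrable D (cst 0 : R -> R).
  by apply: lsi_locally_integrable => //; exact: lsi_cst.
have main p q : p < q -> `[p, q] `<=` D -> {ae mu, forall t, `]p, q[%classic t -> w t = 0}.
  move=> pq pqD; have iw := locally_integrable_segment pqD lw.
  have := @lebesgue_differentiation R (w \_ `[p, q])
    (integrable_locally_restrict (measurable_itv `[p, q]) iw).
  apply: filterS; first exact: (ae_filter_ringOfSetsType mu).
  move=> t lt; rewrite /= in_itv/= => /andP[pt tq].
  pose p' := (p + t) / 2; pose q' := (t + q) / 2.
  have [pp' p't tq' q'q] : [/\ p < p', p' < t, t < q' & q' < q].
    by rewrite /p' /q'; split; lra.
  have w0 s r : p < s -> s < r -> r < q -> \int[mu]_(x in `[s, r]) w x = 0.
    move=> ps sr rq.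
    have c0 x : lebesgue_pt ((cst 0 : R -> R) \_ `[p, q]) x.
      have -> : (cst 0 : R -> R) \_ `[p, q] = cst 0.
        by apply/funext => y; rewrite patchE; case: ifP.
      apply: (@continuous_lebesgue_pt _ _ _ setT) => //; last exact: cst_continuous.
      by split => //; exact: openT.
    have := @weak_derivative1_repr R D (cst 0) w p q s r oD pqD l0 lw d0 ps sr rq (c0 s) (c0 r).
    by rewrite /= subrr => <-.
  have iw' : mu.-integrable `[p', q'] (EFin \o (w \_ `[p, q])).
    have := @integrableS _ _ _ mu `[p, q]%classic `[p', q']%classic (EFin \o w).
    move=> /(_ (measurable_itv _) (measurable_itv _)) h.
    have {}h : mu.-integrable `[p', q'] (EFin \o w).
      apply: h => // x; rewrite /= !in_itv/= => /andP[h1 h2]; apply/andP; split; lra.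
    apply: eq_integrable h => // x; rewrite mem_setE in_itv/= => /andP[h1 h2] /=.
    rewrite patchE mem_setE in_itv/=.
    by have -> : p <= x <= q by apply/andP; split; lra.
  have p't' : (BLeft p' < BRight t)%E by rewrite /= lte_fin.
  have [_] := @FTC1_lebesgue_pt R (w \_ `[p, q]) (BLeft p') t q' tq' iw' p't' lt.
  rewrite patchE mem_setE in_itv/=.
  have -> : p <= t <= q by apply/andP; split; lra.
  move=> <-; rewrite derive1E (@near_eq_derive _ _ _ _ (cst 0)) ?derive_cst//.
  near=> y.
  have [p'y yq'] : p' < y /\ y < q'.
    by split; near: y; [exact: lt_nbhsr|exact: lt_nbhsl].
  rewrite -[RHS](w0 p' y)//; last by lra.
  apply: eq_Rintegral => x; rewrite mem_setE in_itv/= => /andP[h1 h2].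
  rewrite patchE mem_setE in_itv/=.
  by have -> : p <= x <= q by apply/andP; split; lra.
(* The open set [D] is covered by the segments with rational end points that it contains; they are
   countably many, so the null sets can be united. *)
pose P (n : nat) t := forall pq : rat * rat, unpickle n = Some pq ->
  `[ratr pq.1, ratr pq.2] `<=` D -> `]ratr pq.1, ratr pq.2[%classic t -> w t = 0.
have : {ae mu, forall t, forall n, P n t}.
  apply: ae_foralln => n; rewrite /P.
  case: (unpickle n) => [[p q]|]; last by apply: aeW.
  have [pqD|pqD] := pselect (`[(ratr p : R), ratr q] `<=` D); last first.
    by apply: aeW => t [p' q'] [<- <-].
  have [pq|qp] := ltP (ratr p : R) (ratr q).
    have := main _ _ pq pqD; apply: filterS; first exact: (ae_filter_ringOfSetsType mu).
    by move=> t h [p' q'] [<- <-].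
  apply: aeW => t [p' q'] [<- <-] _; rewrite /= in_itv/= => /andP[h1 h2].
  by move: (lt_trans h1 h2); rewrite ltNge qp.
apply: filterS; first exact: (ae_filter_ringOfSetsType mu).
move=> t h Dt.
have /nbhs_ballP[e /= e0 teD] : nbhs t D by exact: open_nbhs_nbhs.
have [p hp] := @rat_in_itvoo R (t - e) t ltac:(lra).
have [q hq] := @rat_in_itvoo R t (t + e) ltac:(lra).
move: hp hq; rewrite !in_itv/= => /andP[p1 p2] /andP[q1 q2].
apply: (h (pickle (p, q)) (p, q)); first by rewrite pickleK.
- move=> x; rewrite /= in_itv/= => /andP[h1 h2]; apply: teD.
  by rewrite /ball/= ltr_norml; apply/andP; split; lra.
- by rewrite /= in_itv/= p2 q1.
Unshelve. all: by end_near. Qed.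

Lemma is_weak_derivative_unique D k u v v' : open D ->
  is_weak_derivative D k u v -> is_weak_derivative D k u v' ->
  {ae mu, forall t, D t -> v t = v' t}.
Proof.
move=> oD [_ lv hv] [_ lv' hv'].
have := @weak_derivative1_0 D (v \- v') oD (locally_integrableB lv lv').
case=> [phi tphi|N [mN N0 hN]]; last first.
  exists N; split => // t /= h; apply: hN => /= h'; apply: h => Dt.
  by apply/eqP; rewrite -subr_eq0; apply/eqP; exact: h'.
under eq_Rintegral do rewrite /= mul0r.
rewrite Rintegral_cst ?mul0r; last exact: open_measurable.
under eq_Rintegral do rewrite /= mulrBl.
rewrite RintegralB; [|exact: open_measurable|exact: test_integrable..].
have /eqP := hv _ tphi; rewrite hv'//; move/eqP/mulfI.
by rewrite signr_eq0 => /(_ isT) ->; rewrite subrr oppr0.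
Qed.

(** The default value of [xget] is never reached here: one weak derivative exists, so the chosen
    function is one as well. *)
Lemma weak_derivative_ae D k u v : open D -> is_weak_derivative D k u v ->
  locally_integrable D (weak_derivative D k u) /\
  {ae mu, forall t, D t -> weak_derivative D k u t = v t}.
Proof.
move=> oD hv; have h : is_weak_derivative D k u (weak_derivative D k u).
  by rewrite /weak_derivative; case: xgetP => [//|] /(_ v).
by split; [case: h|exact: is_weak_derivative_unique h hv].
Qed.

Lemma sobolevH_loc_weak_chain D k u : open D -> sobolevH_loc D k u ->
  exists2 z, weak_chain D k z & z 0%N = u.
Proof.
move=> oD [lu hu].
(* At order 0 the chain must start with [u] itself and not with a function equal to it almost
   everywhere. *)
have hv j : exists v, (j = 0%N -> v = u) /\ ((j <= k)%N ->
    is_weak_derivative D j u v /\ locally_square_integrable D v).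
  have l := lsi_locally_integrable oD lu.
  case: j => [|j].
    exists u; split => // _; split => //; split => //.
    by move=> phi _; rewrite expr0 mul1r.
  have [jk|] := leqP j.+1 k; last by exists u.
  by have [v [h1 h2]] := hu j.+1 jk; exists v.
have [z hz] := choice hv.
exists z; last by have [->] := hz 0%N.
split => j jk; first by have [_ /(_ jk)[]] := hz j.
apply: (@is_weak_derivative_step _ D j u) => //.
- by have [_ /(_ (ltnW jk))[]] := hz j.
- by have [_ /(_ jk)[]] := hz j.+1.
Qed.

Lemma sobolevH_weak_chain D k u : open D -> sobolevH D k u ->
  exists2 z, weak_chain D k z & z 0%N = u.
Proof.
move=> oD [su hu]; apply: sobolevH_loc_weak_chain => //; split.
  exact: square_integrable_lsi.
move=> j jk; have [v [hv sv]] := hu j jk; exists v; split => //.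
exact: square_integrable_lsi.
Qed.

Lemma weak_chain_sobolevH_loc D k z : open D -> weak_chain D k z ->
  sobolevH_loc D k (z 0%N).
Proof.
move=> oD cz; have [lz _] := cz; split; first exact: lz.
move=> j /andP[_ jk]; exists (z j); split; last exact: lz.
exact: (weak_chain_is_weak_derivative oD jk cz).
Qed.

Lemma weak_chain_sobolevH a b k z : weak_chain setT k z ->
  sobolevH `]a, b[ k (z 0%N).
Proof.
move=> cz; have [lz _] := cz; split; first exact/lsi_square_integrable/lz.
move=> j /andP[_ jk]; exists (z j); split; last exact/lsi_square_integrable/lz.
apply: (weak_chain_is_weak_derivative _ jk); first exact: itv_open.
have oab : open (`]a, b[%classic : set R) by exact: itv_open.
exact: (weak_chainS openT oab (@subsetT _ _) cz).
Qed.

(** Replaces the chosen weak derivative in the energy by the last entry of the chain, which agrees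
    with it almost everywhere. *)
Lemma weak_derivative_energy D k z (c1 c2 : R) (W : R -> R) : open D ->
  weak_chain D k z -> continuous W -> (forall x, 0 <= W x) -> 0 <= c1 -> 0 <= c2 ->
  (\int[mu]_(t in D) (c1 * W (z 0%N t) + c2 * (weak_derivative D k (z 0%N) t) ^+ 2)%:E =
   \int[mu]_(t in D) (c1 * W (z 0%N t) + c2 * (z k t) ^+ 2)%:E)%E.
Proof.
move=> oD cz cW W0 c10 c20; have [lz _] := cz.
have mD := open_measurable oD.
have [[mw _ _] [N [mN N0 hN]]] := weak_derivative_ae oD (weak_chain_is_weak_derivative oD (leqnn k) cz).
have [mz0 _] := lz 0%N (leq0n k); have [mzk _] := lz k (leqnn k).
have m v : measurable_fun D v -> measurable_fun D (fun t => (c1 * W (z 0%N t) + c2 * v t ^+ 2)%:E).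
  move=> mv; apply/measurable_EFinP; apply: measurable_funD.
    apply: measurable_funM => //; apply: measurableT_comp => //.
    exact: continuous_measurable_fun.
  by apply: measurable_funM => //; exact: measurable_funX.
apply: ge0_ae_eq_integral => //; [exact: m|exact: m| | |].
- by move=> x _; rewrite lee_fin addr_ge0// mulr_ge0 ?sqr_ge0.
- by move=> x _; rewrite lee_fin addr_ge0// mulr_ge0 ?sqr_ge0.
- exists N; split => // t /= h; apply: hN => /= h'; apply: h => Dt.
  by rewrite h'.
Qed.

Lemma measurable_superlevel (A : set R) (f : R -> R) (e : R) : measurable A -> measurable_fun A f ->
  measurable [set t | A t /\ e < `|f t|].
Proof.
move=> mA mf.
rewrite (_ : [set _ | _] = A `&` (fun t => `|f t|) @^-1` `]e, +oo[%classic).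
  suff m : measurable_fun A (fun t => `|f t|) by exact: m.
  exact: measurableT_comp.
by apply/seteqP; split => t [h1 h2]; split => //=; move: h2; rewrite /= in_itv/= andbT.
Qed.

Lemma exists_outside (B P : set R) c h : 0 < h -> measurable B -> (mu B < h%:E)%E ->
  {ae mu, forall t, P t} -> exists t, [/\ c < t < c + h, ~ B t & P t].
Proof.
move=> h0 mB small [N [mN N0 hN]]; apply: contrapT => none.
have sub : `]c, c + h[ `<=` B `|` N.
  move=> t; rewrite /= in_itv/= => tc.
  have [Bt|Bt] := pselect (B t); [by left|right].
  by apply: hN => /= Pt; apply: none; exists t.
have : (mu `]c, (c + h)%R[%classic <= mu (B `|` N))%E.
  by apply: le_measure => //; rewrite inE//; exact: measurableU.
rewrite (@measureU0 _ _ _ mu)// leNgt.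
have -> : mu `]c, (c + h)%R[%classic = h%:E.
  by rewrite lebesgue_measure_itv/= lte_fin ltrDl h0 -EFinD addrAC subrr add0r.
by rewrite small.
Qed.

Lemma ae_exists (P : set R) p q : p < q -> {ae mu, forall t, P t} ->
  exists2 t, `]p, q[%classic t & P t.
Proof.
move=> pq aeP; have qp0 : 0 < q - p by rewrite subr_gt0.
have [|t [tpq _ Pt]] := @exists_outside set0 P p (q - p) qp0 measurable0 _ aeP.
  by rewrite measure0 lte_fin.
by exists t => //=; rewrite in_itv/= -[q](subrK p) addrC.
Qed.

Lemma Rintegral_segmentB f p s t : p <= s -> s <= t ->
  mu.-integrable `[p, t] (EFin \o f) ->
  \int[mu]_(x in `[p, t]) f x - \int[mu]_(x in `[p, s]) f x =
  \int[mu]_(x in `[s, t]) f x.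
Proof.
move=> ps st intf; rewrite Rintegral_itvB ?bnd_simp//.
rewrite Rintegral_itv_obnd_cbnd//.
apply: (@integrableS _ _ _ mu `[p, t]) => //.
by move=> x; rewrite /= !in_itv/= => /andP[h1 ->]; rewrite andbT ltW// (le_lt_trans ps).
Qed.

(** The constant is fixed at one Lebesgue point [s]; the representation formula then relates [s] to
    almost every [t], on either side of it. *)
Lemma weak_derivative1_primitive D u v p q : open D -> p < q -> `[p, q] `<=` D ->
  locally_integrable D u -> locally_integrable D v -> weak_derivative1 D u v ->
  exists c, {ae mu, forall t, `]p, q[%classic t -> u t = c + \int[mu]_(x in `[p, t]) v x}.
Proof.
move=> oD pq pqD lu lv duv.
have iu := locally_integrable_segment pqD lu.
have iv := locally_integrable_segment pqD lv.
have lae := @lebesgue_differentiation R (u \_ `[p, q])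
  (integrable_locally_restrict (measurable_itv `[p, q]) iu).
have [s spq ls] := ae_exists pq lae.
exists (u s - \int[mu]_(x in `[p, s]) v x).
move: lae; apply: filterS; first exact: (ae_filter_ringOfSetsType mu).
move=> t lt; move: spq; rewrite /= !in_itv/= => /andP[ps sq] /andP[pt tq].
have ivt r : r < q -> mu.-integrable `[p, r] (EFin \o v).
  move=> rq; apply: (@integrableS _ _ _ mu `[p, q]) => //.
  by move=> x; rewrite /= !in_itv/= => /andP[-> /le_trans]; apply; exact: ltW.
have [st|ts|->] := ltgtP s t; last by rewrite subrK.
- have := @weak_derivative1_repr R D u v p q s t oD pqD lu lv duv ps st tq ls lt.
  rewrite -(@Rintegral_segmentB v p s t (ltW ps) (ltW st) (ivt t tq)) => h.
  by apply/eqP; rewrite -subr_eq0; apply/eqP; lra.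
- have := @weak_derivative1_repr R D u v p q t s oD pqD lu lv duv pt ts sq lt ls.
  rewrite -(@Rintegral_segmentB v p t s (ltW pt) (ltW ts) (ivt s sq)) => h.
  by apply/eqP; rewrite -subr_eq0; apply/eqP; lra.
Qed.

(** [Z i] is the primitive that [z i] equals almost everywhere. For i < n its integrand can be
    replaced by the continuous [Z i.+1], so [Z i] is differentiable in the classical sense. The top
    function [Z n] has a merely integrable derivative and keeps the integral form. *)
Lemma weak_chain_continuous_repr D n z p q : open D -> p < q -> `[p, q] `<=` D ->
  weak_chain D n.+1 z ->
  exists Z : nat -> R -> R, [/\
    forall i, (i <= n)%N -> {ae mu, forall t, `]p, q[%classic t -> z i t = Z i t},
    forall i, (i <= n)%N -> {within `[p, q], continuous (Z i)},
    forall i t, (i < n)%N -> p < t -> t < q -> is_derive t (1 : R) (Z i) (Z i.+1 t) &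
    forall s t, p <= s -> s <= t -> t <= q ->
      Z n t - Z n s = \int[mu]_(x in `[s, t]) z n.+1 x].
Proof.
move=> oD pq pqD [lz dz].
have lI i (ik : (i <= n.+1)%N) := lsi_locally_integrable oD (lz _ ik).
have /choice[c hc] i : exists c, (i <= n)%N -> {ae mu, forall t, `]p, q[%classic t ->
    z i t = c + \int[mu]_(x in `[p, t]) z i.+1 x}.
  have [ik|ik] := leqP i n; last by exists 0.
  have [c hc] := weak_derivative1_primitive oD pq pqD (lI i (leqW ik)) (lI i.+1 ik) (dz i ik).
  by exists c.
pose Z i t := c i + \int[mu]_(x in `[p, t]) z i.+1 x.
have iz i : (i <= n)%N -> mu.-integrable `[p, q] (EFin \o z i.+1).
  by move=> ik; apply: (locally_integrable_segment pqD); exact: lI.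
have izt i t : (i <= n)%N -> t <= q -> mu.-integrable `[p, t] (EFin \o z i.+1).
  move=> ik tq; apply: (@integrableS _ _ _ mu `[p, q]) => //; last exact: iz.
  by move=> x; rewrite /= !in_itv/= => /andP[-> /le_trans]; apply.
have cZ i : (i <= n)%N -> {within `[p, q], continuous (Z i)}.
  move=> ik x; apply: cvgD; first exact: cvg_cst.
  exact: (parameterized_integral_continuous (ltW pq) (iz _ ik)).
exists Z; split => //.
- move=> i t ik pt tq.
  have [N [mN N0 hN]] := hc _ ik.
  have cZt : {for t, continuous (Z i.+1)}.
    by apply: (within_continuous_continuous pq (cZ _ ik)); rewrite in_itv/= pt tq.
  have iZ : mu.-integrable `[p, q] (EFin \o Z i.+1).
    by apply: continuous_compact_integrable; [exact: segment_compact|exact: cZ].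
  have eZ s : p <= s -> s < q ->
      \int[mu]_(x in `[p, s]) z i.+1 x = \int[mu]_(x in `[p, s]) Z i.+1 x.
    move=> ps sq; congr fine; apply: ae_eq_integral => //.
    + by have /measurable_int := izt i s (ltnW ik) (ltW sq).
    + apply/measurable_EFinP; apply: (@measurable_funS _ _ _ _ `[p, q]%classic) => //.
        by move=> x; rewrite /= !in_itv/= => /andP[-> /le_trans]; apply; exact: ltW.
      by apply/measurable_EFinP; exact: measurable_int iZ.
    + exists (N `|` [set p]); split; first exact: measurableU.
        by rewrite (@measureU0 _ _ _ mu)//; exact: lebesgue_measure_set1.
      move=> x /= h; have [xp|xp] := eqVneq x p; [by right|left].
      apply: hN => /= h'; apply: h; rewrite in_itv/= => /andP[px xs].
      by rewrite h'//= in_itv/= lt_neqAle eq_sym xp px (le_lt_trans xs).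
  have [h1 h2] := @continuous_FTC1_closed R (Z i.+1) p t q tq iZ pt cZt.
  have h3 : is_derive t (1 : R) (fun y => c i + \int[mu]_(x in `[p, y]) Z i.+1 x) (Z i.+1 t).
    rewrite -[X in is_derive _ _ _ X]add0r; apply: is_deriveD.
    by rewrite -h2 derive1E; exact: derivableP.
  apply: (@near_eq_is_derive _ _ _ (fun y => c i + \int[mu]_(x in `[p, y]) Z i.+1 x)).
  near=> y; rewrite /Z eZ//.
    by rewrite ltW//; near: y; exact: lt_nbhsr.
  by near: y; exact: lt_nbhsl.
- move=> s t ps st tq; rewrite /Z opprD addrACA subrr add0r.
  by rewrite Rintegral_segmentB//; exact: izt.
Unshelve. all: by end_near. Qed.

End weak_derivative_uniqueness.

(** * Jet bounds on unit cells *)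

Section jets.
Context {R : realType}.
Implicit Types (D : set R) (z Z : nat -> R -> R) (p q s t eta delta c : R).
Local Notation mu := (@lebesgue_measure R).

(** Continuity up to the end points with derivatives only inside is the form in which the mean value
    theorem applies to every subinterval. *)
Definition classical_chain n p q Z :=
  (forall i, (i <= n)%N -> {within `[p, q], continuous (Z i)}) /\
  (forall i t, (i < n)%N -> p < t -> t < q -> is_derive t (1 : R) (Z i) (Z i.+1 t)).

Lemma classical_chainS n p q p' q' Z : p <= p' -> q' <= q ->
  classical_chain n p q Z -> classical_chain n p' q' Z.
Proof.
move=> pp' qq' [cZ dZ]; split => [i ik|i t ik pt tq].
  apply: continuous_subspaceW (cZ i ik) => x.
  by rewrite /= !in_itv/= => /andP[h1 h2]; rewrite (le_trans pp')// (le_trans h2).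
by apply: dZ; rewrite ?(le_lt_trans pp')// (lt_le_trans tq).
Qed.

Lemma classical_chainW n m p q Z : (m <= n)%N ->
  classical_chain n p q Z -> classical_chain m p q Z.
Proof.
move=> mn [cZ dZ]; split => i; first by move=> im; apply: cZ; exact: leq_trans mn.
by move=> t im; apply: dZ; exact: leq_trans mn.
Qed.

Lemma classical_chain_shift n p q Z : classical_chain n.+1 p q Z ->
  classical_chain n p q (fun i => Z i.+1).
Proof. by move=> [cZ dZ]; split => i; [exact: (cZ i.+1)|move=> t; exact: (dZ i.+1)]. Qed.

Lemma classical_chain_MVT n i p q Z s t : classical_chain n p q Z -> (i < n)%N ->
  p <= s -> s < t -> t <= q ->
  exists2 x, s < x < t & Z i t - Z i s = Z i.+1 x * (t - s).
Proof.
move=> ch ik ps st tq; have [cZ dZ] := classical_chainS ps tq ch.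
have [||x] := @MVT R (Z i) (Z i.+1) s t st.
- by move=> x; rewrite in_itv/= => /andP[sx xt]; exact: dZ.
- exact: cZ (ltnW ik).
by rewrite in_itv/= => sxt h; exists x.
Qed.

(* The mean value theorem between consecutive points gives half as many separated points where
   the next derivative is small; iterate. *)
Lemma separated_small_points n Z p q c eta (x : nat -> R) : 0 < c ->
  classical_chain n p q Z ->
  (forall i, (i < 2 ^ n)%N -> p <= x i <= q /\ `|Z 0%N (x i)| <= eta) ->
  (forall i, (i.+1 < 2 ^ n)%N -> x i + c <= x i.+1) ->
  exists2 xi, p <= xi <= q & `|Z n xi| <= (2 / c) ^+ n * eta.
Proof.
move=> c0; elim: n Z eta x => [|n ih] Z eta x ch hx gap.
  by have [h1 h2] := hx 0%N isT; exists (x 0%N) => //; rewrite expr0 mul1r.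
have i2 i : (i < 2 ^ n -> i.*2.+1 < 2 ^ n.+1)%N by rewrite expnS; lia.
have /choice[y hy] i : exists y, (i < 2 ^ n)%N ->
   x i.*2 < y < x i.*2.+1 /\ `|Z 1%N y| <= 2 / c * eta.
  have [ik|ik] := ltnP i (2 ^ n)%N; last by exists 0.
  have g := gap _ (i2 _ ik).
  have [/andP[p1 q1] z1] := hx _ (ltnW (i2 _ ik)).
  have [/andP[p2 q2] z2] := hx _ (i2 _ ik).
  have lt12 : x i.*2 < x i.*2.+1 by rewrite (lt_le_trans _ g)// ltrDl.
  have [y hy e] := classical_chain_MVT ch (ltn0Sn n) p1 lt12 q2.
  exists y => _; split => //.
  have d0 : 0 < x i.*2.+1 - x i.*2 by rewrite subr_gt0.
  have {}e : Z 1%N y = (Z 0%N (x i.*2.+1) - Z 0%N (x i.*2)) / (x i.*2.+1 - x i.*2).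
    by rewrite e mulfK// gt_eqF.
  have eta0 : 0 <= eta by exact: le_trans z1.
  rewrite e normrM normfV (gtr0_norm d0) ler_pdivrMr//.
  apply: (@le_trans _ _ (eta + eta)).
    by apply: le_trans (ler_normB _ _) _; exact: lerD.
  have -> : 2 / c * eta * (x i.*2.+1 - x i.*2) =
    (eta + eta) * ((x i.*2.+1 - x i.*2) / c) by ring.
  rewrite ler_peMr ?addr_ge0// ler_pdivlMr// mul1r; lra.
have [||xi h1 h2] := ih (fun i => Z i.+1) (2 / c * eta) y (classical_chain_shift ch).
- move=> i ik; have [/andP[h1 h2] h3] := hy i ik; split => //.
  have [/andP[p1 q1] z1] := hx _ (ltnW (i2 _ ik)).
  have [/andP[p2 q2] z2] := hx _ (i2 _ ik).
  by apply/andP; split; lra.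
(* The separation [c] survives, because the gap between x_(2i+1) and x_(2i+2) lies between the two
   new points. *)
- move=> i ik; have [/andP[h1 h2] _] := hy i (ltnW ik).
  have [/andP[h3 h4] _] := hy i.+1 ik.
  have : (i.*2.+2 < 2 ^ n.+1)%N by rewrite expnS; lia.
  move=> /gap; rewrite -doubleS => g; lra.
- by exists xi => //; rewrite exprSr -mulrA.
Qed.

(** Induction on the order. Separated small points yield one point where the top derivative is at
    most A eta; its oscillation bound spreads this over the cell. On a cell of length 1 the
    resulting bound is also an oscillation bound for the derivative of one order less, to which the
    induction hypothesis applies. *)
Lemma jet_bound n : exists2 C : R, 0 <= C & forall Z p eta delta,
  0 <= eta -> 0 <= delta -> classical_chain n p (p + 1) Z ->
  (forall s t, p <= s -> s <= t -> t <= p + 1 -> `|Z n t - Z n s| <= delta) ->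
  (forall c, p <= c -> c + 2^-1 ^+ n.+1 <= p + 1 ->
    exists2 t, c <= t <= c + 2^-1 ^+ n.+1 & `|Z 0%N t| <= eta) ->
  forall i t, (i <= n)%N -> p <= t <= p + 1 -> `|Z i t| <= C * (eta + delta).
Proof.
have osc Z m p A xi delta t : (forall s t, p <= s -> s <= t -> t <= p + 1 ->
    `|Z m t - Z m s| <= delta) -> p <= xi <= p + 1 -> p <= t <= p + 1 ->
    `|Z m xi| <= A -> `|Z m t| <= A + delta.
  move=> h /andP[x1 x2] /andP[t1 t2] hA.
  have : `|Z m t - Z m xi| <= delta.
    by have [tx|xt] := leP t xi; [rewrite distrC; exact: h|apply: h => //; exact: ltW].
  rewrite -[X in `|X| <= A + _](subrK (Z m xi)) => h'.
  by apply: le_trans (ler_normD _ _) _; rewrite addrC lerD.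
elim: n => [|n [C C0 ih]].
  exists 1 => // Z p eta delta e0 d0 ch hosc small i t; rewrite leqn0 => /eqP -> pt.
  have [||xi] := small p; rewrite ?lexx//; first by rewrite expr1; lra.
  rewrite expr1 => /andP[x1 x2] hxi; rewrite mul1r.
  by apply: (@osc Z 0%N p eta xi) => //; apply/andP; split; lra.
(* The constant of the separated points for order n + 1 and separation 2^-(n+2). *)
pose A : R := (2 / 2^-1 ^+ n.+2) ^+ n.+1.
have A0 : 0 <= A by rewrite exprn_ge0// divr_ge0// exprn_ge0.
exists (C * (1 + A) + A + 1) => [|Z p eta delta e0 d0 ch hosc small i t].
  by rewrite !addr_ge0// mulr_ge0// addr_ge0.
have h0 : 0 < 2^-1 ^+ n.+2 :> R by rewrite exprn_gt0.
have hE : 2^-1 ^+ n.+2 * (2 ^ n.+2)%N%:R = 1 :> R.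
  by rewrite natrX -exprMn mulVf ?expr1n.
(* The cell is divided into 2^(n+2) equal subintervals. Those of even index supply the points and
   those of odd index the separation. *)
have /choice[x hx] j : exists t, (j < 2 ^ n.+1)%N ->
   p + j.*2%:R * 2^-1 ^+ n.+2 <= t <= p + j.*2%:R * 2^-1 ^+ n.+2 + 2^-1 ^+ n.+2 /\
   `|Z 0%N t| <= eta.
  have [jk|jk] := ltnP j (2 ^ n.+1)%N; last by exists 0.
  have jk2 : (j.*2.+1 <= 2 ^ n.+2)%N by rewrite expnS; lia.
  have [||s hs hz] := small (p + j.*2%:R * 2^-1 ^+ n.+2); last by exists s.
  - by rewrite lerDl mulr_ge0// ltW.
  - rewrite -addrA lerD2l -[X in _ + X]mul1r -mulrDl natr1 -[leRHS]hE mulrC.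
    by rewrite ler_wpM2l ?ler_nat// ltW.
have xin j : (j < 2 ^ n.+1)%N -> p <= x j <= p + 1.
  move=> jk; have [/andP[h1 h2] _] := hx j jk.
  have jk2 : (j.*2.+1 <= 2 ^ n.+2)%N by rewrite expnS; lia.
  have : (j.*2.+1)%:R * 2^-1 ^+ n.+2 <= 1 :> R.
    by rewrite -[leRHS]hE mulrC ler_wpM2l ?ler_nat// ltW.
  rewrite -natr1 mulrDl mul1r => h3.
  have h4 : 0 <= j.*2%:R * 2^-1 ^+ n.+2 :> R by rewrite mulr_ge0// ltW.
  by apply/andP; split; lra.
have [||xi xi1 xiA] := @separated_small_points n.+1 Z p (p + 1) _ eta x h0 ch.
- by move=> j jk; split; [exact: xin|have [_] := hx j jk].
- move=> j jk; have [/andP[_ h2] _] := hx j (ltnW jk).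
  have [/andP[h3 _] _] := hx j.+1 jk.
  move: h3; rewrite doubleS -[in X in X -> _](addn2 j.*2) natrD mulrDl; lra.
have bn s : p <= s <= p + 1 -> `|Z n.+1 s| <= A * eta + delta.
  by move=> hs; apply: (osc Z n.+1 p _ xi).
have d'0 : 0 <= A * eta + delta by rewrite addr_ge0// mulr_ge0.
rewrite leq_eqVlt => /predU1P[-> pt|]; last rewrite ltnS => ik pt.
  apply: le_trans (bn _ pt) _.
  have := mulr_ge0 C0 e0; have := mulr_ge0 A0 e0.
  have := mulr_ge0 C0 d0; have := mulr_ge0 A0 d0.
  by have := mulr_ge0 (mulr_ge0 C0 A0) e0; have := mulr_ge0 (mulr_ge0 C0 A0) d0; nra.
have := ih Z p eta (A * eta + delta) e0 d'0 (classical_chainW (leqnSn n) ch) _ _ i t ik pt.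
move=> h; apply: (le_trans (h _ _)).
- move=> s r ps; rewrite le_eqVlt => /predU1P[->|sr] rp1; first by rewrite subrr normr0.
  have [y /andP[sy yr] ->] := classical_chain_MVT ch (ltnSn n) ps sr rp1.
  rewrite normrM (gtr0_norm (_ : 0 < r - s)) ?subr_gt0//.
  apply: (@le_trans _ _ ((A * eta + delta) * 1)); last by rewrite mulr1.
  apply: ler_pM => //; [by rewrite subr_ge0 ltW| |lra].
  by apply: bn; apply/andP; split; lra.
- move=> c pc cp1.
  have le2 : 2^-1 ^+ n.+2 <= 2^-1 ^+ n.+1 :> R.
    by rewrite exprS ler_piMl ?exprn_ge0//; lra.
  have [|s /andP[s1 s2] hs] := small c pc; first lra.
  by exists s => //; apply/andP; split; lra.
- have := mulr_ge0 C0 e0; have := mulr_ge0 A0 e0.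
  have := mulr_ge0 C0 d0; have := mulr_ge0 A0 d0.
  by have := mulr_ge0 (mulr_ge0 C0 A0) e0; have := mulr_ge0 (mulr_ge0 C0 A0) d0; nra.
Qed.

Definition continuous_repr n z p q Z := [/\ classical_chain n p q Z,
  forall i, (i <= n)%N -> {ae mu, forall t, `]p, q[%classic t -> z i t = Z i t} &
  forall s t, p <= s -> s <= t -> t <= q ->
      Z n t - Z n s = \int[mu]_(x in `[s, t]) z n.+1 x].

(** On an interval of length at most 1, integrate Young's inequality |f| <= delta / 2 + f^2 / (2
    delta). *)
Lemma integral_norm_le_sqr (f : R -> R) p q delta : p <= q -> 0 < delta ->
  measurable_fun `[p, q] f ->
  (\int[mu]_(t in `[p, q]) (f t ^+ 2)%:E <= (delta ^+ 2)%:E)%E -> q <= p + 1 ->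
  mu.-integrable `[p, q] (EFin \o f) /\ \int[mu]_(t in `[p, q]) `|f t| <= delta.
Proof.
move=> pq d0 mf hf qp1.
have h : (\int[mu]_(t in `[p, q]) `|f t|%:E <= delta%:E)%E.
  apply: (@le_trans _ _ (\int[mu]_(t in `[p, q])
      ((delta / 2)%:E + (2 * delta)^-1%:E * (f t ^+ 2)%:E))%E).
    apply: ge0_le_integral => //=.
    - by apply/measurable_EFinP; exact: measurableT_comp.
    - apply: emeasurable_funD => //; apply: measurable_funeM.
      by apply/measurable_EFinP; exact: measurable_funX.
    - move=> t _; rewrite -EFinM -EFinD lee_fin -[f t ^+ 2]real_normK ?num_real//.
      rewrite -subr_ge0; have -> : delta / 2 + (2 * delta)^-1 * `|f t| ^+ 2 - `|f t| =
        (`|f t| - delta) ^+ 2 / (2 * delta) by field; rewrite gt_eqF.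
      by rewrite divr_ge0 ?sqr_ge0// mulr_ge0// ltW.
  rewrite ge0_integralD//=.
  - rewrite integral_cst//= ge0_integralZl//=.
    + rewrite lebesgue_measure_itv/= lte_fin.
      have -> : (delta%:E = (delta / 2)%:E * 1 + (2 * delta)^-1%:E * (delta ^+ 2)%:E)%E.
        by rewrite mule1 -EFinM -EFinD; congr EFin; field; rewrite gt_eqF.
      apply: leeD; last by rewrite lee_pmul2l// lte_fin invr_gt0 mulr_gt0.
      rewrite lee_pmul2l ?lte_fin ?divr_gt0//; case: ifPn => // _.
      by rewrite -EFinD lee_fin lerBlDl.
    + by apply/measurable_EFinP; exact: measurable_funX.
    + by move=> t _; rewrite lee_fin sqr_ge0.
    + by rewrite lee_fin invr_ge0 mulr_ge0// ltW.
  - by move=> t _; rewrite lee_fin divr_ge0// ltW.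
  - by move=> t _; rewrite -EFinM lee_fin mulr_ge0 ?sqr_ge0// invr_ge0 mulr_ge0// ltW.
  - apply: measurable_funeM.
    by apply/measurable_EFinP; exact: measurable_funX.
have intf : mu.-integrable `[p, q] (EFin \o f).
  apply/integrableP; split; first exact/measurable_EFinP.
  exact: le_lt_trans h (ltry _).
split => //; rewrite -lee_fin /Rintegral fineK//.
exact/integrable_fin_num/integrable_norm.
Qed.

Lemma continuous_repr_oscillation n z p Z delta s t : 0 < delta ->
  continuous_repr n z p (p + 1) Z -> measurable_fun `[p, p + 1] (z n.+1) ->
  (\int[mu]_(t in `[p, (p + 1)%R]) (z n.+1 t ^+ 2)%:E <= (delta ^+ 2)%:E)%E ->
  p <= s -> s <= t -> t <= p + 1 -> `|Z n t - Z n s| <= delta.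
Proof.
move=> d0 [_ _ it] mz hz ps st tp1; rewrite it//.
have sub : `[s, t] `<=` `[p, p + 1].
  by move=> x; rewrite /= !in_itv/= => /andP[h1 h2]; rewrite (le_trans ps)// (le_trans h2).
have mzs : measurable_fun `[s, t] (z n.+1) by apply: measurable_funS mz.
have [||h1 h2] := @integral_norm_le_sqr (z n.+1) s t delta st d0 mzs.
- apply: le_trans hz; apply: ge0_subset_integral => //.
  + by apply/measurable_EFinP; exact: measurable_funX.
  + by move=> x _; rewrite lee_fin sqr_ge0.
- lra.
by apply: le_trans h2; exact: le_normr_Rintegral.
Qed.

Lemma exists_small_point n z p Z eta c h : 0 < h ->
  continuous_repr n z p (p + 1) Z -> measurable_fun `[p, p + 1] (z 0%N) ->
  (mu [set t | `[p, (p + 1)%R]%classic t /\ (eta < `|z 0%N t|)%R] < h%:E)%E ->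
  p <= c -> c + h <= p + 1 -> exists2 t, c <= t <= c + h & `|Z 0%N t| <= eta.
Proof.
move=> h0 [_ /(_ 0%N (leq0n n)) ae _] mz small pc chp.
have [t [/andP[ct tch] Bt zZ]] := exists_outside c h0
  (measurable_superlevel eta (measurable_itv _) mz) small ae.
exists t; first by rewrite !ltW.
have [pt tp] : p < t /\ t < p + 1 by split; [exact: le_lt_trans ct|exact: lt_le_trans chp].
rewrite -zZ /= ?in_itv/= ?pt//.
by rewrite leNgt; apply/negP => h'; apply: Bt; split; rewrite //= in_itv/= !ltW.
Qed.

(** An exceptional set of measure below 2^-(n+1) cannot fill any of the subintervals in which
    [jet_bound] asks for a small point; the L^2 bound on the top derivative controls the oscillation
    one order below. *)
Lemma continuous_repr_jet n : exists2 C : R, 0 <= C & forall z p Z eta delta,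
  0 <= eta -> 0 < delta -> continuous_repr n z p (p + 1) Z ->
  measurable_fun `[p, p + 1] (z 0%N) -> measurable_fun `[p, p + 1] (z n.+1) ->
  (\int[mu]_(t in `[p, (p + 1)%R]) (z n.+1 t ^+ 2)%:E <= (delta ^+ 2)%:E)%E ->
  (mu [set t | `[p, (p + 1)%R]%classic t /\ (eta < `|z 0%N t|)%R] < (2^-1 ^+ n.+1)%:E)%E ->
  forall i t, (i <= n)%N -> p <= t <= p + 1 -> `|Z i t| <= C * (eta + delta).
Proof.
have [C C0 hC] := jet_bound n; exists C => // z p Z eta delta e0 d0 rep m0 mn hz hs.
have [ch _ _] := rep.
apply: (hC Z p eta delta e0 (ltW d0) ch).
  by move=> s t; exact: (continuous_repr_oscillation d0 rep mn hz).
move=> c pc cp; by apply: (exists_small_point _ rep m0 hs) => //; rewrite exprn_gt0.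
Qed.

End jets.

(** * Gluing to the wells and the one-jump lower bound *)

Section gluing.
Context {R : realType}.
Implicit Types (D A : set R) (y z : nat -> R -> R) (p q s t c : R) (k : nat).
Local Notation mu := (@lebesgue_measure R).

Definition energy (W : R -> R) k A z : \bar R :=
  (\int[mu]_(t in A) (W (z 0%N t) + z k t ^+ 2)%:E)%E.

Lemma near_eq_derive1n (f g : R -> R) n t : (\forall u \near t, f u = g u) ->
  derive1n n f t = derive1n n g t.
Proof.
move=> fg; suff : \forall u \near t, derive1n n f u = derive1n n g u.
  exact: nbhs_singleton.
elim: n => // n ih; rewrite !derive1nS.
move: (near_join ih); apply: filterS => u hu.
by rewrite !derive1E; apply: near_eq_derive.
Qed.

Lemma derive1nS_cst n (a : R) : derive1n n.+1 (cst a : R -> R) = cst 0.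
Proof.
elim: n => [|n ih]; first by rewrite derive1n1; apply/funext => u; rewrite derive1_cst.
by rewrite derive1nS ih; apply/funext => u; rewrite derive1_cst.
Qed.

Lemma smooth_derive1nD (f g : R -> R) n : smooth f -> smooth g ->
  derive1n n (f \+ g) = derive1n n f \+ derive1n n g.
Proof.
move=> sf sg; elim: n => // n ih; rewrite !derive1nS ih; apply/funext => u.
have [_ e] := is_deriveD (smooth_is_derive u (@smooth_derive1n _ f n sf))
  (smooth_is_derive u (@smooth_derive1n _ g n sg)).
by rewrite derive1E; exact: e.
Qed.

Lemma smooth_derive1nZ (f : R -> R) (a : R) n : smooth f ->
  derive1n n (cst a \* f) = cst a \* derive1n n f.
Proof.
move=> sf; elim: n => // n ih; rewrite !derive1nS ih; apply/funext => u.
have [_ e] := is_deriveZ a (smooth_is_derive u (@smooth_derive1n _ f n sf)).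
by rewrite derive1E; exact: e.
Qed.

(* The weak derivatives of chi * z_0 + H, by the Leibniz rule. *)
Definition glue (chi H : R -> R) z j : R -> R :=
  leibniz z (fun n => derive1n n chi) j \+ derive1n j H.

(** Under the local hypothesis the glued function is s + phi (z_0 - s), an interpolation between the
    well s and z_0, and the formula is the Leibniz rule for this product. The choices of [phi] that
    occur are 0, 1, a rising step and a falling step; they cover the whole line. *)
Lemma glue_local (chi H phi : R -> R) z j s t : smooth phi ->
  (\forall u \near t, chi u = phi u /\ H u = s * (1 - phi u)) ->
  glue chi H z j t = s * (j == 0%N)%:R +
  \sum_(i < j.+1) (z i t - s * (i == 0%N :> nat)%:R) * derive1n (j - i) phi t *+ 'C(j, i).
Proof.
move=> sphi loc; rewrite /glue/= /leibniz.
have e1 n : derive1n n chi t = derive1n n phi t.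
  by apply: near_eq_derive1n; move: loc; apply: filterS => u [].
have -> : derive1n j H t = s * (j == 0%N)%:R - s * derive1n j phi t.
  rewrite (@near_eq_derive1n _ (fun u => s * (1 - phi u))); last first.
    by move: loc; apply: filterS => u [].
  case: j => [|j]; first by rewrite /= mulr1 mulrBr mulr1.
  rewrite mulr0 sub0r.
  have -> : (fun u => s * (1 - phi u)) = cst s \+ (cst (- s) \* phi).
    by apply/funext => u /=; ring.
  rewrite smooth_derive1nD; [|exact: smooth_cst|exact: (smoothM (@smooth_cst _ _) sphi)].
  rewrite derive1nS_cst smooth_derive1nZ//.
  by rewrite -[LHS]/(0 + - s * derive1n j.+1 phi t) add0r mulNr.
rewrite addrC -addrA; congr (_ + _).
rewrite big_ord_recl/= [in RHS]big_ord_recl/= !bin0 !mulr1n subn0 e1 mulr1.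
rewrite mulrBl addrA [- _ + _]addrC; congr (_ + _).
apply: eq_bigr => i _; rewrite /bump/= add1n/= mulr0 subr0.
by rewrite e1.
Qed.

(** All terms of the Leibniz sum but the one with z_k contain a factor at most [omega]; the binomial
    coefficients add up to 2^k. *)
Lemma glue_local_bound (chi H phi : R -> R) z k s t (K omega : R) : (0 < k)%N -> smooth phi ->
  (\forall u \near t, chi u = phi u /\ H u = s * (1 - phi u)) ->
  0 <= K -> (forall n, (n <= k)%N -> `|derive1n n phi t| <= K) ->
  (forall i, (i < k)%N -> `|z i t - s * (i == 0%N)%:R| <= omega) ->
  `|glue chi H z 0 t - s| <= K * omega /\
  `|glue chi H z k t| <= K * (2 ^ k)%:R * (omega + `|z k t|).
Proof.
move=> k0 sphi loc K0 hK hz; split.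
  rewrite (glue_local _ _ sphi loc) big_ord1 bin0 mulr1n/= !mulr1 addrC addKr.
  rewrite normrM mulrC ler_pM//; first exact: (hK 0%N).
  by have := hz 0%N k0; rewrite mulr1.
rewrite (glue_local _ _ sphi loc) gt_eqF// mulr0 add0r.
have om0 : 0 <= omega by apply: le_trans (hz 0%N k0).
apply: le_trans (ler_norm_sum _ _ _) _.
have -> : (2 ^ k)%N = \sum_(i < k.+1) 'C(k, i).
  by rewrite -[2%N]/(1 + 1)%N expnDn; apply: eq_bigr => i _; rewrite !exp1n !muln1.
rewrite natr_sum mulr_sumr mulr_suml; apply: ler_sum => i _.
rewrite normrMn normrM -[_ *+ 'C(k, i)]mulr_natr.
have -> : K * 'C(k, i)%:R * (omega + `|z k t|) = (omega + `|z k t|) * K * 'C(k, i)%:R by ring.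
rewrite ler_wpM2r//; apply: ler_pM => //; last by apply: hK; rewrite leq_subr.
have [ik|ki] := ltnP i k; first by apply: le_trans (hz _ ik) _; rewrite lerDl.
have -> : i = k :> nat by apply/eqP; rewrite eqn_leq ki -ltnS ltn_ord.
by rewrite gt_eqF// mulr0 subr0 lerDr.
Qed.

Lemma glue_weak_chain D k z (chi H : R -> R) : open D -> weak_chain D k z ->
  test_function D chi -> smooth H ->
  (forall n, exists M, forall x, `|derive1n n H x| <= M) ->
  weak_chain setT k (glue chi H z).
Proof.
move=> oD cz tchi sH bH.
have := weak_chainD openT (weak_chain_leibniz oD cz tchi)
  (@weak_chain_smooth _ setT k H openT sH bH).
by [].
Qed.

(** Half of [theta] pays for [W], by its continuity at the well [s]. The other half pays for the
    square of the k-th derivative, since (omega + |z_k|)^2 <= 2 omega^2 + 2 z_k^2 and the last term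
    integrates to at most 2 omega^2. *)
Lemma cell_energy (W : R -> R) (s K B theta : R) : continuous W -> (forall x, 0 <= W x) -> W s = 0 ->
  0 <= K -> 0 <= B -> 0 < theta -> exists2 omega : R, 0 < omega & forall (y0 yk zk : R -> R) c,
  measurable_fun `[c, c + 1] y0 -> measurable_fun `[c, c + 1] yk ->
  measurable_fun `[c, c + 1] zk ->
  {ae mu, forall t, `[c, c + 1]%classic t ->
    `|y0 t - s| <= K * omega /\ `|yk t| <= B * (omega + `|zk t|)} ->
  (\int[mu]_(t in `[c, (c + 1)%R]) (zk t ^+ 2)%:E <= (omega ^+ 2)%:E)%E ->
  (\int[mu]_(t in `[c, (c + 1)%R]) (W (y0 t) + yk t ^+ 2)%:E <= theta%:E)%E.
Proof.
move=> cW W0 Ws K0 B0 th0.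
have : \forall x \near s, W x <= theta / 2.
  have := cW s; move/cvgrPdist_le => /(_ (theta / 2)); rewrite divr_gt0// => /(_ isT).
  apply: filterS => x; rewrite Ws sub0r normrN; apply: le_trans; exact: ler_norm.
move=> /nbhs_ballP[d /= d0 hd].
(* The first entry keeps the values in the ball of radius [d] about the well, the second gives
   omega^2 <= omega, and with the third 4 B^2 omega^2 <= theta / 2. *)
pose omega := Num.min (d / (2 * (K + 1))) (Num.min 1 (theta / (8 * (B ^+ 2 + 1)))).
have B1 : 0 < B ^+ 2 + 1 by rewrite ltr_wpDl// sqr_ge0.
have K1 : 0 < K + 1 by rewrite ltr_wpDl.
have om0 : 0 < omega.
  by rewrite !lt_min ltr01 !divr_gt0// mulr_gt0.
have omd : K * omega < d.
  have : omega <= d / (2 * (K + 1)) by rewrite /omega ge_min lexx.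
  rewrite ler_pdivlMr ?mulr_gt0// => h.
  by have := mulr_gt0 om0 K1; nra.
have omB : 4 * B ^+ 2 * omega ^+ 2 <= theta / 2.
  have h1 : omega <= 1 by rewrite /omega !ge_min lexx orbT.
  have : omega <= theta / (8 * (B ^+ 2 + 1)) by rewrite /omega !ge_min lexx !orbT.
  rewrite ler_pdivlMr ?mulr_gt0// => h2.
  have h3 : omega ^+ 2 <= omega by rewrite expr2 ler_piMl// ltW.
  have := ler_wpM2l (sqr_ge0 B) h3; have := sqr_ge0 B; have := ltW om0; nra.
exists omega => // y0 yk zk c my0 myk mzk hae hz.
have mWy : measurable_fun `[c, c + 1] (fun t => (W (y0 t) + yk t ^+ 2)%:E).
  apply/measurable_EFinP; apply: measurable_funD; last exact: measurable_funX.
  by apply: measurableT_comp => //; exact: continuous_measurable_fun.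
have mzk2 : measurable_fun `[c, c + 1] (fun t => (zk t ^+ 2)%:E).
  by apply/measurable_EFinP; exact: measurable_funX.
apply: (@le_trans _ _ (\int[mu]_(t in `[c, (c + 1)%R])
   ((theta / 2 + 2 * B ^+ 2 * omega ^+ 2)%:E + (2 * B ^+ 2)%:E * (zk t ^+ 2)%:E))%E).
  apply: ae_ge0_le_integral => //.
  - by move=> t _; rewrite lee_fin addr_ge0// sqr_ge0.
  - move=> t _; rewrite -EFinM -EFinD lee_fin.
    have h1 : 0 <= theta / 2 by rewrite divr_ge0 ?ltW.
    have h2 : 0 <= 2 * B ^+ 2 * omega ^+ 2 by apply: mulr_ge0; rewrite ?sqr_ge0// mulr_ge0 ?sqr_ge0.
    have h3 : 0 <= 2 * B ^+ 2 * zk t ^+ 2 by apply: mulr_ge0; rewrite ?sqr_ge0// mulr_ge0 ?sqr_ge0.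
    by rewrite !addr_ge0.
  - by apply: emeasurable_funD => //; exact: measurable_funeM.
  - move: hae; apply: filterS; first exact: (ae_filter_ringOfSetsType mu).
    move=> t h /h[h1 h2]; rewrite -EFinM -EFinD lee_fin -addrA lerD//.
      by apply: hd; rewrite /ball/= distrC (le_lt_trans h1).
    rewrite -[yk t ^+ 2]real_normK ?num_real//.
    apply: (@le_trans _ _ ((B * (omega + `|zk t|)) ^+ 2)).
      by rewrite lerXn2r// nnegrE// mulr_ge0// addr_ge0// ltW.
    rewrite -[zk t ^+ 2]real_normK ?num_real// exprMn.
    have -> : 2 * B ^+ 2 * omega ^+ 2 + 2 * B ^+ 2 * `|zk t| ^+ 2 =
      B ^+ 2 * (2 * omega ^+ 2 + 2 * `|zk t| ^+ 2) by ring.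
    rewrite ler_wpM2l ?sqr_ge0//.
    by have := sqr_ge0 (omega - `|zk t|); nra.
have ge1 : 0 <= theta / 2 + 2 * B ^+ 2 * omega ^+ 2.
  apply: addr_ge0; first by rewrite divr_ge0 ?ltW.
  by apply: mulr_ge0; rewrite ?sqr_ge0// mulr_ge0 ?sqr_ge0.
have ge2 : 0 <= 2 * B ^+ 2 by rewrite mulr_ge0 ?sqr_ge0.
rewrite ge0_integralD//=; first last.
- exact: measurable_funeM.
- by move=> t _; rewrite -EFinM lee_fin mulr_ge0 ?sqr_ge0.
rewrite integral_cst//= lebesgue_measure_itv/= lte_fin ltrDl ltr01 -EFinD.
rewrite (_ : c + 1 - c = 1); last by rewrite addrAC subrr add0r.
rewrite mule1 ge0_integralZl//; last by move=> t _; rewrite lee_fin sqr_ge0.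
apply: (@le_trans _ _ ((theta / 2 + 2 * B ^+ 2 * omega ^+ 2)%:E + (2 * B ^+ 2)%:E * (omega ^+ 2)%:E)%E).
  by apply: leeD => //; apply: lee_wpmul2l.
by rewrite -EFinM -EFinD lee_fin; nra.
Qed.

(** A translate of the smooth step that rises on [c, c + 1]; all translates share their derivative
    bounds. *)
Let sp c : R -> R := @smooth_step R \o affine 1 (- c).

Let sp_smooth c : smooth (sp c).
Proof. exact: (smooth_affine (@smooth_smooth_step R)). Qed.

Let sp0 c t : t <= c -> sp c t = 0.
Proof. by move=> tc; rewrite /sp/= smooth_step_le0// /affine mul1r; lra. Qed.

Let sp1 c t : c + 1 <= t -> sp c t = 1.
Proof. by move=> tc; rewrite /sp/= smooth_step_ge1// /affine mul1r; lra. Qed.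

Let sp_bounded k : exists2 K, 1 <= K & forall c n t, (n <= k)%N ->
  `|derive1n n (sp c) t| <= K.
Proof.
have [K K1 hK] : exists2 K, 1 <= K & forall n t, (n <= k)%N ->
    `|derive1n n (@smooth_step R) t| <= K.
  elim: k => [|k [K K1 hK]].
    exists 1 => // n t; rewrite leqn0 => /eqP ->.
    by rewrite /= ger0_norm ?smooth_step_ge0// smooth_step_le1.
  have [K' K'0 hK'] := @derive1n_smooth_step_bounded R k.+1.
  exists (K + K') => [|n t]; first by rewrite (le_trans K1)// lerDl.
  rewrite leq_eqVlt => /predU1P[->|nk].
    by rewrite (le_trans (hK' _))// lerDr (le_trans _ K1).
  by rewrite (le_trans (hK _ _ nk))// lerDl.
exists K => // c n t nk.
rewrite (_ : sp c = (fun x => smooth_step (1 * x + - c)))//.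
by rewrite derive1n_affine ?expr1n ?mul1r; [exact: hK|exact: smooth_smooth_step].
Qed.

(** The glued function coincides with [z] between the two cells and with the wells beyond them,
    where the energy density vanishes. Only the two cells cost anything extra, theta / 2 each. *)
Lemma glue_energy (W : R -> R) k (theta : R) : (0 < k)%N -> continuous W ->
  (forall x, 0 <= W x) -> W (-1) = 0 -> W 1 = 0 -> 0 < theta ->
  exists2 omega : R, 0 < omega & forall D z p q, open D -> weak_chain D k z ->
    p + 1 < q -> `[p, q + 1] `<=` D ->
    {ae mu, forall t, `[p, p + 1]%classic t ->
      forall i, (i < k)%N -> `|z i t + (i == 0%N)%:R| <= omega} ->
    {ae mu, forall t, `[q, q + 1]%classic t ->
      forall i, (i < k)%N -> `|z i t - (i == 0%N)%:R| <= omega} ->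
    (\int[mu]_(t in `[p, (p + 1)%R]) (z k t ^+ 2)%:E <= (omega ^+ 2)%:E)%E ->
    (\int[mu]_(t in `[q, (q + 1)%R]) (z k t ^+ 2)%:E <= (omega ^+ 2)%:E)%E ->
    exists y, [/\ weak_chain setT k y,
      forall t, t < p -> y 0%N t = -1 /\ y k t = 0,
      forall t, q + 1 < t -> y 0%N t = 1 /\ y k t = 0 &
      (energy W k setT y <= energy W k `](p + 1)%R, q[ z + theta%:E)%E].
Proof.
move=> k0 cW W0 Wm1 W1 th0.
have [K K1 hK] := sp_bounded k.
have K0 : 0 <= K by exact: le_trans K1.
(* The falling step is a constant 1 minus a rising one, hence the bound K + 1 for it and its
   derivatives. *)
pose K' := K + 1; have K'0 : 0 <= K' by rewrite addr_ge0.
pose B := K' * (2 ^ k)%:R; have B0 : 0 <= B by rewrite mulr_ge0.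
have th20 : 0 < theta / 2 by rewrite divr_gt0.
have [w1 w1_gt0 hw1] := @cell_energy W (-1) K' B _ cW W0 Wm1 K'0 B0 th20.
have [w2 w2_gt0 hw2] := @cell_energy W 1 K' B _ cW W0 W1 K'0 B0 th20.
exists (Num.min w1 w2) => [|D z p q oD cz pq pqD]; first by rewrite lt_min w1_gt0.
set omega := Num.min w1 w2.
have om0 : 0 < omega by rewrite lt_min w1_gt0.
have ole1 : omega <= w1 by rewrite /omega ge_min lexx.
have ole2 : omega <= w2 by rewrite /omega ge_min lexx orbT.
move=> jl jr el er.
(* [chi] is 1 between the two cells and 0 outside, while [H] passes from -1 through 0 to 1. On each
   cell only one of the two steps varies, so both reduce to the local form of [glue_local]. *)
pose chi := sp p \* (cst 1 \+ (cst (-1) \* sp q)).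
pose H := cst (-1) \+ (sp p \+ sp q).
have s1q : smooth (cst 1 \+ (cst (-1) \* sp q)).
  by apply: smoothD; [exact: smooth_cst|apply: smoothM; [exact: smooth_cst|exact: sp_smooth]].
have tchi : test_function D chi.
  split; first by apply: smoothM; [exact: sp_smooth|exact: s1q].
  exists `[p, q + 1]%classic; split => //; first exact: segment_compact.
  move=> x; rewrite /= in_itv/= => /negP; rewrite negb_and -!ltNge /chi/=.
  by case/orP => h; [rewrite sp0 ?mul0r// ltW|rewrite (sp1 (ltW h)); ring].
have sH : smooth H.
  by apply: smoothD; [exact: smooth_cst|apply: smoothD; exact: sp_smooth].
have bH n : exists M, forall x, `|derive1n n H x| <= M.
  have [M M1 hM] := sp_bounded n.
  exists (1 + (M + M)) => x; rewrite /H smooth_derive1nD; first last.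
  - by apply: smoothD; exact: sp_smooth.
  - exact: smooth_cst.
  rewrite smooth_derive1nD; [|exact: sp_smooth..].
  rewrite /=; apply: le_trans (ler_normD _ _) _; apply: lerD.
    case: n {hM} => [|n]; first by rewrite /= normrN1.
    by have -> := @derive1nS_cst n (-1); rewrite normr0.
  by apply: le_trans (ler_normD _ _) _; apply: lerD; exact: hM.
have cy := glue_weak_chain oD cz tchi sH bH.
pose y := glue chi H z.
have chiE u : chi u = sp p u * (1 - sp q u) by rewrite /chi/= mulN1r.
have HE u : H u = -1 + (sp p u + sp q u) by [].
have outl t : t < p -> forall j, y j t = -1 * (j == 0%N)%:R.
  move=> tp j; rewrite /y (@glue_local _ _ (cst 0) _ _ (-1)); [|exact: smooth_cst|].
    rewrite big1 ?addr0// => i _.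
    have -> : derive1n (j - i) (cst 0 : R -> R) t = 0 by case: (j - i)%N => // n; rewrite derive1nS_cst.
    by rewrite mulr0 mul0rn.
  near=> u; have up : u < p by near: u; exact: lt_nbhsl.
  rewrite chiE HE (sp0 (ltW up)) (_ : sp q u = 0) ?sp0//; last by lra.
  by split => /=; ring.
have outr t : q + 1 < t -> forall j, y j t = 1 * (j == 0%N)%:R.
  move=> tp j; rewrite /y (@glue_local _ _ (cst 0) _ _ 1); [|exact: smooth_cst|].
    rewrite big1 ?addr0// => i _.
    have -> : derive1n (j - i) (cst 0 : R -> R) t = 0 by case: (j - i)%N => // n; rewrite derive1nS_cst.
    by rewrite mulr0 mul0rn.
  near=> u; have up : q + 1 < u by near: u; exact: lt_nbhsr.
  rewrite chiE HE (sp1 (ltW up)) (_ : sp p u = 1) ?sp1//; last by lra.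
  by split => /=; ring.
have mid t : p + 1 < t -> t < q -> forall j, y j t = z j t.
  move=> pt tq j; rewrite /y (@glue_local _ _ (cst 1) _ _ 1); [|exact: smooth_cst|].
    rewrite big_ord_recr/= big1 ?add0r; last first.
      move=> i _; rewrite /= (_ : (j - i)%N = (j - i).-1.+1) ?derive1nS_cst ?mulr0 ?mul0rn//.
      by rewrite prednK// subn_gt0.
    by rewrite subnn/= binn mulr1n mulr1 !mul1r addrC subrK.
  near=> u; have pu : p + 1 < u by near: u; exact: lt_nbhsr.
  have uq : u < q by near: u; exact: lt_nbhsl.
  by rewrite chiE HE (sp1 (ltW pu)) (sp0 (ltW uq)) /=; split; ring.
have cell (s o c : R) (phi : R -> R) : smooth phi -> omega <= o ->
    (forall n t, (n <= k)%N -> `|derive1n n phi t| <= K') ->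
    (forall t, `[c, c + 1]%classic t -> \forall u \near t, chi u = phi u /\ H u = s * (1 - phi u)) ->
    {ae mu, forall t, `[c, c + 1]%classic t ->
      forall i, (i < k)%N -> `|z i t - s * (i == 0%N)%:R| <= omega} ->
    {ae mu, forall t, `[c, c + 1]%classic t ->
      `|y 0%N t - s| <= K' * o /\ `|y k t| <= B * (o + `|z k t|)}.
  move=> sphi oo hphi loc; apply: filterS; first exact: (ae_filter_ringOfSetsType mu).
  move=> t h ct; apply: (glue_local_bound k0 sphi (loc _ ct) K'0) => [n nk|i ik].
    exact: hphi.
  exact: le_trans (h ct i ik) oo.
have cl : {ae mu, forall t, `[p, p + 1]%classic t ->
      `|y 0%N t - -1| <= K' * w1 /\ `|y k t| <= B * (w1 + `|z k t|)}.
  apply: (cell _ _ _ (sp p)); [exact: sp_smooth|exact: ole1| | |].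
  - by move=> n t nk; rewrite (le_trans (hK _ _ _ nk))// /K' lerDl.
  - move=> t; rewrite /= in_itv/= => /andP[pt tp1]; near=> u.
    have uq : u < q by near: u; apply: lt_nbhsl; lra.
    by rewrite chiE HE (sp0 (ltW uq)); split; ring.
  - move: jl; apply: filterS; first exact: (ae_filter_ringOfSetsType mu).
    by move=> t h pt i ik; rewrite mulN1r opprK; exact: h.
have cr : {ae mu, forall t, `[q, q + 1]%classic t ->
      `|y 0%N t - 1| <= K' * w2 /\ `|y k t| <= B * (w2 + `|z k t|)}.
  apply: (cell _ _ _ (cst 1 \+ (cst (-1) \* sp q))); [exact: s1q|exact: ole2| | |].
  - move=> n t nk; rewrite smooth_derive1nD; first last.
    + by apply: smoothM; [exact: smooth_cst|exact: sp_smooth].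
    + exact: smooth_cst.
    rewrite smooth_derive1nZ; last exact: sp_smooth.
    rewrite -[X in `|X|]/(derive1n n (cst 1 : R -> R) t + -1 * derive1n n (sp q) t) /K' addrC.
    apply: le_trans (ler_normD _ _) _; apply: lerD; first by rewrite mulN1r normrN; exact: hK.
    by case: n nk => [|n] _; [rewrite /= normr1|rewrite derive1nS_cst normr0].
  - move=> t; rewrite /= in_itv/= => /andP[qt tq1]; near=> u.
    have uq : p + 1 < u by near: u; apply: lt_nbhsr; lra.
    by rewrite chiE HE (sp1 (ltW uq)) /=; split; ring.
  - move: jr; apply: filterS; first exact: (ae_filter_ringOfSetsType mu).
    by move=> t h pt i ik; rewrite mul1r; exact: h.
exists y; split => //.
- by move=> t tp; rewrite !outl// mulr1 gt_eqF// mulr0.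
- by move=> t tp; rewrite !outr// mulr1 gt_eqF// mulr0.
have [lz _] := cz; have [ly _] := cy.
have mcell j c : (j <= k)%N -> `[c, c + 1] `<=` D -> measurable_fun `[c, c + 1] (z j).
  by move=> jk cD; have [m _] := lz j jk; apply: measurable_funS m => //; exact: open_measurable.
have myj j A : (j <= k)%N -> measurable_fun A (y j).
  by move=> jk; have [m _] := ly j jk; apply: measurable_funS m.
have pq' : p <= q by rewrite (le_trans _ (ltW pq))// lerDl.
have pD : `[p, p + 1] `<=` D.
  apply: subset_trans pqD => t; rewrite /= !in_itv/= => /andP[-> h2].
  by rewrite (le_trans h2)// lerD2r.
have qD : `[q, q + 1] `<=` D.
  apply: subset_trans pqD => t; rewrite /= !in_itv/= => /andP[h1 ->].
  by rewrite (le_trans pq').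
have e1 := hw1 (y 0%N) (y k) (z k) p (myj _ _ (leq0n k)) (myj _ _ (leqnn k)) (mcell k p (leqnn k) pD) cl.
have e2 := hw2 (y 0%N) (y k) (z k) q (myj _ _ (leq0n k)) (myj _ _ (leqnn k)) (mcell k q (leqnn k) qD) cr.
have {}e1 := e1 (le_trans el _); have {}e2 := e2 (le_trans er _).
pose f t := (W (y 0%N t) + y k t ^+ 2)%:E.
pose g t := (W (z 0%N t) + z k t ^+ 2)%:E.
have f0 t : (0 <= f t)%E by rewrite lee_fin addr_ge0// sqr_ge0.
have g0 t : (0 <= g t)%E by rewrite lee_fin addr_ge0// sqr_ge0.
have mf A : measurable_fun A f.
  apply/measurable_EFinP; apply: measurable_funD; last by apply: measurable_funX; exact: myj.
  by apply: measurableT_comp; [exact: continuous_measurable_fun|exact: myj].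
have mg : measurable_fun `]p + 1, q[ g.
  have m j : (j <= k)%N -> measurable_fun `]p + 1, q[ (z j).
    move=> jk; have [m _] := lz j jk; apply: measurable_funS m; first exact: open_measurable.
    move=> t; rewrite /= in_itv/= => /andP[h1 h2]; apply: pqD; rewrite /= in_itv/=.
    rewrite (le_trans _ (ltW h1)) ?lerDl//=.
    by rewrite (le_trans (ltW h2))// lerDl.
  apply/measurable_EFinP; apply: measurable_funD; last by apply: measurable_funX; exact: m.
  by apply: measurableT_comp; [exact: continuous_measurable_fun|exact: m].
have pr0 A (h : R -> \bar R) : (forall t, (0 <= h t)%E) -> forall t, (0 <= (h \_ A) t)%E.
  by move=> h0 t; rewrite patchE; case: ifP.
have mr A (h : R -> \bar R) : measurable A -> measurable_fun A h -> measurable_fun setT (h \_ A).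
  by move=> mA mh; apply/(measurable_restrictT h mA).
(* The density is bounded by a sum of three truncated functions, which avoids partitioning the line
   into five intervals. *)
apply: (@le_trans _ _ (\int[mu]_t ((f \_ `[p, (p + 1)%R]) t +
   ((g \_ `](p + 1)%R, q[) t + (f \_ `[q, (q + 1)%R]) t)))%E).
  apply: ge0_le_integral => //.
  - by move=> t _; exact: f0.
  - exact: mf.
  - apply: emeasurable_funD; first exact: mr.
    by apply: emeasurable_funD; apply: mr.
  - move=> t _; rewrite -/(f t).
    have [tp|pt] := ltP t p.
      rewrite /f !outl// !mulr1 Wm1 gt_eqF// mulr0 expr0n/= addr0.
      by rewrite !adde_ge0// pr0.
    have [tp1|tp1] := leP t (p + 1).
      rewrite [X in (_ <= X + _)%E]patchE mem_setE in_itv/= pt tp1/=.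
      by rewrite leeDl// adde_ge0// pr0.
    have [tq|qt] := ltP t q.
      rewrite addeCA [X in (_ <= X + _)%E]patchE mem_setE in_itv/= tp1 tq/=.
      by rewrite /f !mid// leeDl// adde_ge0// pr0.
    have [tq1|tq1] := leP t (q + 1).
      rewrite addeA addeC [X in (_ <= X + _)%E]patchE mem_setE in_itv/= qt tq1/=.
      by rewrite leeDl// adde_ge0// pr0.
    rewrite /f !outr// !mulr1 W1 gt_eqF// mulr0 expr0n/= addr0.
    by rewrite !adde_ge0// pr0.
rewrite ge0_integralD//; first last.
- by apply: emeasurable_funD; exact: mr.
- by move=> t _; rewrite adde_ge0// pr0.
- exact: mr.
- by move=> t _; exact: pr0.
rewrite ge0_integralD//; first last.
- exact: mr.
- by move=> t _; exact: pr0.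
- exact: mr.
- by move=> t _; exact: pr0.
rewrite -!integral_mkcond addeCA; apply: leeD => //.
rewrite (_ : theta%:E = (theta / 2)%:E + (theta / 2)%:E)%E; last first.
  by rewrite -EFinD -splitr.
by apply: leeD; [apply: e1|apply: e2]; rewrite lee_fin lerXn2r// nnegrE ltW.
Unshelve. all: by end_near. Qed.

End gluing.

(** * Selection of good cells and almost optimal profiles *)

Section optimal_profile.
Context {R : realType}.
Implicit Types (D A : set R) (y z : nat -> R -> R) (p q s t c : R) (k : nat).
Local Notation mu := (@lebesgue_measure R).

Lemma cell_integral_sum (f : R -> \bar R) n c :
  measurable_fun `[c, c + n%:R] f -> (forall t, (0 <= f t)%E) ->
  (\int[mu]_(t in `[c, (c + n%:R)%R]) f t =
   \sum_(i < n) \int[mu]_(t in `[(c + i%:R)%R, (c + i%:R + 1)%R]) f t)%E.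
Proof.
move=> mf f0; elim: n mf => [|n ih] mf.
  by rewrite addr0 big_ord0 set_itv1 integral_set1.
have sub1 : `[c, c + n%:R] `<=` `[c, c + n.+1%:R].
  by move=> t; rewrite /= !in_itv/= => /andP[-> /le_trans]; apply; rewrite lerD2l ler_nat.
have sub2 : `]c + n%:R, c + n.+1%:R] `<=` `[c, c + n.+1%:R].
  move=> t; rewrite /= !in_itv/= => /andP[h1 ->]; rewrite andbT.
  by rewrite (le_trans _ (ltW h1))// lerDl.
have cn : c + n%:R + 1 = c + n.+1%:R by rewrite -addrA natr1.
rewrite big_ord_recr/= -ih; last by apply: measurable_funS mf.
rewrite cn -[in X in (_ = _ + X)%E]integral_itv_obnd_cbnd; last by apply: measurable_funS mf.
have -> : `[c, c + n.+1%:R]%classic = `[c, c + n%:R] `|` `]c + n%:R, c + n.+1%:R].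
  apply/seteqP; split=> t; last by case=> [/sub1|/sub2].
  rewrite /= !in_itv/= => /andP[-> ->]; rewrite andbT.
  by case: (leP t (c + n%:R)) => h; [left|right].
rewrite ge0_integral_setU//.
- by apply: measurable_funS mf => //; rewrite subUset.
- apply/disj_setPS => t [] /=; rewrite !in_itv/= => /andP[_ h1] /andP[h2 _].
  by move: (lt_le_trans h2 h1); rewrite ltxx.
Qed.

Lemma lt_cell_integral (f : R -> \bar R) n c (tau : R) :
  measurable_fun `[c, c + n%:R] f -> (forall t, (0 <= f t)%E) ->
  (\int[mu]_(t in `[c, (c + n%:R)%R]) f t < (n%:R * tau)%:E)%E ->
  exists2 i, (i < n)%N & (\int[mu]_(t in `[(c + i%:R)%R, (c + i%:R + 1)%R]) f t < tau%:E)%E.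
Proof.
move=> mf f0 h; apply: contrapT => none; move: h; apply/negP; rewrite -leNgt.
have -> : n%:R * tau = \sum_(i < n) tau by rewrite sumr_const card_ord mulr_natl.
rewrite cell_integral_sum// -sumEFin; apply: lee_sum => i _.
by rewrite leNgt; apply/negP => lt; apply: none; exists i.
Qed.

Lemma m_opt_le (W : R -> R) k z : continuous W -> (forall x, 0 <= W x) ->
  weak_chain setT k z -> z 0%N t @[t --> +oo] --> (1 : R) ->
  z 0%N t @[t --> -oo] --> (-1 : R) -> (m_opt k W <= energy W k setT z)%E.
Proof.
move=> cW W0 cz z1 zm1; apply: ereal_inf_lbound; exists (z 0%N).
  by split => //; apply: weak_chain_sobolevH_loc => //; exact: openT.
have := @weak_derivative_energy R setT k z 1 1 W openT cz cW W0 ler01 ler01.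
under eq_integral do rewrite !mul1r.
by under [in RHS]eq_integral do rewrite !mul1r.
Qed.

Lemma m_opt_ge0 (W : R -> R) k : (forall x, 0 <= W x) -> (0 <= m_opt k W)%E.
Proof.
move=> W0; apply: le_ereal_inf_tmp => _ [u _ <-]; apply: integral_ge0 => t _.
by rewrite lee_fin addr_ge0// sqr_ge0.
Qed.

(** The profile 2 smooth_step - 1 is a competitor whose energy density is continuous and supported
    in [0, 1]. *)
Lemma m_opt_lty (W : R -> R) k : (0 < k)%N -> continuous W -> (forall x, 0 <= W x) ->
  W (-1) = 0 -> W 1 = 0 -> (m_opt k W < +oo)%E.
Proof.
move=> k0 cW W0 Wm1 W1.
pose H : R -> R := cst (-1) \+ (cst 2 \* @smooth_step R).
have s2 : smooth (cst 2 \* @smooth_step R).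
  by apply: smoothM; [exact: smooth_cst|exact: smooth_smooth_step].
have sH : smooth H by apply: smoothD; [exact: smooth_cst|exact: s2].
have HS n t : derive1n n.+1 H t = 2 * derive1n n.+1 (@smooth_step R) t.
  rewrite smooth_derive1nD; [|exact: smooth_cst|exact: s2].
  rewrite derive1nS_cst smooth_derive1nZ; last exact: smooth_smooth_step.
  by rewrite -[LHS]/(0 + 2 * derive1n n.+1 (@smooth_step R) t) add0r.
have H0 t : t <= 0 -> H t = -1.
  by move=> t0; rewrite /H/= smooth_step_le0// mulr0 addr0.
have H1 t : 1 <= t -> H t = 1.
  by move=> t0; rewrite /H/= smooth_step_ge1// mulr1; ring.
have bH n : exists M, forall x, `|derive1n n H x| <= M.
  case: n => [|n].
    exists 1 => t; rewrite /H/= ler_norml.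
    by have := smooth_step_ge0 t; have := smooth_step_le1 t; move=> h1 h2; apply/andP; split; lra.
  have [M M0 hM] := @derive1n_smooth_step_bounded R n.+1.
  by exists (2 * M) => t; rewrite HS normrM ger0_norm// ler_pM2l.
have cH := @weak_chain_smooth _ setT k H openT sH bH.
apply: (@le_lt_trans _ _ (energy W k setT (fun n => derive1n n H))).
  apply: m_opt_le => //.
    apply: cvg_near_cst; near=> t; apply: H1.
    by near: t; apply: nbhs_pinfty_ge; rewrite num_real.
  apply: cvg_near_cst; near=> t; apply: H0.
  by near: t; apply: nbhs_ninfty_le; rewrite num_real.
pose e t := W (H t) + derive1n k H t ^+ 2.
have ce : continuous e.
  move=> t; apply: cvgD.
    by apply: continuous_comp; [exact: smooth_continuous|exact: cW].
  apply: (@continuous_comp _ _ _ (derive1n k H) (fun x => x ^+ 2)).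
    by apply: smooth_continuous; exact: smooth_derive1n.
  exact: exprn_continuous.
have e0 t : ~ `[0, 1]%classic t -> e t = 0.
  rewrite /= in_itv/= => /negP; rewrite negb_and -!ltNge => /orP h.
  rewrite /e; case: k k0 {cH ce e} => // n _.
  rewrite HS derive1n_smooth_step_eq0// mulr0 expr0n addr0.
  by case: h => h; [rewrite H0// ltW|rewrite H1// ltW].
have -> : energy W k setT (fun n => derive1n n H) = (\int[mu]_(t in `[0%R, 1%R]) (e t)%:E)%E.
  rewrite /energy integral_mkcond [RHS]integral_mkcond; apply: eq_integral => t _.
  rewrite patchT ?in_setT// patchE; case: ifPn => // /negP h.
  rewrite -/(e t) e0// => h'; apply: h; exact: mem_set.
apply: integrable_lty => //; apply: continuous_compact_integrable.
  exact: segment_compact.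
exact: continuous_subspaceT.
Unshelve. all: by end_near. Qed.

(** The jet estimate is applied to z_0 - s, which has the same derivatives of positive order, and
    then carried back from the continuous representatives; the end points of the cell join the
    exceptional null set. *)
Lemma small_jets k : (0 < k)%N -> exists2 C : R, 0 <= C &
  forall D z p s (eta delta : R), open D -> weak_chain D k z -> `[p, p + 1] `<=` D ->
  0 <= eta -> 0 < delta ->
  (\int[mu]_(t in `[p, (p + 1)%R]) (z k t ^+ 2)%:E <= (delta ^+ 2)%:E)%E ->
  (mu [set t | `[p, (p + 1)%R]%classic t /\ (eta < `|z 0%N t - s|)%R] < (2^-1 ^+ k)%:E)%E ->
  {ae mu, forall t, `[p, p + 1]%classic t ->
    forall i, (i < k)%N -> `|z i t - s * (i == 0%N)%:R| <= C * (eta + delta)}.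
Proof.
case: k => // n _; have [C C0 hC] := @continuous_repr_jet R n; exists C => //.
move=> D z p s eta delta oD cz pD e0 d0 hz hs.
pose y j := z j \+ cst (if j is 0%N then - s else 0).
have cy : weak_chain D n.+1 y by exact: weak_chainD oD cz (weak_chain_cst _ _ oD).
have [ly _] := cy.
have my j : (j <= n.+1)%N -> measurable_fun `[p, p + 1] (y j).
  by move=> jn; have [m _] := ly j jn; apply: measurable_funS m => //; exact: open_measurable.
have pp1 : p < p + 1 by rewrite ltrDl.
have [Z [h1 h2 h3 h4]] := weak_chain_continuous_repr oD pp1 pD cy.
have rep : continuous_repr n y p (p + 1) Z by split.
have bZ := hC y p Z eta delta e0 d0 rep (my _ (leq0n _)) (my _ (leqnn _)).
have {}bZ i t : (i <= n)%N -> p <= t <= p + 1 -> `|Z i t| <= C * (eta + delta).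
  apply: bZ => //.
  have -> : y n.+1 = z n.+1 by apply/funext => u; rewrite /y/= addr0.
  exact: hz.
have : {ae mu, forall t, forall i, (i <= n)%N -> `]p, p + 1[%classic t -> y i t = Z i t}.
  apply: ae_foralln => i; have [ik|ik] := leqP i n; last by apply: aeW.
  have [N [mN N0 hN]] := h1 i ik; exists N; split => // t /= h; apply: hN => /= h'.
  by apply: h => _; exact: h'.
move=> [N [mN N0 hN]].
exists (N `|` ([set p] `|` [set p + 1])); split.
- by do 2 apply: measurableU => //.
- rewrite (@measureU0 _ _ _ mu)//; first exact: measurableU.
  by rewrite (@measureU0 _ _ _ mu)//; exact: lebesgue_measure_set1.
move=> t /= h; have [->|tp] := eqVneq t p; first by right; left.
have [->|tp1] := eqVneq t (p + 1); first by right; right.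
left; apply: hN => /= h'; apply: h; rewrite in_itv/= => /andP[t1 t2] i ik.
have -> : z i t - s * (i == 0%N)%:R = y i t.
  by rewrite /y/=; case: (i) => [|j]/=; rewrite ?mulr1// mulr0 subr0 addr0.
rewrite h'//; last first.
  by rewrite in_itv/= lt_neqAle eq_sym tp t1 lt_neqAle tp1 t2.
by apply: bZ => //; rewrite t1.
Qed.

(* Pigeonhole: one of the n cells has small energy and few points away from the value s. *)
Lemma good_cell k (omega : R) : (0 < k)%N -> 0 < omega -> exists2 eta : R, 0 < eta &
  exists2 tau : R, 0 < tau & forall D z c n s, open D -> weak_chain D k z ->
  `[c, c + n%:R] `<=` D ->
  (\int[mu]_(t in `[c, (c + n%:R)%R]) (z k t ^+ 2)%:E +
   mu [set t | `[c, (c + n%:R)%R]%classic t /\ (eta < `|z 0%N t - s|)%R] < (n%:R * tau)%:E)%E ->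
  exists2 i, (i < n)%N & let p := c + i%:R in
    (\int[mu]_(t in `[p, (p + 1)%R]) (z k t ^+ 2)%:E <= (omega ^+ 2)%:E)%E /\
    {ae mu, forall t, `[p, p + 1]%classic t ->
      forall i, (i < k)%N -> `|z i t - s * (i == 0%N)%:R| <= omega}.
Proof.
move=> k0 om0; have [C C0 hC] := small_jets k0.
have C1 : 0 < 2 * (C + 1) by rewrite mulr_gt0// ltr_wpDl.
(* The same [eta] serves as pointwise tolerance and as L^2 bound, so the jet estimate reads C (eta +
   eta) <= omega. *)
pose eta := Num.min omega (omega / (2 * (C + 1))).
have eta0 : 0 < eta by rewrite lt_min om0 divr_gt0.
have etaC : C * (eta + eta) <= omega.
  have : eta <= omega / (2 * (C + 1)) by rewrite /eta ge_min lexx orbT.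
  by rewrite ler_pdivlMr// => h; nra.
have eo : eta <= omega by rewrite /eta ge_min lexx.
(* Below this threshold a cell has both the L^2 bound eta^2 and an exceptional set of measure less
   than 2^-k. *)
exists eta => //; exists (Num.min (eta ^+ 2) (2^-1 ^+ k)).
  by rewrite lt_min !exprn_gt0.
move=> D z c n s oD cz cD; set tau := Num.min _ _.
set B := [set t | _ /\ _].
have [lz _] := cz.
have mz j : (j <= k)%N -> measurable_fun `[c, c + n%:R] (z j).
  by move=> jk; have [m _] := lz j jk; apply: measurable_funS m => //; exact: open_measurable.
have mB : measurable B.
  apply: (@measurable_superlevel _ `[c, c + n%:R]%classic (z 0%N \- cst s)) => //.
  by apply: measurable_funB => //; exact: mz.
have mz2 : measurable_fun `[c, c + n%:R] (fun t => (z k t ^+ 2)%:E).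
  by apply/measurable_EFinP; apply: measurable_funX; exact: mz.
(* A single integrand for both quantities, so that one pigeonhole argument selects a cell that is
   good for both. *)
pose f t := ((z k t ^+ 2)%:E + (\1_B t)%:E)%E.
have f0 t : (0 <= f t)%E by rewrite /f -EFinD lee_fin addr_ge0 ?sqr_ge0.
have mf : measurable_fun `[c, c + n%:R] f.
  by apply: emeasurable_funD => //; apply/measurable_EFinP; exact: measurable_indic.
have -> : (\int[mu]_(t in `[c, (c + n%:R)%R]) (z k t ^+ 2)%:E + mu B =
    \int[mu]_(t in `[c, (c + n%:R)%R]) f t)%E.
  rewrite ge0_integralD//=.
  - by rewrite integral_indic//; congr (_ + mu _)%E; rewrite setIidl// => t [].
  - by move=> t _; rewrite lee_fin sqr_ge0.
  - by apply/measurable_EFinP; exact: measurable_indic.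
move=> /(lt_cell_integral mf f0)[i ik hi]; exists i => //=.
set p := c + i%:R in hi *.
have pc : `[p, p + 1] `<=` `[c, c + n%:R].
  move=> t; rewrite /= !in_itv/= /p -addrA natr1 => /andP[h1 h2].
  by rewrite (le_trans _ h1) ?lerDl//= (le_trans h2)// lerD2l ler_nat.
have mzp : measurable_fun `[p, p + 1] (fun t => (z k t ^+ 2)%:E) by apply: measurable_funS mz2.
have hz : (\int[mu]_(t in `[p, (p + 1)%R]) (z k t ^+ 2)%:E <= (eta ^+ 2)%:E)%E.
  apply: (@le_trans _ _ tau%:E); last by rewrite lee_fin /tau ge_min lexx.
  apply: le_trans (ltW hi); apply: ge0_le_integral => //.
  - by move=> t _; rewrite lee_fin sqr_ge0.
  - exact: measurable_funS mf.
  - by move=> t _; rewrite leeDl.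
have hb : (mu [set t | `[p, (p + 1)%R]%classic t /\ (eta < `|z 0%N t - s|)%R] < (2^-1 ^+ k)%:E)%E.
  have -> : [set t | `[p, (p + 1)%R]%classic t /\ (eta < `|z 0%N t - s|)%R] = B `&` `[p, p + 1].
    by apply/seteqP; split => t [h1 h2]; split => //; [split => //; exact: pc|case: h1].
  apply: (@lt_le_trans _ _ tau%:E); last by rewrite lee_fin /tau ge_min lexx orbT.
  apply: le_lt_trans hi; rewrite -integral_indic//.
  apply: ge0_le_integral => //.
  - by apply/measurable_EFinP; exact: measurable_indic.
  - exact: measurable_funS mf.
  - by move=> t _; rewrite leeDr// lee_fin sqr_ge0.
split.
  apply: (le_trans hz); rewrite lee_fin lerXn2r// nnegrE ltW//.
have := hC D z p s eta eta oD cz (subset_trans pc cD) (ltW eta0) eta0 hz hb.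
apply: filterS; first exact: (ae_filter_ringOfSetsType mu).
by move=> t h tp j jk; apply: le_trans (h tp j jk) etaC.
Qed.

(** The thresholds [eta] and [tau] do not depend on the number [n] of cells: taking enough cells
    makes n tau exceed any given energy. *)
Lemma one_jump_lower_bound (W : R -> R) k (theta : R) : (0 < k)%N -> continuous W ->
  (forall x, 0 <= W x) -> W (-1) = 0 -> W 1 = 0 -> 0 < theta ->
  exists2 eta : R, 0 < eta & exists2 tau : R, 0 < tau &
  forall D z l r n, open D -> weak_chain D k z -> l + n%:R < r -> `[l, r + n%:R] `<=` D ->
  (\int[mu]_(t in `[l, (l + n%:R)%R]) (z k t ^+ 2)%:E +
   mu [set t | `[l, (l + n%:R)%R]%classic t /\ (eta < `|z 0%N t - -1|)%R] < (n%:R * tau)%:E)%E ->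
  (\int[mu]_(t in `[r, (r + n%:R)%R]) (z k t ^+ 2)%:E +
   mu [set t | `[r, (r + n%:R)%R]%classic t /\ (eta < `|z 0%N t - 1|)%R] < (n%:R * tau)%:E)%E ->
  exists y T, [/\ weak_chain setT k y,
     forall t, t < - T -> y 0%N t = -1 /\ y k t = 0,
     forall t, T < t -> y 0%N t = 1 /\ y k t = 0 &
     (energy W k setT y <= energy W k `[l, (r + n%:R)%R] z + theta%:E)%E].
Proof.
move=> k0 cW W0 Wm1 W1 th0.
have [omega om0 hom] := glue_energy k0 cW W0 Wm1 W1 th0.
have [eta eta0 [tau tau0 hg]] := good_cell k0 om0.
exists eta => //; exists tau => // D z l r n oD cz lr lD hl hr.
have ll : l <= l + n%:R by rewrite lerDl.
have rr : r <= r + n%:R by rewrite lerDl.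
have lD1 : `[l, l + n%:R] `<=` D.
  apply: subset_trans lD => t; rewrite /= !in_itv/= => /andP[-> h2].
  by rewrite (le_trans h2)// (le_trans (ltW lr)).
have rD1 : `[r, r + n%:R] `<=` D.
  apply: subset_trans lD => t; rewrite /= !in_itv/= => /andP[h1 ->].
  by rewrite (le_trans _ h1)// (le_trans ll (ltW lr)).
have [i ik [i1 i2]] := hg D z l n (-1) oD cz lD1 hl.
have [j jk [j1 j2]] := hg D z r n 1 oD cz rD1 hr.
set p := l + i%:R in i1 i2; set q := r + j%:R in j1 j2.
have lp : l <= p by rewrite lerDl.
have pl : p + 1 <= l + n%:R by rewrite -addrA natr1 lerD2l ler_nat.
have rq : r <= q by rewrite lerDl.
have qr : q + 1 <= r + n%:R by rewrite -addrA natr1 lerD2l ler_nat.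
have pq : p + 1 < q by rewrite (le_lt_trans pl)// (lt_le_trans lr).
have pD : `[p, q + 1] `<=` D.
  apply: subset_trans lD => t; rewrite /= !in_itv/= => /andP[h1 h2].
  by rewrite (le_trans lp)// (le_trans h2).
have [||y [cy y1 y2 ey]] := hom D z p q oD cz pq pD _ _ i1 j1.
- move: i2; apply: filterS; first exact: (ae_filter_ringOfSetsType mu).
  by move=> t h tp u uk; have := h tp u uk; rewrite mulN1r opprK.
- move: j2; apply: filterS; first exact: (ae_filter_ringOfSetsType mu).
  by move=> t h tp u uk; have := h tp u uk; rewrite mul1r.
exists y, (`|p| + `|q + 1|); split => //.
- move=> t ht; apply: y1; apply: (lt_le_trans ht).
  by rewrite lerNl (le_trans (ler_norm (- p)))// normrN lerDl.
- move=> t ht; apply: y2; apply: le_lt_trans ht.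
  by rewrite (le_trans (ler_norm _))// lerDr.
apply: (le_trans ey); rewrite leeD2r//.
have [lz _] := cz; apply: ge0_subset_integral => //.
- have m v : (v <= k)%N -> measurable_fun `[l, r + n%:R] (z v).
    by move=> vk; have [m _] := lz v vk; apply: measurable_funS m => //; exact: open_measurable.
  apply/measurable_EFinP; apply: measurable_funD; last by apply: measurable_funX; exact: m.
  by apply: measurableT_comp; [exact: continuous_measurable_fun|exact: m].
- by move=> t _; rewrite lee_fin addr_ge0// sqr_ge0.
- move=> t; rewrite /= !in_itv/= => /andP[h1 h2].
  rewrite (le_trans _ (ltW h1)) ?(le_trans lp) ?lerDl//=.
  by rewrite (le_trans (ltW h2))// (le_trans _ qr)// lerDl.
Qed.

Lemma weak_chain_transition_cvg k y T : weak_chain setT k y ->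
  (forall t, t < - T -> y 0%N t = -1 /\ y k t = 0) ->
  (forall t, T < t -> y 0%N t = 1 /\ y k t = 0) ->
  y 0%N t @[t --> +oo] --> (1 : R) /\ y 0%N t @[t --> -oo] --> (-1 : R).
Proof.
move=> _ y1 y2; split; apply: cvg_near_cst; near=> t.
- have [] // := y2 t; near: t; apply: nbhs_pinfty_gt; exact: num_real.
- have [] // := y1 t; near: t; apply: nbhs_ninfty_lt; exact: num_real.
Unshelve. all: by end_near. Qed.

(** The gluing argument is applied to an almost minimiser. Its limits at infinity make the
    exceptional sets empty far out, and its finite energy is spread over as many cells as
    desired. *)
Lemma near_optimal_profile (W : R -> R) k (theta : R) : (0 < k)%N -> continuous W ->
  (forall x, 0 <= W x) -> W (-1) = 0 -> W 1 = 0 -> 0 < theta ->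
  exists y T, [/\ weak_chain setT k y,
     forall t, t < - T -> y 0%N t = -1 /\ y k t = 0,
     forall t, T < t -> y 0%N t = 1 /\ y k t = 0 &
     (energy W k setT y <= m_opt k W + theta%:E)%E].
Proof.
move=> k0 cW W0 Wm1 W1 th0; have th2 : 0 < theta / 2 by rewrite divr_gt0.
have [eta eta0 [tau tau0 main]] := one_jump_lower_bound k0 cW W0 Wm1 W1 th2.
have mfin : m_opt k W \is a fin_num by rewrite ge0_fin_numE ?m_opt_ge0// m_opt_lty.
have [_ [u [hu u1 um1] <-]] := lb_ereal_inf_adherent th2 mfin.
have [z cz z0] := sobolevH_loc_weak_chain openT hu.
have -> : (\int[mu]_t (W (u t) + weak_derivative setT k u t ^+ 2)%:E = energy W k setT z)%E.
  have := @weak_derivative_energy R setT k z 1 1 W openT cz cW W0 ler01 ler01.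
  rewrite z0; under eq_integral do rewrite !mul1r.
  by move=> ->; rewrite /energy z0; under eq_integral do rewrite !mul1r.
move=> lez; have ltM : (energy W k setT z < +oo)%E.
  by apply: lt_trans lez _; rewrite -/(m_opt k W) -(fineK mfin) -EFinD ltry.
have [lz _] := cz.
have mz v A : measurable A -> (v <= k)%N -> measurable_fun A (z v).
  by move=> mA vk; have [m _] := lz v vk; apply: measurable_funS m.
have E0 : (0 <= energy W k setT z)%E.
  by apply: integral_ge0 => t _; rewrite lee_fin addr_ge0// sqr_ge0.
have Efin : energy W k setT z \is a fin_num by rewrite ge0_fin_numE.
pose M := fine (energy W k setT z).
(* Enough cells for n tau to exceed the whole energy. *)
pose n := (Num.truncn (M / tau)).+1.
have Mn : M < n%:R * tau.
  by rewrite -ltr_pdivrMr// /n truncnS_gt.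
have [A [_ hA]] : \forall t \near -oo, `|u t - -1| <= eta.
  by move/cvgrPdist_le : um1 => /(_ _ eta0); apply: filterS => t; rewrite distrC.
have [B [_ hB]] : \forall t \near +oo, `|u t - 1| <= eta.
  by move/cvgrPdist_le : u1 => /(_ _ eta0); apply: filterS => t; rewrite distrC.
(* The [n] cells starting at [l] end before [A] and those starting at [r] begin after [B], where the
   function is already within [eta] of its limits. *)
pose l := - (`|A| + n%:R + 1); pose r := `|B| + 1.
have zM A' : measurable A' -> (\int[mu]_(t in A') (z k t ^+ 2)%:E <= energy W k setT z)%E.
  move=> mA'; apply: (@le_trans _ _ (\int[mu]_t (z k t ^+ 2)%:E)%E).
    apply: ge0_subset_integral => //.
      by apply/measurable_EFinP; apply: measurable_funX; exact: mz.
    by move=> t _; rewrite lee_fin sqr_ge0.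
  apply: ge0_le_integral => //.
  - by move=> t _; rewrite lee_fin sqr_ge0.
  - by apply/measurable_EFinP; apply: measurable_funX; exact: mz.
  - apply/measurable_EFinP; apply: measurable_funD; last by apply: measurable_funX; exact: mz.
    by apply: measurableT_comp; [exact: continuous_measurable_fun|exact: mz].
  - by move=> t _; rewrite lee_fin lerDr.
have ME : energy W k setT z = M%:E by rewrite /M fineK.
have [||||y [T [cy y1 y2 ey]]] := main setT z l r n openT cz.
- rewrite /l /r; have := normr_ge0 A; have := normr_ge0 B; lra.
- by [].
- rewrite (_ : [set t | _ /\ _] = set0); last first.
    apply/seteqP; split => // t [/=]; rewrite in_itv/= z0 => /andP[_ t2].
    by rewrite ltNge hA//; have := ler_norm (- A); rewrite normrN; move: t2; rewrite /l; lra.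
  by rewrite measure0 adde0 (le_lt_trans (zM _ _))// ME lte_fin.
- rewrite (_ : [set t | _ /\ _] = set0); last first.
    apply/seteqP; split => // t [/=]; rewrite in_itv/= z0 => /andP[t1 _].
    by rewrite ltNge hB//; have := ler_norm B; move: t1; rewrite /r; lra.
  by rewrite measure0 adde0 (le_lt_trans (zM _ _))// ME lte_fin.
exists y, T; split => //; apply: (le_trans ey).
apply: (@le_trans _ _ (energy W k setT z + (theta / 2)%:E)%E).
  rewrite leeD2r//; apply: ge0_subset_integral => //.
    apply/measurable_EFinP; apply: measurable_funD; last by apply: measurable_funX; exact: mz.
    by apply: measurableT_comp; [exact: continuous_measurable_fun|exact: mz].
  by move=> t _; rewrite lee_fin addr_ge0// sqr_ge0.
rewrite [in leRHS](splitr theta) EFinD addeA leeD2r//; exact: ltW.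
Qed.

End optimal_profile.

(** * Rescaling *)

Section rescaling.
Context {R : realType}.
Implicit Types (D A : set R) (z : nat -> R -> R) (a b c d h s t x eps : R) (k : nat)
  (W : R -> R) (xs : seq R).
Local Notation mu := (@lebesgue_measure R).

Definition energy_eps W k eps A z : \bar R :=
  (\int[mu]_(t in A) (eps^-1 * W (z 0%N t) + eps ^+ (2 * k - 1) * z k t ^+ 2)%:E)%E.

Definition rescale c d z j t : R := c ^+ j * z j (affine c d t).

Lemma measurable_energy_density W k D A z c1 c2 : open D -> measurable A -> A `<=` D ->
  weak_chain D k z -> continuous W ->
  measurable_fun A (fun t => (c1 * W (z 0%N t) + c2 * z k t ^+ 2)%:E).
Proof.
move=> oD mA AD [lz _] cW.
have mz v : (v <= k)%N -> measurable_fun A (z v).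
  by move=> vk; have [m _] := lz v vk; apply: measurable_funS m => //; exact: open_measurable.
apply/measurable_EFinP; apply: measurable_funD; apply: measurable_funM => //.
  by apply: measurableT_comp; [exact: continuous_measurable_fun|exact: mz].
by apply: measurable_funX; exact: mz.
Qed.

Lemma energy_density_ge0 W k z eps t : (forall x, 0 <= W x) -> 0 < eps ->
  0 <= eps^-1 * W (z 0%N t) + eps ^+ (2 * k - 1) * z k t ^+ 2.
Proof.
move=> W0 e0; apply: addr_ge0; apply: mulr_ge0 => //; first by rewrite invr_ge0 ltW.
  by rewrite exprn_ge0// ltW.
exact: sqr_ge0.
Qed.

Lemma energy_eps_ge0 W k eps A z : (forall x, 0 <= W x) -> 0 < eps ->
  (0 <= energy_eps W k eps A z)%E.
Proof.
move=> W0 e0; by apply: integral_ge0 => t _; rewrite lee_fin energy_density_ge0.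
Qed.

Lemma energy_epsS W k eps D A B z : open D -> weak_chain D k z -> continuous W ->
  (forall x, 0 <= W x) -> 0 < eps -> measurable A -> measurable B -> A `<=` B -> B `<=` D ->
  (energy_eps W k eps A z <= energy_eps W k eps B z)%E.
Proof.
move=> oD cz cW W0 e0 mA mB AB BD; apply: ge0_subset_integral => //.
  exact: measurable_energy_density cz cW.
by move=> t _; rewrite lee_fin energy_density_ge0.
Qed.

Lemma energy_epsU W k eps D A B z : open D -> weak_chain D k z -> continuous W ->
  (forall x, 0 <= W x) -> 0 < eps -> measurable A -> measurable B -> [disjoint A & B] ->
  A `<=` D -> B `<=` D ->
  energy_eps W k eps (A `|` B) z = (energy_eps W k eps A z + energy_eps W k eps B z)%E.
Proof.
move=> oD cz cW W0 e0 mA mB AB AD BD; rewrite /energy_eps ge0_integral_setU//.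
  apply: measurable_energy_density cz cW => //; first exact: measurableU.
  by rewrite subUset; split.
by move=> t _; rewrite lee_fin energy_density_ge0.
Qed.

(** The square of the k-th derivative contributes eps^(2k) and the change of variables 1 / eps. Only
    the square of c is prescribed, so reflections are included. *)
Lemma rescale_energy W k D A z c d eps : open D -> weak_chain D k z -> continuous W ->
  (forall x, 0 <= W x) -> (0 < k)%N -> 0 < eps -> c ^+ 2 = eps ^+ 2 -> measurable A -> A `<=` D ->
  energy W k (affine c d @^-1` A) (rescale c d z) = energy_eps W k eps A z.
Proof.
move=> oD cz cW W0 k0 e0 ce mA AD.
have c0 : c != 0 by rewrite -sqrf_eq0 ce sqrf_eq0 gt_eqF.
have absc : `|c| = eps.
  by have /eqP := ce; rewrite eqf_sqr => /orP[]/eqP ->; rewrite ?normrN gtr0_norm.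
pose f t := (W (z 0%N t) + eps ^+ (2 * k) * z k t ^+ 2)%:E.
have mf : measurable_fun A f.
  have := @measurable_energy_density W k D A z 1 (eps ^+ (2 * k)) oD mA AD cz cW.
  by apply: eq_measurable_fun => t _; rewrite /f mul1r.
have f0 x : A x -> (0 <= f x)%E.
  by move=> _; rewrite lee_fin addr_ge0// mulr_ge0 ?sqr_ge0// exprn_ge0// ltW.
have -> : energy W k (affine c d @^-1` A) (rescale c d z) =
   (\int[mu]_(t in affine c d @^-1` A) f (affine c d t))%E.
  apply: eq_integral => t _; rewrite /rescale expr0 mul1r /f exprMn; congr (_ + _ * _)%:E.
  by rewrite exprAC ce -exprM mulnC.
rewrite ge0_integral_affine// absc -ge0_integralZl//; last by rewrite lee_fin invr_ge0 ltW.
apply: eq_integral => t _; rewrite /f -EFinM mulrDr mulrA; congr (_ + _ * _)%:E.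
(* Subtraction of natural numbers truncates, so the exponent is 2k - 1 only for k > 0. *)
have k2 : (2 * k = (2 * k - 1).+1)%N by case: k k0 {cz f mf f0} => // n _; rewrite mulnS/= subn1.
by rewrite [in LHS]k2 exprS mulrA mulVf ?mul1r// gt_eqF.
Qed.

(* The sign of c selects the orientation of the blow-up at x, so that every jump becomes a
   transition from -1 to 1. *)
Lemma jump_lower_bound W k (theta M : R) : (0 < k)%N -> continuous W ->
  (forall x, 0 <= W x) -> W (-1) = 0 -> W 1 = 0 -> 0 < theta -> 0 <= M ->
  exists2 eta : R, 0 < eta & forall h, 0 < h -> exists2 eps0 : R, 0 < eps0 &
  exists2 rho : R, 0 < rho & forall eps c x D z, 0 < eps -> eps < eps0 -> c ^+ 2 = eps ^+ 2 ->
  open D -> weak_chain D k z -> `[x - h, x + h] `<=` D ->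
  (energy_eps W k eps `[(x - h)%R, (x + h)%R] z <= M%:E)%E ->
  (mu [set t | [/\ `[(x - h)%R, (x + h)%R]%classic t, t != x &
      (eta < `|z 0%N t - Num.sg (c * (t - x))|)%R]] < rho%:E)%E ->
  (m_opt k W <= energy_eps W k eps `[(x - h)%R, (x + h)%R] z + theta%:E)%E.
Proof.
move=> k0 cW W0 Wm1 W1 th0 M0.
have [eta eta0 [tau tau0 main]] := one_jump_lower_bound k0 cW W0 Wm1 W1 th0.
(* With eps below rho / (M + 1) one has M < rho / eps, so M + rho / eps < 2 rho / eps = (h / eps)
   tau / 2. The bound eps < h / 4 gives h / eps <= 2 n for the [n] chosen below, hence a total less
   than n tau. *)
exists eta => // h h0; pose rho := h * tau / 4.
have rho0 : 0 < rho by rewrite /rho !mulr_gt0// invr_gt0.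
pose e1 := rho / (M + 1).
have e10 : 0 < e1 by rewrite divr_gt0// ltr_wpDl.
exists (Num.min (h / 4) e1); first by rewrite lt_min e10 divr_gt0.
exists rho => // eps c x D z e0; rewrite lt_min => /andP[eh ee1] ce oD cz hD hM.
set Bad := [set t | _]; move=> hB.
have c0 : c != 0 by rewrite -sqrf_eq0 ce sqrf_eq0 gt_eqF.
have absc : `|c| = eps.
  by have /eqP := ce; rewrite eqf_sqr => /orP[]/eqP ->; rewrite ?normrN gtr0_norm.
pose D' := affine c x @^-1` D; pose v := rescale c x z.
have oD' : open D' by exact: open_preimage_affine.
have cv : weak_chain D' k v by exact: weak_chain_affine.
have he4 : 4 < h / eps by rewrite ltr_pdivlMr// mulrC -ltr_pdivlMr//.
have [n nh hn] : exists2 n : nat, n.+1%:R <= h / eps & h / eps < n.+2%:R.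
  have h1 : (Num.truncn (h / eps))%:R <= h / eps by rewrite truncn_le// ltW// (lt_trans _ he4).
  have h2 := truncnS_gt (h / eps).
  case: (Num.truncn (h / eps)) h1 h2 => [|n] h1 h2; last by exists n.
  by move: (lt_trans he4 h2); rewrite ltr_nat.
have TB t : - (h / eps) <= t -> t <= h / eps -> `[x - h, x + h]%classic (affine c x t).
  move=> t1 t2; have ht : `|c * t| <= h.
    by rewrite normrM absc mulrC -ler_pdivlMr// ler_norml t1.
  by move: ht; rewrite /affine /= in_itv/= ler_norml => /andP[h1 h2]; apply/andP; split; lra.
(* The cells fill [-(n+1), -1] and [1, n+1]; they avoid the jump, now at 0, and stay in the blown-up
   neighbourhood since n + 1 <= h / eps. *)
pose l := - n.+1%:R : R; pose r := 1 : R.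
have nS : n.+1%:R = n%:R + 1 :> R by rewrite natr1.
have sub : `[l, r + n%:R] `<=` affine c x @^-1` `[x - h, x + h].
  move=> t; rewrite /= in_itv/= => /andP[t1 t2]; apply: TB.
    by apply: le_trans t1; rewrite lerN2.
  by apply: (le_trans t2); rewrite addrC -nS.
have subD : `[l, r + n%:R] `<=` D' by move=> t /sub; exact: hD.
have mB : measurable `[x - h, x + h]%classic by [].
have mA := measurable_preimage_affine c x mB.
have Ev : energy W k (affine c x @^-1` `[x - h, x + h]) v = energy_eps W k eps `[(x - h)%R, (x + h)%R] z.
  exact: rescale_energy cz cW W0 k0 e0 ce mB hD.
have mvD A : measurable A -> A `<=` D' ->
    measurable_fun A (fun t => (W (v 0%N t) + v k t ^+ 2)%:E) /\
    measurable_fun A (fun t => (v k t ^+ 2)%:E).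
  move=> mA' AD; split.
    have := @measurable_energy_density W k D' A v 1 1 oD' mA' AD cv cW.
    by apply: eq_measurable_fun => t _; rewrite !mul1r.
  have [lv _] := cv; have [m _] := lv k (leqnn k).
  apply/measurable_EFinP; apply: measurable_funX; apply: measurable_funS m => //.
  exact: open_measurable.
have Esub A : measurable A -> A `<=` affine c x @^-1` `[x - h, x + h] ->
    (energy W k A v <= energy_eps W k eps `[(x - h)%R, (x + h)%R] z)%E.
  move=> mA' AB; rewrite -Ev; apply: ge0_subset_integral => //.
    by have [] := mvD _ mA (fun t ht => hD _ ht).
  by move=> t _; rewrite lee_fin addr_ge0// sqr_ge0.
have vE A : measurable A -> A `<=` affine c x @^-1` `[x - h, x + h] ->
    (\int[mu]_(t in A) (v k t ^+ 2)%:E <= M%:E)%E.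
  move=> mA' AB; apply: le_trans hM; apply: le_trans (Esub _ mA' AB).
  have [m1 m2] := mvD _ mA' (fun t ht => hD _ (AB t ht)).
  apply: ge0_le_integral => //.
  - by move=> t _; rewrite lee_fin sqr_ge0.
  - by move=> t _; rewrite lee_fin lerDr.
have mz0 : measurable_fun `[x - h, x + h] (z 0%N).
  have [lz _] := cz; have [m _] := lz 0%N (leq0n k).
  by apply: measurable_funS m => //; exact: open_measurable.
have mBad : measurable Bad.
  have -> : Bad = [set t | `[x - h, x + h]%classic t /\ eta < `|z 0%N t - Num.sg (c * (t - x))|]
      `&` ~` [set x].
    apply/seteqP; split => t /=; first by move=> [h1 /eqP h2 h3].
    by move=> [[h1 h3] /eqP h2].
  apply: measurableI; last exact: measurableC.
  apply: measurable_superlevel => //; apply: measurable_funB => //.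
  apply: (@measurable_funS _ _ _ _ setT) => //.
  have -> : (fun t => Num.sg (c * (t - x))) =
     (fun u : R => \1_(`]0, +oo[%classic) u - \1_(`]-oo, 0[%classic) u) \o affine c (- (c * x)).
    apply/funext => t; rewrite /affine /= -mulrN -mulrDr !indicE.
    rewrite !mem_setE !in_itv/= andbT; case: (sgrP (c * (t - x))) => hs.
    - by rewrite subr0.
    - by rewrite subr0.
    - by rewrite sub0r.
  apply: measurableT_comp; last exact: measurable_affine.
  by apply: measurable_funB; exact: measurable_indic.
(* At the image of t the quantity c (t' - x) equals c^2 t = eps^2 t, so the target value there is
   the sign of t, whatever the sign of c. *)
have bad sg A : measurable A -> A `<=` affine c x @^-1` `[x - h, x + h] ->
    (forall t, A t -> Num.sg t = sg /\ t != 0) ->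
    (mu [set t | A t /\ (eta < `|v 0%N t - sg|)%R] <= (eps^-1 * rho)%:E)%E.
  move=> mA' AB Asg; apply: (@le_trans _ _ (mu (affine c x @^-1` Bad))).
    have m0 : measurable_fun A (v 0%N).
      have [lv _] := cv; have [m _] := lv 0%N (leq0n k).
      apply: measurable_funS m => //; first exact: open_measurable.
      by move=> t /AB; exact: hD.
    apply: le_measure; rewrite ?inE; [|exact: measurable_preimage_affine|].
      by apply: measurable_superlevel => //; apply: measurable_funB.
    move=> t [At ht]; have [s1 s2] := Asg t At; split; first exact: AB.
      by rewrite /affine -subr_eq0 addrK mulf_neq0.
    rewrite /affine addrK mulrA -expr2 ce sgrM sgrX gtr0_sg// expr1n mul1r s1.
    by move: ht; rewrite /v /rescale expr0 mul1r.
  rewrite lebesgue_measure_affine// absc EFinM lee_pmul2l ?lte_fin ?invr_gt0//.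
  exact: ltW.
have num : M + eps^-1 * rho < n%:R * tau.
  have Me : M < eps^-1 * rho.
    rewrite mulrC ltr_pdivlMr//; move: ee1; rewrite /e1 ltr_pdivlMr ?ltr_wpDl//.
    by apply: le_lt_trans; rewrite mulrDr mulr1 mulrC lerDl ltW.
  have : eps^-1 * rho = (h / eps) * tau / 4 by rewrite /rho; field; rewrite gt_eqF.
  move=> er; apply: (@lt_le_trans _ _ (2 * (eps^-1 * rho))); first by rewrite mulr2n mulrDl mul1r ltrD2r.
  rewrite er.
  have : (h / eps) / 2 <= n%:R by move: hn; rewrite -natr1 nS; lra.
  move=> hn2; have := ler_wpM2r (ltW tau0) hn2; lra.
have in1 t : `[l, l + n%:R]%classic t -> Num.sg t = -1 /\ t != 0.
  rewrite /= in_itv/= => /andP[_ t2].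
  have t0 : t < 0 by move: t2; rewrite /l nS; lra.
  by rewrite ltr0_sg// lt_eqF.
have in2 t : `[r, r + n%:R]%classic t -> Num.sg t = 1 /\ t != 0.
  rewrite /= in_itv/= => /andP[t1 _].
  have t0 : 0 < t by exact: lt_le_trans t1.
  by rewrite gtr0_sg// gt_eqF.
have lr : l + n%:R < r by rewrite /l /r nS; lra.
have s1 : `[l, l + n%:R] `<=` affine c x @^-1` `[x - h, x + h].
  apply: subset_trans sub => t; rewrite /= !in_itv/= => /andP[-> t2].
  by rewrite (le_trans t2)// (le_trans (ltW lr))// lerDl.
have s2 : `[r, r + n%:R] `<=` affine c x @^-1` `[x - h, x + h].
  apply: subset_trans sub => t; rewrite /= !in_itv/= => /andP[t1 ->].
  by rewrite andbT (le_trans _ t1)// (le_trans _ (ltW lr))// lerDl.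
have [||y [T [cy y1 y2 ey]]] := main D' v l r n oD' cv lr subD.
- apply: (@le_lt_trans _ _ (M + eps^-1 * rho)%:E); last by rewrite lte_fin.
  by rewrite EFinD; apply: leeD; [exact: vE|apply: bad].
- apply: (@le_lt_trans _ _ (M + eps^-1 * rho)%:E); last by rewrite lte_fin.
  by rewrite EFinD; apply: leeD; [exact: vE|apply: bad].
have [yp ym] := weak_chain_transition_cvg cy y1 y2.
apply: (le_trans (m_opt_le cW W0 cy yp ym)); apply: (le_trans ey).
by rewrite leeD2r//; exact: Esub.
Qed.

(** The right-continuous step function with initial value s that changes sign at each entry of [xs].
    In a nondecreasing list two equal entries cancel, so jumps that merge in a limit need no special
    treatment. *)
Fixpoint pwc s xs t : R := if xs is x :: xs' then if t < x then s else pwc (- s) xs' t else s.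

Lemma pwc_path s t xs : path <%R t xs -> pwc s xs t = s.
Proof. by case: xs => [//|x xs] /= /andP[->]. Qed.

Lemma measurable_pwc s xs A : measurable_fun A (pwc s xs).
Proof.
apply: (@measurable_funS _ _ _ _ setT) => //.
elim: xs s => [|x xs ih] s /=; first exact: measurable_cst.
by apply: measurable_fun_ifT => //; exact: measurable_fun_ltr.
Qed.

(** Induction on the jumps: a neighbourhood of the first one is disjoint from an interval to its
    right that contains the others, and the energies add up. The tolerance [eta] is common to all
    jumps, whereas [eps0] and [rho] depend on their positions. *)
Lemma pwc_lower_bound W k (theta M b : R) : (0 < k)%N -> continuous W ->
  (forall x, 0 <= W x) -> W (-1) = 0 -> W 1 = 0 -> 0 < theta -> 0 <= M ->
  exists2 eta : R, 0 < eta & forall xs s a, s = 1 \/ s = -1 -> path <%R a xs ->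
    all (fun x => x < b) xs -> exists2 eps0 : R, 0 < eps0 &
  exists2 rho : R, 0 < rho & forall eps D z, 0 < eps -> eps < eps0 ->
  open D -> weak_chain D k z -> `]a, b[ `<=` D ->
  (energy_eps W k eps `]a, b[ z <= M%:E)%E ->
  (mu [set t | `]a, b[%classic t /\ (eta < `|z 0%N t - pwc s xs t|)%R] < rho%:E)%E ->
  ((size xs)%:R%:E * m_opt k W <= energy_eps W k eps `]a, b[ z + ((size xs)%:R * theta)%:E)%E.
Proof.
move=> k0 cW W0 Wm1 W1 th0 M0.
have [eta eta0 main] := jump_lower_bound k0 cW W0 Wm1 W1 th0 M0.
exists eta => //; elim=> [|x xs ih] s a hs.
  move=> _ _; exists 1 => //; exists 1 => // eps D z e0 _ oD cz _ _ _ /=.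
  by rewrite mul0e mul0r adde0 energy_eps_ge0.
move=> /= /andP[ax xxs] /andP[xb xsb].
have hs' : - s = 1 \/ - s = -1 by case: hs => ->; [right|left; rewrite opprK].
(* At most half the distance to [a] and to the next jump, or to [b] if there is none. *)
have [h h0 [ah hb hxs]] : exists2 h, 0 < h & [/\ a < x - h, x + h < b & path <%R (x + h) xs].
  pose y := head b xs.
  have xy : x < y by rewrite /y; case: (xs) xxs => //= ? ? /andP[].
  have yb : y <= b by rewrite /y; case: (xs) xsb => //= ? ? /andP[/ltW].
  exists (Num.min ((x - a) / 2) ((y - x) / 2)); first by rewrite lt_min !divr_gt0// subr_gt0.
  set h := Num.min _ _.
  have h1 : h <= (x - a) / 2 by rewrite /h ge_min lexx.
  have h2 : h <= (y - x) / 2 by rewrite /h ge_min lexx orbT.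
  have xhy : x + h < y by lra.
  split; [lra|lra|]; move: xhy xxs; rewrite /y; case: (xs) => //= y' ys' -> /andP[_ ->].
  by [].
have [e1 e10 [r1 r10 H1]] := main h h0.
have [e2 e20 [r2 r20 H2]] := ih (- s) (x + h) hs' hxs xsb.
exists (Num.min e1 e2); first by rewrite lt_min e10.
exists (Num.min r1 r2); first by rewrite lt_min r10.
move=> eps D z e0; rewrite lt_min => /andP[ee1 ee2] oD cz abD eM.
set Bad := [set t | _] => hB.
have sub1 : `[x - h, x + h] `<=` `]a, b[.
  by move=> t; rewrite /= !in_itv/= => /andP[t1 t2]; rewrite (lt_le_trans ah)//= (le_lt_trans t2).
have sub2 : `]x + h, b[ `<=` `]a, b[.
  move=> t; rewrite /= !in_itv/= => /andP[t1 ->]; rewrite andbT (lt_trans _ t1)//.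
  by rewrite (lt_trans ax)// ltrDl.
have mz0 A : measurable A -> A `<=` `]a, b[ -> measurable_fun A (z 0%N).
  move=> mA Aab; have [lz _] := cz; have [m _] := lz 0%N (leq0n k).
  by apply: measurable_funS m => //; [exact: open_measurable|exact: subset_trans abD].
have mBad : measurable Bad.
  have m1 : measurable_fun `]a, b[%classic (z 0%N \- pwc s (x :: xs)).
    by apply: measurable_funB; [exact: mz0|exact: measurable_pwc].
  by have := @measurable_superlevel R `]a, b[%classic _ eta (measurable_itv _) m1.
(* The factor - s orients the blow-up: the sign of - s eps (t - x) is s before the jump and - s
   after it. *)
have hc : (- s * eps) ^+ 2 = eps ^+ 2.
  by rewrite exprMn sqrrN; case: hs => ->; rewrite ?sqrrN expr1n mul1r.
have D1 : `[x - h, x + h] `<=` D by exact: subset_trans abD.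
have D2 : `]x + h, b[ `<=` D by exact: subset_trans abD.
have M1 : (energy_eps W k eps `[(x - h)%R, (x + h)%R] z <= M%:E)%E.
  by apply: le_trans eM; exact: energy_epsS cz cW W0 e0 _ _ sub1 abD.
have M2 : (energy_eps W k eps `](x + h)%R, b[ z <= M%:E)%E.
  by apply: le_trans eM; exact: energy_epsS cz cW W0 e0 _ _ sub2 abD.
have B1 : (mu [set t | [/\ `[(x - h)%R, (x + h)%R]%classic t, t != x &
      (eta < `|z 0%N t - Num.sg (- s * eps * (t - x))|)%R]] < r1%:E)%E.
  apply: (@lt_le_trans _ _ (Num.min r1 r2)%:E); last by rewrite lee_fin ge_min lexx.
  apply: le_lt_trans hB.
  rewrite (_ : [set _ | _] = (Bad `&` `[x - h, x + h]) `\` [set x]).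
    apply: le_measure; rewrite ?inE//; last by move=> t [[]].
    by apply: measurableD => //; exact: measurableI.
  have sgE t : `[(x - h)%R, (x + h)%R]%classic t -> t <> x ->
      Num.sg (- s * eps * (t - x)) = pwc s (x :: xs) t.
    rewrite /= in_itv/= => /andP[t1 t2] /eqP tx.
    rewrite -mulrA sgrM sgrN mulrC sgrM gtr0_sg// mul1r.
    have -> : Num.sg s = s by case: hs => ->; rewrite ?sgrN sgr1.
    case: ltP => tx'; first by rewrite ltr0_sg ?subr_lt0// mulrNN mul1r.
    rewrite gtr0_sg ?subr_gt0 ?lt_neqAle 1?eq_sym ?tx// mul1r.
    rewrite pwc_path//; case: (xs) hxs => //= x' xs' /andP[xx' ->]; rewrite andbT.
    exact: le_lt_trans xx'.
  apply/seteqP; split => t.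
    by move=> [t1 /eqP tx t2]; split => //; split => //; split; [exact: sub1|rewrite -[X in _ - X]/(pwc s (x :: xs) t) -sgE].
  by move=> [[[t1 t2] t3] tx]; split => //; [exact/eqP|rewrite sgE].
have B2 : (mu [set t | `](x + h)%R, b[%classic t /\
      (eta < `|z 0%N t - pwc (- s) xs t|)%R] < r2%:E)%E.
  apply: (@lt_le_trans _ _ (Num.min r1 r2)%:E); last by rewrite lee_fin ge_min lexx orbT.
  apply: le_lt_trans hB; apply: le_measure; rewrite ?inE//.
    apply: (@measurable_superlevel R _ (z 0%N \- pwc (- s) xs)) => //.
    by apply: measurable_funB; [exact: mz0|exact: measurable_pwc].
  move=> t [t1 t2]; split; first exact: sub2.
  rewrite /= ifN// -leNgt; move: t1; rewrite /= in_itv/= => /andP[/ltW t1 _].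
  by rewrite (le_trans _ t1)// lerDl ltW.
have G1 := H1 eps (- s * eps) x D z e0 ee1 hc oD cz D1 M1 B1.
have G2 := H2 eps D z e0 ee2 oD cz D2 M2 B2.
apply: (@le_trans _ _ (energy_eps W k eps (`[(x - h)%R, (x + h)%R] `|` `](x + h)%R, b[) z
   + ((size xs).+1%:R * theta)%:E)%E); last first.
  rewrite leeD2r//; apply: energy_epsS cz cW W0 e0 _ _ _ abD => //.
  - exact: measurableU.
  - by rewrite subUset.
rewrite (energy_epsU oD cz cW W0 e0)//; last first.
  apply/disj_setPS => t [] /=; rewrite !in_itv/= => /andP[_ h1] /andP[h2 _].
  by move: (lt_le_trans h2 h1); rewrite ltxx.
rewrite -nat1r EFinD ge0_muleDl ?lee_fin//.
rewrite mul1e mulrDl mul1r EFinD.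
rewrite [in leRHS]addeACA.
by apply: leeD; [exact: G1|exact: G2].
Qed.

End rescaling.

(** * Structure of BV functions with values in {-1, 1} *)

Section piecewise_constant.
Context {R : realType}.
Implicit Types (a b c d s t x p q : R) (u v : R -> R) (xs : seq R).
Local Notation mu := (@lebesgue_measure R).

(** By the Jordan decomposition v is a difference of two nondecreasing functions, and these have
    one-sided limits. *)
Lemma bounded_variation_one_sided_limits a b v x : bounded_variation a b v ->
  (a <= x < b -> exists l : R, v t @[t --> x^'+] --> l) /\
  (a < x <= b -> exists l : R, v t @[t --> x^'-] --> l).
Proof.
move=> bv.
pose f := fine \o pos_tv a v; pose g := fine \o neg_tv a v.
have vE : {in `[a, b], v =1 f \- g} := bounded_variation_pos_neg_tvE bv.
have ndg : {in `[a, b] &, {homo g : s t / s <= t}} := fine_neg_tv_nondecreasing bv.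
have ndf : {in `[a, b] &, {homo f : s t / s <= t}}.
  exact: (fine_neg_tv_nondecreasing (bounded_variationN bv)).
have lim_right (h : R -> R) : {in `[a, b] &, {homo h : s t / s <= t}} -> a <= x < b ->
    cvg (h t @[t --> x^'+]).
  move=> nd /andP[ax xb]; apply: nondecreasing_at_right_is_cvgr.
    near=> y; have yb : y <= b by near: y; exact: nbhs_right_le.
    move=> s t; rewrite !in_itv/= => /andP[s1 s2] /andP[t1 t2]; apply: nd; rewrite in_itv/=.
      by rewrite (le_trans ax (ltW s1)) (le_trans (ltW s2) yb).
    by rewrite (le_trans ax (ltW t1)) (le_trans (ltW t2) yb).
  near=> y; have yb : y <= b by near: y; exact: nbhs_right_le.
  exists (h x) => z [t /= ht <-]; move: ht; rewrite in_itv/= => /andP[t1 t2]; apply: nd; rewrite ?in_itv/=.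
  - by rewrite ax ltW.
  - by rewrite (le_trans ax (ltW t1)) (le_trans (ltW t2) yb).
  - exact: ltW.
have lim_left (h : R -> R) : {in `[a, b] &, {homo h : s t / s <= t}} -> a < x <= b ->
    cvg (h t @[t --> x^'-]).
  move=> nd /andP[ax xb]; apply: nondecreasing_at_left_is_cvgr.
    near=> y; have ya : a <= y by near: y; exact: nbhs_left_ge.
    move=> s t; rewrite !in_itv/= => /andP[s1 s2] /andP[t1 t2]; apply: nd; rewrite in_itv/=.
      by rewrite (le_trans ya (ltW s1)) (le_trans (ltW s2) xb).
    by rewrite (le_trans ya (ltW t1)) (le_trans (ltW t2) xb).
  near=> y; have ya : a <= y by near: y; exact: nbhs_left_ge.
  exists (h x) => z [t /= ht <-]; move: ht; rewrite in_itv/= => /andP[t1 t2]; apply: nd; rewrite ?in_itv/=.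
  - by rewrite (le_trans ya (ltW t1)) (le_trans (ltW t2) xb).
  - by rewrite xb ltW.
  - exact: ltW.
split=> /[dup] xab /andP[ax xb].
  exists (lim (f t @[t --> x^'+]) - lim (g t @[t --> x^'+])).
  have : (f t - g t) @[t --> x^'+] --> lim (f t @[t --> x^'+]) - lim (g t @[t --> x^'+]).
    by apply: cvgB; [exact: lim_right|exact: lim_right].
  apply: cvg_trans; apply: near_eq_cvg; near=> t; rewrite vE// in_itv/=.
  apply/andP; split; last by near: t; exact: nbhs_right_le.
  by apply: (le_trans ax); near: t; apply: nbhs_right_ge.
exists (lim (f t @[t --> x^'-]) - lim (g t @[t --> x^'-])).
have : (f t - g t) @[t --> x^'-] --> lim (f t @[t --> x^'-]) - lim (g t @[t --> x^'-]).
  by apply: cvgB; [exact: lim_left|exact: lim_left].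
apply: cvg_trans; apply: near_eq_cvg; near=> t; rewrite vE// in_itv/=.
apply/andP; split; first by near: t; exact: nbhs_left_ge.
by apply: le_trans xb; near: t; apply: nbhs_left_le.
Unshelve. all: by end_near. Qed.

Definition ae_eq_on p q u v := {ae mu, forall t, t \in `]p, q[ -> u t = v t}.

Lemma ae_eq_onS p q p' q' u v : p <= p' -> q' <= q -> ae_eq_on p q u v -> ae_eq_on p' q' u v.
Proof.
move=> pp qq; apply: filterS; first exact: (ae_filter_ringOfSetsType mu).
move=> t h; rewrite in_itv/= => /andP[t1 t2].
by apply: h; rewrite in_itv/= (le_lt_trans pp)//= (lt_le_trans t2).
Qed.

(** The values 1 and -1 cannot both lie within 1/2 of the same l; which one does is decided by the
    sign of l. *)
Lemma near_limit_sign u v l p q a b : a <= p -> q <= b ->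
  {ae mu, forall t, t \in `]a, b[ -> u t = v t} ->
  {ae mu, forall t, t \in `]a, b[ -> u t = 1 \/ u t = -1} ->
  (forall t, t \in `]p, q[ -> `|v t - l| < 2^-1) ->
  exists2 s, s = 1 \/ s = -1 & ae_eq_on p q u (cst s).
Proof.
move=> ap qb uv upm hv.
exists (if 0 < l then 1 else -1); first by case: ifP; [left|right].
move: uv upm; apply: filterS2; first exact: (ae_filter_ringOfSetsType mu).
move=> t h1 h2 tpq; have := hv t tpq.
have tab : t \in `]a, b[.
  by move: tpq; rewrite !in_itv/= => /andP[h3 h4]; rewrite (le_lt_trans ap)//= (lt_le_trans h4).
rewrite -h1// ltr_norml => /andP[h3 h4].
case: (h2 tab) => ut; rewrite ut /= in h3 h4 *; first by rewrite ifT//; lra.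
by rewrite ifF//; apply/negbTE; rewrite -leNgt; lra.
Qed.

Lemma BV_pm1_one_sided a b u x : BV_pm1 a b u ->
  (a <= x < b -> exists2 y, x < y <= b & exists2 s, s = 1 \/ s = -1 & ae_eq_on x y u (cst s)) /\
  (a < x <= b -> exists2 y, a <= y < x & exists2 s, s = 1 \/ s = -1 & ae_eq_on y x u (cst s)).
Proof.
move=> [_ [v [bv uv]] upm]; have [lr ll] := bounded_variation_one_sided_limits x bv.
have half : 0 < 2^-1 :> R by rewrite invr_gt0.
split=> /[dup] /andP[ax xb].
  move=> /lr[l /cvgrPdist_lt/(_ _ half)[d /= d0 hd]].
  exists (Num.min b (x + d)); first by rewrite lt_min xb ltrDl d0/= ge_min lexx.
  apply: (near_limit_sign (l := l) ax _ uv upm); first by rewrite ge_min lexx.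
  move=> t; rewrite in_itv/= lt_min => /and3P[xt _ td]; rewrite distrC; apply: hd => //=.
  by rewrite ltr_distlC; apply/andP; split; lra.
move=> /ll[l /cvgrPdist_lt/(_ _ half)[d /= d0 hd]].
exists (Num.max a (x - d)); first by rewrite gt_max ax ltrBlDr ltrDl d0/= le_max lexx.
apply: (near_limit_sign (l := l) _ xb uv upm); first by rewrite le_max lexx.
move=> t; rewrite in_itv/= gt_max => /andP[/andP[_ td] xt]; rewrite distrC; apply: hd => //=.
by rewrite ltr_distlC; apply/andP; split; lra.
Qed.

Lemma pwc_rcons s xs x t : all (fun y => y <= x) xs ->
  pwc s (rcons xs x) t = if t < x then pwc s xs t else - pwc s xs t.
Proof.
elim: xs s => [|y xs ih] s /=; first by [].
move=> /andP[yx xsx]; case: ltP => ty; last exact: ih.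
by rewrite (lt_le_trans ty).
Qed.

Lemma pwc_last s xs t t' : all (fun y => y <= t) xs -> all (fun y => y <= t') xs ->
  pwc s xs t = pwc s xs t'.
Proof.
elim: xs s => [//|y xs ih] s /= /andP[y1 h1] /andP[y2 h2].
by rewrite !ltNge y1 y2; exact: ih.
Qed.

Lemma pwc_pm1 s xs t : s = 1 \/ s = -1 -> pwc s xs t = 1 \/ pwc s xs t = -1.
Proof.
elim: xs s => [//|y xs ih] s hs /=; case: ifP => // _; apply: ih.
by case: hs => ->; [right|left; rewrite opprK].
Qed.

Lemma path_rcons_lt a xs t : path <%R a xs -> a < t -> all (fun x => x < t) xs ->
  path <%R a (rcons xs t).
Proof.
move=> pxs at' h; rewrite rcons_path pxs/=; case/lastP: xs h {pxs} => [//|xs y].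
by rewrite all_rcons last_rcons => /andP[].
Qed.

Definition pwc_upto a t u := exists s xs, [/\ s = 1 \/ s = -1, path <%R a xs,
  all (fun x => x < t) xs & ae_eq_on a t u (pwc s xs)].

Lemma pwc_upto_extend a t t' s u : a < t -> t < t' -> s = 1 \/ s = -1 ->
  pwc_upto a t u -> ae_eq_on t t' u (cst s) -> pwc_upto a t' u.
Proof.
move=> at' tt' hs [s0 [xs [hs0 pxs xst uxs]]] us.
have xst2 : all (fun x => x <= t) xs by apply: sub_all xst => x /ltW.
have xst' : all (fun x => x < t') xs by apply: sub_all xst => x /lt_trans; exact.
have tS : {ae mu, forall v : R, v <> t}.
  exists [set t]; split; [exact: measurable_set1|exact: lebesgue_measure_set1|].
  by move=> y /= /contrapT.
have join w : (forall y, y < t -> w y = pwc s0 xs y) -> (forall y, t < y -> w y = s) ->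
    ae_eq_on a t' u w.
  move=> w1 w2; move: uxs us tS.
  apply: filterS3; first exact: (ae_filter_ringOfSetsType mu).
  move=> y h1 h2 yt; rewrite in_itv/= => /andP[ay yt']; case: (ltgtP y t) yt => // yt _.
    by rewrite h1 ?w1// in_itv/= ay.
  by rewrite h2 ?w2// in_itv/= yt.
(* A jump is recorded at [t] only if the value changes there, so that the list contains true
   jumps. *)
have [e|ne] := eqVneq (pwc s0 xs t) s.
  exists s0, xs; split => //; apply: join => // y ty; rewrite -e; apply: pwc_last => //.
  by apply: sub_all xst2 => x /le_trans; apply; exact: ltW.
exists s0, (rcons xs t); split => //; first exact: path_rcons_lt.
  by rewrite all_rcons tt'.
apply: join => y ty; rewrite pwc_rcons// ?ty//.
rewrite ltNge (ltW ty)/= (@pwc_last _ _ _ t)//; last first.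
  by apply: sub_all xst2 => x /le_trans; apply; exact: ltW.
by case: (pwc_pm1 xs t hs0) ne => ->; case: hs => ->; rewrite ?eqxx// opprK.
Qed.

(** A supremum argument replaces counting jumps by variation. One-sided limits make u constant just
    left of each point, so the supremum of the points up to which u is piecewise constant is
    attained; they make u constant just right of it, so the supremum cannot lie below b. *)
Lemma BV_pm1_pwc a b u : a < b -> BV_pm1 a b u -> pwc_upto a b u.
Proof.
move=> ab bv; pose S := [set t | a < t <= b /\ pwc_upto a t u].
have Sb : ubound S b by move=> t [/andP[]].
have [y0 /andP[ay0 y0b] [s0 hs0 us0]] : exists2 y, a < y <= b &
    exists2 s, s = 1 \/ s = -1 & ae_eq_on a y u (cst s).
  by have [h _] := BV_pm1_one_sided a bv; apply: h; rewrite lexx.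
have S0 : S y0 by split; [rewrite ay0|exists s0, [::]; split].
have hS : has_sup S by split; [exists y0|exists b].
set x := sup S.
have ax : a < x by apply: (lt_le_trans ay0); exact: sup_upper_bound.
have xb : x <= b by apply: ge_sup => //; exists y0.
have Px : pwc_upto a x u.
  have [_ h] := BV_pm1_one_sided x bv.
  have [|y /andP[ay yx] [s hs us]] := h; first by rewrite ax.
  have yx0 : 0 < x - y by rewrite subr_gt0.
  have [t St yt] := sup_adherent yx0 hS; have [/andP[at' tb] Pt] := St.
  have : t <= x by exact: sup_upper_bound.
  rewrite le_eqVlt => /predU1P[<-//|tx]; apply: (pwc_upto_extend at' tx hs Pt).
  by apply: ae_eq_onS us => //; rewrite ltW// (le_lt_trans _ yt)// -/x opprB addrC subrK.
have [xb'|] := ltP x b; last by move=> bx; rewrite (@le_anti _ _ b x)// ?bx.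
have [h _] := BV_pm1_one_sided x bv.
have [|y /andP[xy yb] [s hs us]] := h; first by rewrite (ltW ax).
have : S y by split; [rewrite (lt_trans ax)|exact: pwc_upto_extend us].
by move=> /(sup_upper_bound hS); rewrite leNgt xy.
Qed.

Lemma pwc_local a s xs x : s = 1 \/ s = -1 -> path <%R a xs -> a < x ->
  exists2 d, 0 < d & exists2 c, c = 1 \/ c = -1 &
    (forall t, x - d < t < x -> pwc s xs t = c) /\
    (forall t, x < t < x + d -> pwc s xs t = if x \in xs then - c else c).
Proof.
elim: xs s a => [|y xs ih] s a hs.
  by move=> _ _; exists 1 => //; exists s.
move=> /= /andP[ay yxs] ax.
have hs' : - s = 1 \/ - s = -1 by case: hs => ->; [right|left; rewrite opprK].
case: (ltgtP x y) => [xy|yx|->].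
- exists (y - x); first by rewrite subr_gt0.
  exists s => //; split => t /andP[t1 t2].
    by rewrite (lt_trans t2 xy).
  have -> : t < y by move: t2; rewrite addrC subrK.
  rewrite inE lt_eqF//=; case: ifP => // xxs.
  have : y < x by move: yxs; rewrite (path_sortedE lt_trans) => /andP[/allP/(_ _ xxs)].
  by rewrite ltNge (ltW xy).
- have [d d0 [c hc [h1 h2]]] := ih (- s) y hs' yxs yx.
  exists (Num.min d (x - y)); first by rewrite lt_min d0 subr_gt0.
  exists c => //; have m1 : Num.min d (x - y) <= d by rewrite ge_min lexx.
  have m2 : Num.min d (x - y) <= x - y by rewrite ge_min lexx orbT.
  split => t /andP[t1 t2].
    rewrite ltNge (_ : y <= t)/=; last by lra.
    by apply: h1; rewrite t2 andbT; lra.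
  rewrite ltNge (_ : y <= t)/=; last by lra.
  rewrite h2; last by rewrite t1; lra.
  by rewrite inE gt_eqF.
- pose z := head (y + 1) xs; have yz : y < z.
    by rewrite /z; case: (xs) yxs => /= [|? ? /andP[]//]; rewrite ltrDl.
  exists (z - y); first by rewrite subr_gt0.
  exists s => //; split => t /andP[t1 t2]; first by rewrite t2.
  rewrite ltNge (ltW t1)/= inE eqxx/= pwc_path//.
  have : t < z by move: t2; rewrite addrC subrK.
  by rewrite /z; case: (xs) yxs => //= ? ? /andP[_ ->] ->.
Qed.

Lemma ae_near_cst u p q l c e : p < q -> ae_eq_on p q u (cst c) ->
  {ae mu, forall t, t \in `]p, q[ -> `|u t - l| < e} -> `|c - l| < e.
Proof.
move=> pq h1 h2.
have : {ae mu, forall t, t \in `]p, q[ -> `|c - l| < e}.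
  move: h1 h2; apply: filterS2; first exact: (ae_filter_ringOfSetsType mu).
  by move=> t e1 e2 tpq; rewrite -[c](e1 tpq); exact: e2.
by move=> /(ae_exists pq)[t tpq ht]; exact: ht.
Qed.

(** Around an interior point the step function takes one constant value on each side. Essential
    one-sided limits are unique and must be these constants, which differ exactly at the entries of
    [xs]. *)
Lemma jump_set_pwc a b s xs u : s = 1 \/ s = -1 -> path <%R a xs ->
  all (fun x => x < b) xs -> ae_eq_on a b u (pwc s xs) -> jump_set a b u = [set` xs].
Proof.
move=> hs pxs xsb us.
have loc x : a < x -> x < b -> exists2 c, c = 1 \/ c = -1 &
    (forall l, ess_left_limit u x l <-> l = c) /\
    (forall l, ess_right_limit u x l <-> l = if x \in xs then - c else c).
  move=> ax xb; have [d0 d00 [c hc [h1 h2]]] := pwc_local hs pxs ax; exists c => //.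
  pose d := Num.min d0 (Num.min (x - a) (b - x)).
  have dpos : 0 < d by rewrite !lt_min d00 !subr_gt0 ax.
  have [dd0 [da db]] : d <= d0 /\ d <= x - a /\ d <= b - x.
    by rewrite /d !ge_min !lexx !orbT.
  have ul : ae_eq_on (x - d) x u (cst c).
    move: us; apply: filterS; first exact: (ae_filter_ringOfSetsType mu).
    move=> t h; rewrite in_itv/= => /andP[t1 t2]; rewrite h ?h1//.
      by rewrite t2 andbT (le_lt_trans _ t1)// lerD2l lerN2.
    by rewrite in_itv/=; apply/andP; split; lra.
  have ur : ae_eq_on x (x + d) u (cst (if x \in xs then - c else c)).
    move: us; apply: filterS; first exact: (ae_filter_ringOfSetsType mu).
    move=> t h; rewrite in_itv/= => /andP[t1 t2]; rewrite h ?h2//.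
      by rewrite t1 (lt_le_trans t2)// lerD2l.
    by rewrite in_itv/=; apply/andP; split; lra.
  split=> l; split=> [hl|->].
  - apply/eqP; rewrite eq_sym -subr_eq0 -normr_le0 leNgt; apply/negP => e0.
    have [d' d'0 hd'] := hl _ e0; pose d1 := Num.min d d'.
    have d10 : 0 < d1 by rewrite lt_min dpos.
    suff : `|c - l| < `|c - l| by rewrite ltxx.
    apply: (@ae_near_cst u (x - d1) x l c); first by rewrite ltrBlDr ltrDl.
      by apply: ae_eq_onS ul => //; rewrite lerD2l lerN2 /d1 ge_min lexx.
    move: hd'; apply: filterS; first exact: (ae_filter_ringOfSetsType mu).
    move=> t h; rewrite in_itv/= => /andP[t1 t2]; apply: h; rewrite in_itv/= t2 andbT.
    by rewrite (le_lt_trans _ t1)// lerD2l lerN2 /d1 ge_min lexx orbT.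
  - move=> e e0; exists d => //; move: ul.
    apply: filterS; first exact: (ae_filter_ringOfSetsType mu).
    by move=> t h /h ->; rewrite /= subrr normr0.
  - apply/eqP; rewrite eq_sym -subr_eq0 -normr_le0 leNgt; apply/negP => e0.
    have [d' d'0 hd'] := hl _ e0; pose d1 := Num.min d d'.
    have d10 : 0 < d1 by rewrite lt_min dpos.
    set c' := (if _ then _ else _) in ur e0 hd' *.
    suff : `|c' - l| < `|c' - l| by rewrite ltxx.
    apply: (@ae_near_cst u x (x + d1) l c'); first by rewrite ltrDl.
      by apply: ae_eq_onS ur => //; rewrite lerD2l /d1 ge_min lexx.
    move: hd'; apply: filterS; first exact: (ae_filter_ringOfSetsType mu).
    move=> t h; rewrite in_itv/= => /andP[t1 t2]; apply: h; rewrite in_itv/= t1/=.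
    by rewrite (lt_le_trans t2)// lerD2l /d1 ge_min lexx orbT.
  - move=> e e0; exists d => //; move: ur.
    apply: filterS; first exact: (ae_filter_ringOfSetsType mu).
    by move=> t h /h ->; rewrite /= subrr normr0.
apply/seteqP; split=> x /=.
  move=> [/[!in_itv]/= /andP[ax xb] [l [r [hl hr lr]]]].
  have [c hc [h1 h2]] := loc x ax xb; apply: contraT => xxs; move: lr.
  by rewrite (proj1 (h1 l) hl) (proj1 (h2 r) hr) (negbTE xxs) eqxx.
move=> xxs; have ax : a < x.
  by move: pxs; rewrite (path_sortedE lt_trans) => /andP[/allP/(_ _ xxs)].
have xb : x < b by exact: (allP xsb).
split; first by rewrite in_itv/= ax.
have [c hc [h1 h2]] := loc x ax xb.
exists c, (- c); split; [exact/h1|by apply/h2; rewrite xxs|].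
by rewrite -subr_eq0 opprK; case: hc => ->; rewrite -?opprD ?oppr_eq0 gt_eqF// addr_gt0.
Qed.

Lemma counting_seq (T : choiceType) (s : seq T) : uniq s ->
  counting [set` s] = (size s)%:R%:E :> \bar R.
Proof.
move=> us; rewrite /counting asboolT; last exact: finite_seq.
congr (_%:R%:E); apply: perm_size; apply: uniq_perm; [exact: finmap.fset_uniq|exact: us|].
move=> x; rewrite (in_fset_set (finite_seq s)).
by apply/idP/idP; rewrite inE.
Qed.

Lemma counting_jump_set_pwc a b s xs u : s = 1 \/ s = -1 -> path <%R a xs ->
  all (fun x => x < b) xs -> ae_eq_on a b u (pwc s xs) ->
  counting (jump_set a b u) = (size xs)%:R%:E :> \bar R.
Proof.
move=> hs pxs xsb us; rewrite (jump_set_pwc hs pxs xsb us) counting_seq//.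
by apply: (sorted_uniq (leT := <%R) lt_trans ltxx); exact: path_sorted pxs.
Qed.

End piecewise_constant.

(** * Lower and upper bounds *)

Section limits_inferior.
Local Open Scope ereal_scope.
Context {R : realType} {T : choiceType} {I : filteredType T} (G : set_system I) {FG : ProperFilter G}.
Implicit Types (f : I -> \bar R) (x : \bar R).

(** Finite thresholds suffice for every extended real x, so an infinite lower limit is proved in the
    same way as a finite one. *)
Lemma limf_einf_ge f x : (forall c : R, c%:E < x -> \forall i \near G, c%:E <= f i) ->
  x <= limf_einf f G.
Proof.
move=> h; rewrite leNgt; apply/negP => lt.
have [c h1 h2] : exists2 c : R, limf_einf f G < c%:E & c%:E < x.
  move: lt; case: (limf_einf f G) => [p| |]; case: x {h} => [q| |]// lt.
  - by exists ((p + q) / 2)%R; rewrite lte_fin; move: lt; rewrite lte_fin; lra.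
  - by exists (p + 1)%R; rewrite ?ltry// lte_fin ltrDl.
  - by exists (q - 1)%R; rewrite ?ltNyr// lte_fin ltrBlDr ltrDl.
  - by exists 0%R; rewrite ?ltry ?ltNyr.
have hG : G [set i | c%:E <= f i] := h c h2.
move: h1; rewrite ltNge limf_einfE => /negP; apply.
apply: (@le_trans _ _ (ereal_inf (f @` [set i | c%:E <= f i]))).
  by apply: le_ereal_inf_tmp => _ [i /= ci <-].
by apply: ereal_sup_ubound; exists [set i | c%:E <= f i].
Qed.

Lemma limf_esup_le f x : (forall c : R, x < c%:E -> \forall i \near G, f i <= c%:E) ->
  limf_esup f G <= x.
Proof.
move=> h; have := @limf_einf_ge (\- f) (- x); rewrite limf_einfN leeN2; apply.
move=> c; rewrite lteNr -EFinN => /h; apply: filterS => i.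
by rewrite /= leeNr EFinN.
Qed.

Lemma limf_einf_le_esup f : limf_einf f G <= limf_esup f G.
Proof.
rewrite limf_einfE limf_esupE; apply: ge_ereal_sup => _ [V GV <-].
apply: le_ereal_inf_tmp => _ [U GU <-].
have [i [Vi Ui]] := filter_ex (filterI GV GU).
by apply: (@le_trans _ _ (f i)); [apply: ereal_inf_lbound; exists i|apply: ereal_sup_ubound; exists i].
Qed.

End limits_inferior.

Section lower_bound.
Context {R : realType}.
Implicit Types (a b c eps : R) (u v : R -> R) (k : nat) (W : R -> R).
Local Notation mu := (@lebesgue_measure R).

Lemma F_eps_energy W k a b eps v z : continuous W -> (forall x, 0 <= W x) -> 0 < eps ->
  sobolevH `]a, b[ k v -> weak_chain `]a, b[ k z -> z 0%N = v ->
  F_eps k W a b eps v = energy_eps W k eps `]a, b[ z.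
Proof.
move=> cW W0 e0 hv cz zv; rewrite /F_eps asboolT// -zv.
have oab : open (`]a, b[%classic : set R) by exact: itv_open.
rewrite (weak_derivative_energy oab cz cW W0)// ?invr_ge0 ?ltW//.
by rewrite exprn_gt0.
Qed.

(** A quantitative form with thresholds, free of sequences, so that it applies along any filter on
    which eps tends to 0 from above. *)
Lemma F_eps_lower_bound W k a b u c : (0 < k)%N -> continuous W -> (forall x, 0 <= W x) ->
  W (-1) = 0 -> W 1 = 0 -> a < b -> BV_pm1 a b u ->
  (c%:E < m_opt k W * counting (jump_set a b u))%E ->
  exists2 eps0 : R, 0 < eps0 & exists2 eta : R, 0 < eta & exists2 rho : R, 0 < rho &
  forall eps v, 0 < eps -> eps < eps0 -> measurable_fun `]a, b[ v ->
    (mu [set t | (t \in `]a, b[) /\ (eta < `|v t - u t|)%R] < rho%:E)%E ->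
    (c%:E <= F_eps k W a b eps v)%E.
Proof.
move=> k0 cW W0 Wm1 W1 ab bv; have [mu_ _ _] := bv.
have [s [xs [hs pxs xsb us]]] := BV_pm1_pwc ab bv.
rewrite (counting_jump_set_pwc hs pxs xsb us).
have mfin : m_opt k W \is a fin_num by rewrite ge0_fin_numE ?m_opt_ge0// m_opt_lty.
have m0 : 0 <= fine (m_opt k W) by apply: fine_ge0; exact: m_opt_ge0.
rewrite -(fineK mfin) -EFinM lte_fin; set m := fine _; set N := (size xs)%:R => cmN.
have N0 : 0 <= N by [].
(* Chosen so that the total error N theta stays within the margin m N - c. *)
pose theta := (m * N - c) / (N + 1).
have th0 : 0 < theta by rewrite divr_gt0 ?subr_gt0// ltr_wpDl.
have M0 : 0 <= m * N by rewrite mulr_ge0.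
have [eta eta0 H] := pwc_lower_bound b k0 cW W0 Wm1 W1 th0 M0.
have [e0 e00 [rho rho0 {}H]] := H xs s a hs pxs xsb.
exists e0 => //; exists eta => //; exists rho => // eps v eps0 epse mv hv.
have [hH|hH] := pselect (sobolevH `]a, b[ k v); last by rewrite /F_eps asboolF// leey.
have oab : open `]a, b[%classic by exact: itv_open.
have [z cz zv] := sobolevH_weak_chain oab hH.
rewrite (F_eps_energy cW W0 eps0 hH cz zv).
(* The energy bound required below is m N itself: a larger energy already exceeds c. *)
have [EM|EM] := leP (energy_eps W k eps `]a, b[ z) (m * N)%:E; last first.
  by rewrite (le_trans _ (ltW EM))// lee_fin ltW.
have := H eps _ z eps0 epse oab cz (@subset_refl _ _) EM.
rewrite -(fineK mfin) -/m -/N -EFinM => {}H.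
suff /H : (mu [set t | `]a, b[%classic t /\ (eta < `|z 0%N t - pwc s xs t|)%R] < rho%:E)%E.
  have Efin : energy_eps W k eps `]a, b[ z \is a fin_num.
    by rewrite ge0_fin_numE ?energy_eps_ge0// (le_lt_trans EM)// ltry.
  rewrite -(fineK Efin) -EFinD !lee_fin => h.
  have : N * theta <= m * N - c.
    rewrite /theta mulrA ler_pdivrMr ?ltr_wpDl// mulrC ler_wpM2l// ?subr_ge0 ?ltW//.
    by rewrite ltrDl.
  by rewrite mulrC in h => h'; lra.
apply: le_lt_trans hv; rewrite zv.
have [A [mA A0 hA]] := us.
have mB (w : R -> R) : measurable_fun `]a, b[ w -> measurable [set t | `]a, b[%classic t /\ eta < `|v t - w t|].
  move=> mw; apply: (@measurable_superlevel _ `]a, b[%classic (v \- w)) => //.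
  exact: measurable_funB.
apply: (@le_trans _ _ (mu ([set t | (t \in `]a, b[) /\ (eta < `|v t - u t|)%R] `|` A))).
  apply: le_measure; rewrite ?inE.
  - by apply: mB; exact: measurable_pwc.
  - by apply: measurableU => //; exact: mB.
  - move=> t [tab ht]; have [At|At] := pselect (A t); [by right|left; split => //].
    by rewrite (_ : u t = pwc s xs t)//; apply: contrapT => h; apply: At; apply: hA => /= /(_ tab).
by rewrite (@measureU0 _ _ _ mu)//; exact: mB.
Qed.

Lemma F_eps_liminf (T : choiceType) (I : filteredType T) (G : set_system I) {FG : ProperFilter G} (e : I -> R) (u_ : I -> R -> R)
    W k a b u : (0 < k)%N -> continuous W -> (forall x, 0 <= W x) ->
  W (-1) = 0 -> W 1 = 0 -> a < b -> BV_pm1 a b u ->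
  (forall d, 0 < d -> \forall i \near G, 0 < e i < d) ->
  (\forall i \near G, measurable_fun `]a, b[ (u_ i)) ->
  cvg_in_measure G a b u_ u ->
  (m_opt k W * counting (jump_set a b u) <= limf_einf (fun i => F_eps k W a b (e i) (u_ i)) G)%E.
Proof.
move=> k0 cW W0 Wm1 W1 ab bv e0 mu_ hu; apply: limf_einf_ge => c hc.
have [eps0 eps00 [eta eta0 [rho rho0 H]]] := F_eps_lower_bound k0 cW W0 Wm1 W1 ab bv hc.
have rho0' : (0 < rho%:E)%E by rewrite lte_fin.
have h1 := hu eta eta0 _ (open_ereal_lt' rho0').
near=> i; have /andP[i1 i2] : 0 < e i < eps0 by near: i; exact: e0.
by apply: H => //; near: i.
Unshelve. all: by end_near. Qed.

End lower_bound.

(** * Recovery sequences *)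

Section recovery.
Context {R : realType}.
Implicit Types (a b c d s t x eps : R) (u v : R -> R) (k : nat) (W : R -> R) (xs : seq R)
  (y z : nat -> R -> R).
Local Notation mu := (@lebesgue_measure R).

(** The blow-up read backwards, with c = 1 / eps or -1 / eps: a profile keeps its energy when it is
    concentrated at scale eps. *)
Lemma rescale_inv_energy W k y c d eps : continuous W -> (forall x, 0 <= W x) -> (0 < k)%N ->
  0 < eps -> c ^+ 2 = eps ^- 2 -> weak_chain setT k y ->
  energy_eps W k eps setT (rescale c d y) = energy W k setT y.
Proof.
move=> cW W0 k0 e0 ce cy.
have c0 : c != 0 by rewrite -sqrf_eq0 ce invr_eq0 sqrf_eq0 gt_eqF.
have absc : `|c| = eps^-1.
  have /eqP := ce; rewrite -exprVn eqf_sqr => /orP[]/eqP ->; rewrite ?normrN gtr0_norm//;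
    by rewrite invr_gt0.
pose f t := (eps^-1 * (W (y 0%N t) + y k t ^+ 2))%:E.
have mf : measurable_fun setT f.
  have := @measurable_energy_density R W k setT setT y eps^-1 eps^-1 openT measurableT (@subset_refl _ _) cy cW.
  by apply: eq_measurable_fun => t _; rewrite /f mulrDr.
have f0 x : setT x -> (0 <= f x)%E.
  by move=> _; rewrite lee_fin mulr_ge0// ?addr_ge0 ?sqr_ge0// invr_ge0 ltW.
have k2 : (2 * k = (2 * k - 1).+1)%N by case: k k0 {cy f mf f0} => // n _; rewrite mulnS/= subn1.
have -> : energy_eps W k eps setT (rescale c d y) =
   (\int[mu]_(t in affine c d @^-1` setT) f (affine c d t))%E.
  rewrite preimage_setT; apply: eq_integral => t _; rewrite /rescale expr0 mul1r /f mulrDr exprMn.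
  rewrite mulrA; congr (_ + _ * _)%:E.
  rewrite exprAC ce -exprVn -exprM [in X in _ * X]k2 exprSr mulrA -exprMn divff ?gt_eqF//.
  by rewrite expr1n mul1r.
rewrite ge0_integral_affine// absc invrK -ge0_integralZl//; last by rewrite lee_fin ltW.
apply: eq_integral => t _; rewrite /f -EFinM mulrA mulfV ?gt_eqF//.
by rewrite mul1r.
Qed.

Lemma weak_chain_segment_integrable k z p q : weak_chain setT k z ->
  mu.-integrable `[p, q] (EFin \o z 0%N).
Proof.
move=> [lz _]; apply: (@locally_integrable_segment _ setT) => //.
by apply: lsi_locally_integrable; [exact: openT|exact: lz].
Qed.

Lemma measurable_sgB x (A : set R) : measurable_fun A (fun t => Num.sg (x - t)).
Proof.
apply: (@measurable_funS _ _ _ _ setT) => //.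
have -> : (fun t => Num.sg (x - t)) =
    (fun t => \1_(`]-oo, x[%classic) t - \1_(`]x, +oo[%classic) t).
  apply/funext => t; rewrite !indicE !mem_setE !in_itv/= andbT.
  case: (ltgtP t x) => tx; first by rewrite gtr0_sg ?subr_gt0// subr0.
    by rewrite ltr0_sg ?subr_lt0// sub0r.
  by rewrite tx subrr sgr0 subr0.
by apply: measurable_funB; exact: measurable_indic.
Qed.

Lemma measurable_sg (A : set R) : measurable_fun A (Num.sg : R -> R).
Proof.
rewrite (_ : Num.sg = fun t : R => - Num.sg (0 - t)).
  by apply: measurable_funN; exact: measurable_sgB.
by apply/funext => t; rewrite sub0r sgrN opprK.
Qed.

(** Outside a bounded interval the profile equals the sign function. After rescaling by eps, this
    finite integral becomes an L^1 error of order eps for each jump. *)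
Lemma transition_L1 k y (T : R) : weak_chain setT k y ->
  (forall t, t < - T -> y 0%N t = -1) -> (forall t, T < t -> y 0%N t = 1) ->
  (\int[mu]_t (`|y 0%N t - Num.sg t|)%:E < +oo)%E.
Proof.
move=> cy y1 y2.
pose f t := (`|y 0%N t - Num.sg t|)%:E.
pose A := `[- `|T|, `|T|]%classic.
have -> : (\int[mu]_t (`|y 0%N t - Num.sg t|)%:E = \int[mu]_(t in A) f t)%E.
  rewrite [RHS]integral_mkcond; apply: eq_integral => t _; rewrite patchE.
  case: ifPn => // /negP hA; rewrite /f.
  have : t < - `|T| \/ `|T| < t.
    have [|t1] := ltP t (- `|T|); first by left.
    have [t2|] := leP t `|T|; last by right.
    by exfalso; apply: hA; rewrite mem_setE in_itv/= t1.
  case=> ht.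
    have T0 : t < 0 by rewrite (lt_le_trans ht)// oppr_le0.
    by rewrite y1 ?ltr0_sg// ?subrr ?normr0// (lt_le_trans ht)// lerNr opprK ler_norm.
  have T0 : 0 < t by rewrite (le_lt_trans _ ht).
  by rewrite y2 ?gtr0_sg// ?subrr ?normr0// (le_lt_trans _ ht)// ler_norm.
have iy := weak_chain_segment_integrable (- `|T|) (`|T|) cy.
have isg : mu.-integrable A (EFin \o (Num.sg : R -> R)).
  apply: (@le_integrable _ _ _ mu A _ _ (EFin \o cst 1)) => //.
  - exact: measurable_itv.
  - by apply/measurable_EFinP; exact: measurable_sg.
  - move=> t _ /=; rewrite lee_fin normr1 normr_sg; by case: (t != 0).
  - by apply: continuous_compact_integrable; [exact: segment_compact|move=> ?; exact: cvg_cst].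
have /integrableP[_] : mu.-integrable A (EFin \o (y 0%N \- Num.sg)).
  by have := @integrableB _ _ _ mu A (measurable_itv _) _ _ iy isg; apply.
by move=> h; exact: h.
Qed.

(** Induction on the jumps, with an equality of the chain with the constant s to the left of all
    transitions. That equality is what allows a further transition to be added on the left without
    disturbing the others. *)
Lemma recovery_chain W k (theta : R) : (0 < k)%N -> continuous W ->
  (forall x, 0 <= W x) -> W (-1) = 0 -> W 1 = 0 -> 0 < theta ->
  exists2 C : R, 0 <= C & exists2 T : R, 0 <= T & forall b xs s a, s = 1 \/ s = -1 ->
    a < b -> path <%R a xs -> all (fun x => x < b) xs ->
  exists2 eps0 : R, 0 < eps0 & forall eps, 0 < eps -> eps < eps0 -> exists z,
   [/\ weak_chain setT k z,
     forall t, all (fun x => t < x - T * eps) xs -> z 0%N t = s /\ z k t = 0,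
     (energy_eps W k eps `]a, b[ z <= (size xs)%:R%:E * (m_opt k W + theta%:E))%E &
     (\int[mu]_(t in `]a, b[) (`|z 0%N t - pwc s xs t|)%:E <= ((size xs)%:R * (C * eps))%:E)%E].
Proof.
move=> k0 cW W0 Wm1 W1 th0.
have [y [T0 [cy y1 y2 ey]]] := near_optimal_profile k0 cW W0 Wm1 W1 th0.
have L1 := transition_L1 cy (fun t ht => (y1 t ht).1) (fun t ht => (y2 t ht).1).
pose T := Num.max T0 0; have T0' : 0 <= T by rewrite le_max lexx orbT.
have yl t : t < - T -> y 0%N t = -1 /\ y k t = 0.
  by move=> ht; apply: y1; rewrite (lt_le_trans ht)// lerN2 le_max lexx.
have yr t : T < t -> y 0%N t = 1 /\ y k t = 0.
  by move=> ht; apply: y2; rewrite (le_lt_trans _ ht)// le_max lexx.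
pose C := fine (\int[mu]_t (`|y 0%N t - Num.sg t|)%:E)%E.
have C0 : 0 <= C by apply: fine_ge0; exact: integral_ge0.
have CE : (\int[mu]_t (`|y 0%N t - Num.sg t|)%:E = C%:E)%E.
  by rewrite fineK// ge0_fin_numE//; exact: integral_ge0.
exists C => //; exists T => // b; elim=> [|x xs ih] s a hs ab.
  move=> _ _; exists 1 => // eps e0 _; exists (fun j => cst (if j is 0%N then s else 0)).
  have [k' kE] : exists k', k = k'.+1 by case: k k0 {cy y1 y2 ey yl yr} => // n _; exists n.
  split; first by apply: weak_chain_cst; exact: openT.
  - by move=> t _; rewrite kE.
  - rewrite mul0e /energy_eps (_ : (fun _ => _) = cst 0%E) ?integral0//.
    apply/funext => t; rewrite kE /= expr0n mulr0 addr0.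
    by case: hs => ->; rewrite ?Wm1 ?W1 mulr0.
  - rewrite mul0r (_ : (fun _ => _) = cst 0%E) ?integral0//.
    by apply/funext => t; rewrite /= subrr normr0.
move=> /= /andP[ax xxs] /andP[xb xsb].
have hs' : - s = 1 \/ - s = -1 by case: hs => ->; [right|left; rewrite opprK].
have ss : s * s = 1 by case: hs => ->; rewrite ?mulr1// mulrNN mulr1.
(* A third of the distance to the next jump or to [b]. As T eps < h, the transition at [x] is over
   before x + h and the later ones begin after it. *)
have [h h0 [hb hxs]] : exists2 h, 0 < h & x + h < b /\ path <%R (x + (h + h)) xs.
  pose w := head b xs.
  have xw : x < w by rewrite /w; case: (xs) xxs => //= ? ? /andP[].
  have wb : w <= b by rewrite /w; case: (xs) xsb => //= ? ? /andP[/ltW].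
  exists ((w - x) / 3); first by rewrite divr_gt0// subr_gt0.
  set h := _ / 3; have hE : w = x + 3 * h by rewrite /h; field.
  have hh0 : 0 < h by rewrite divr_gt0// subr_gt0.
  have xhw : x + (h + h) < w by lra.
  split; first lra.
  by move: xhw xxs; rewrite /w; case: (xs) => //= y' ys' -> /andP[_ ->].
have hxs1 : path <%R (x + h) xs.
  by case: (xs) hxs => //= y' ys' /andP[h1 ->]; rewrite andbT (lt_trans _ h1)// ltrD2l ltrDl.
have [e0 e00 {}ih] := ih (- s) (x + h) hs' hb hxs1 xsb.
have T1 : 0 < T + 1 by rewrite ltr_wpDl.
exists (Num.min e0 (h / (T + 1))); first by rewrite lt_min e00 divr_gt0.
move=> eps eps0; rewrite lt_min => /andP[ee0 eh].
have [z [cz zl Ez Lz]] := ih eps eps0 ee0.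
have Te : T * eps < h.
  move: eh; rewrite ltr_pdivlMr// => eh; apply: le_lt_trans eh.
  by rewrite mulrDr mulr1 mulrC lerDl ltW.
(* The sign - s turns the profile from -1 to 1 into a transition from s to - s. *)
pose c := - s / eps; pose d := - (c * x).
have cE : c ^+ 2 = eps ^- 2 by rewrite /c expr_div_n sqrrN expr2 ss div1r.
have c0 : c != 0 by rewrite -sqrf_eq0 cE invr_eq0 sqrf_eq0 gt_eqF.
have absc : `|c| = eps^-1.
  have /eqP := cE; rewrite -exprVn eqf_sqr => /orP[]/eqP ->; rewrite ?normrN gtr0_norm//;
    by rewrite invr_gt0.
have affE t : affine c d t = - s * ((t - x) / eps) by rewrite /affine /d /c; ring.
pose v := rescale c d y.
have cv : weak_chain setT k v.
  by have := weak_chain_affine d c0 openT cy; rewrite preimage_setT.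
have cc := @weak_chain_cst R setT k s openT.
(* Up to x + h the later part is the constant - s and cancels the added s, leaving [v]; beyond it
   [v] is - s and cancels the same s, leaving [z]. Adding chains thus glues them without another
   cut-off. *)
pose zz j := v j \+ cst (if j is 0%N then s else 0) \+ z j.
have czz : weak_chain setT k zz.
  exact: weak_chainD openT (weak_chainD openT cv cc) cz.
have [k' kE] : exists k', k = k'.+1 by case: k k0 {cy y1 y2 ey yl yr cc czz cv cz zl Ez zz ih} => // n _; exists n.
have v_left t : t < x - T * eps -> v 0%N t = s /\ v k t = 0.
  move=> ht; have hT : T < (x - t) / eps by rewrite ltr_pdivlMr//; lra.
  have aE : affine c d t = s * ((x - t) / eps) by rewrite affE; ring.
  rewrite /v /rescale expr0 mul1r aE; case: hs => ->; rewrite ?mul1r ?mulN1r.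
    by have [-> ->] := yr _ hT; rewrite mulr0.
  by have [|-> ->] := yl (- ((x - t) / eps)); [rewrite ltrN2|rewrite mulr0].
have v_right t : x + T * eps < t -> v 0%N t = - s /\ v k t = 0.
  move=> ht; have hT : T < (t - x) / eps by rewrite ltr_pdivlMr//; lra.
  rewrite /v /rescale expr0 mul1r affE; case: hs => ->; rewrite ?opprK ?mul1r ?mulN1r.
    by have [|-> ->] := yl (- ((t - x) / eps)); [rewrite ltrN2|rewrite mulr0].
  by have [-> ->] := yr _ hT; rewrite mulr0.
have z_left t : t <= x + h -> z 0%N t = - s /\ z k t = 0.
  move=> ht; apply: zl; apply/allP => w wxs; have : x + (h + h) < w.
    by move: hxs; rewrite (path_sortedE lt_trans) => /andP[/allP/(_ _ wxs)].
  lra.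
have zz_left t : t <= x + h -> zz 0%N t = v 0%N t /\ zz k t = v k t.
  by move=> /z_left[e1 e2]; rewrite /zz/= e1 kE/= -kE e2 addrK !addr0.
have zz_right t : x + h < t -> zz 0%N t = z 0%N t /\ zz k t = z k t.
  move=> ht; have [|e1 e2] := v_right t; first by rewrite (lt_trans _ ht)// ltrD2l.
  by rewrite /zz/= e1 kE/= -kE e2 addNr !add0r.
have abE : `]a, b[%classic = `]a, x + h] `|` `]x + h, b[.
  apply/seteqP; split=> t /=; rewrite !in_itv/=.
    by move=> /andP[-> ->]; rewrite andbT /=; case: (leP t (x + h)) => ht; [left|right].
  case=> /andP[t1 t2]; first by rewrite t1 (le_lt_trans t2).
  by rewrite t2 andbT (lt_trans _ t1)// (lt_trans ax)// ltrDl.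
have dis : [disjoint `]a, x + h] & `]x + h, b[].
  apply/disj_setPS => t [] /=; rewrite !in_itv/= => /andP[_ h1] /andP[h2 _].
  by move: (lt_le_trans h2 h1); rewrite ltxx.
exists zz; split => //.
- move=> t /andP[t1 tx].
  have [|e1 e2] := zz_left t.
    rewrite ltW// (lt_le_trans t1)// lerD2l (le_trans _ (ltW h0))// oppr_le0.
    by rewrite mulr_ge0// ltW.
  by rewrite e1 e2; exact: v_left.
- rewrite abE (energy_epsU openT czz cW W0 eps0)// -nat1r EFinD ge0_muleDl ?lee_fin//.
  rewrite mul1e; apply: leeD.
    apply: le_trans ey; rewrite -(rescale_inv_energy d cW W0 k0 eps0 cE cy).
    apply: (@le_trans _ _ (energy_eps W k eps `]a, (x + h)%R] v)).
      rewrite le_eqVlt; apply/orP; left; apply/eqP; apply: eq_integral => t.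
      by rewrite mem_setE in_itv/= => /andP[_ /zz_left[-> ->]].
    exact: energy_epsS openT cv cW W0 eps0 _ _ _ _.
  apply: le_trans Ez.
  rewrite le_eqVlt; apply/orP; left; apply/eqP; apply: eq_integral => t.
  by rewrite mem_setE in_itv/= => /andP[/zz_right[-> ->]].
- have mz j (w : nat -> R -> R) : weak_chain setT k w -> (j <= k)%N -> forall A, measurable A -> measurable_fun A (w j).
    by move=> [lw _] jk A mA; have [m _] := lw j jk; apply: measurable_funS m.
  have mpwc s' xs' (w : nat -> R -> R) A : weak_chain setT k w -> measurable A ->
      measurable_fun A (fun t => (`|w 0%N t - pwc s' xs' t|)%:E).
    move=> cw mA; apply/measurable_EFinP; apply: measurableT_comp => //.
    by apply: measurable_funB; [exact: mz cw _ _ mA|exact: measurable_pwc].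
  have mvs A : measurable A -> measurable_fun A (fun t => (`|v 0%N t - s * Num.sg (x - t)|)%:E).
    move=> mA; apply/measurable_EFinP; apply: measurableT_comp => //.
    apply: measurable_funB; first exact: mz cv _ _ mA.
    apply: measurable_funM; first exact: measurable_cst.
    exact: measurable_sgB.
  rewrite abE ge0_integral_setU//; last by apply: (mpwc s (x :: xs) zz) => //; exact: measurableU.
  rewrite -nat1r mulrDl mul1r EFinD; apply: leeD.
    (* The L^1 distance between the rescaled profile and its jump is eps times the distance on the
       unscaled line. *)
    have -> : (C * eps)%:E = (\int[mu]_t (`|v 0%N t - s * Num.sg (x - t)|)%:E)%E.
      pose g t := (`|y 0%N t - Num.sg t|)%:E : \bar R.
      have mg : measurable_fun setT g.
        apply/measurable_EFinP; apply: measurableT_comp => //.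
        by apply: measurable_funB; [exact: mz cy _ _ _|exact: measurable_sg].
      have -> : (\int[mu]_t (`|v 0%N t - s * Num.sg (x - t)|)%:E =
          \int[mu]_t g (affine c d t))%E.
        apply: eq_integral => t _; rewrite /g /v /rescale expr0 mul1r; congr (`|_ - _|)%:E.
        have -> : affine c d t = s * ((x - t) / eps) by rewrite affE; ring.
        rewrite !sgrM [Num.sg eps^-1]gtr0_sg ?invr_gt0// mulr1.
        by case: hs => ->; rewrite ?sgrN sgr1.
      have g0 t : setT t -> (0 <= g t)%E by move=> _; rewrite lee_fin.
      have := ge0_integral_affine d c0 measurableT mg g0.
      rewrite preimage_setT absc invrK => e1; apply: etrans (esym e1).
      rewrite [X in (_ * X)%E](_ : _ = C%:E); last exact: CE.
      by rewrite -EFinM mulrC.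
    apply: (@le_trans _ _ (\int[mu]_(t in `]a, (x + h)%R]) (`|v 0%N t - s * Num.sg (x - t)|)%:E)%E).
      rewrite le_eqVlt; apply/orP; left; apply/eqP.
      have mI : measurable `]a, x + h]%classic by exact: measurable_itv.
      apply: ge0_ae_eq_integral => //.
      - exact: (mpwc s (x :: xs) zz).
      - exact: mvs.
      exists [set x]; split; [exact: measurable_set1|exact: lebesgue_measure_set1|].
      move=> t /= ht; apply: contrapT => /eqP tx; apply: ht.
      rewrite in_itv/= => /andP[_ th]; rewrite (zz_left _ th).1; congr (`|_ - _|)%:E.
      case: (ltgtP t x) tx => // tx _.
        by rewrite gtr0_sg ?subr_gt0// mulr1.
      rewrite ltr0_sg ?subr_lt0// mulrN1 pwc_path//.
      by case: (xs) hxs1 => //= y' ys' /andP[h1 ->]; rewrite andbT (le_lt_trans th).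
    apply: ge0_subset_integral => //.
    exact: mvs.
  apply: le_trans Lz.
  rewrite le_eqVlt; apply/orP; left; apply/eqP; apply: eq_integral => t.
  rewrite mem_setE in_itv/= => /andP[/[dup] xt /zz_right[-> _] _].
  by rewrite ltNge (le_trans _ (ltW xt))//= lerDl ltW.
Qed.

(** Markov's inequality. *)
Lemma cvg_in_L1_measure (T : Type) (G : set_system T) {FG : Filter G} a b (u_ : T -> R -> R) u :
  (\forall i \near G, measurable_fun `]a, b[ (u_ i)) -> measurable_fun `]a, b[ u ->
  cvg_in_L1 G a b u_ u -> cvg_in_measure G a b u_ u.
Proof.
move=> mu_ mu0 h e e0.
apply: (@squeeze_cvge _ _ _ _ (cst 0%E) _
  (fun i => (e^-1%:E * \int[mu]_(t in `]a, b[) (`|u_ i t - u t|)%:E)%E)).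
- near=> i; apply/andP; split; first exact: measure_ge0.
  have mi : measurable_fun `]a, b[ (u_ i) by near: i.
  rewrite -lee_pdivrMl ?invr_gt0// invrK.
  have mf : measurable_fun `]a, b[ (EFin \o (u_ i \- u)).
    by apply/measurable_EFinP; exact: measurable_funB.
  apply: le_trans (le_integral_abse mu (measurable_itv _) mf e0).
  apply: lee_wpmul2l; first by rewrite lee_fin ltW.
  apply: le_measure; rewrite ?inE.
  + apply: (@measurable_superlevel _ `]a, b[%classic (u_ i \- u)) => //.
    exact: measurable_funB.
  + by apply: emeasurable_fun_c_infty => //; exact: measurableT_comp.
  + by move=> t /= [tab te]; split => //; rewrite lee_fin ltW.
- exact: cvg_cst.
- by rewrite -[X in _ --> X](mule0 e^-1%:E); apply: cvgeZl.
Unshelve. all: by end_near. Qed.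

(** One family indexed by eps serves every sequence tending to 0 as well as the limit along eps
    itself. All its members are integrable, including those for eps that is not small or not
    positive. *)
Lemma recovery_family W k a b u : (0 < k)%N -> continuous W ->
  (forall x, 0 <= W x) -> W (-1) = 0 -> W 1 = 0 -> a < b -> BV_pm1 a b u ->
  exists u_ : R -> R -> R, (forall eps, integrable_on a b (u_ eps)) /\
  forall delta, 0 < delta -> exists2 eps0 : R, 0 < eps0 & forall eps, 0 < eps -> eps < eps0 ->
    (F_eps k W a b eps (u_ eps) <= m_opt k W * counting (jump_set a b u) + delta%:E)%E /\
    (\int[mu]_(t in `]a, b[) (`|u_ eps t - u t|)%:E <= delta%:E)%E.
Proof.
move=> k0 cW W0 Wm1 W1 ab bv.
have [s [xs [hs pxs xsb us]]] := BV_pm1_pwc ab bv.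
rewrite (counting_jump_set_pwc hs pxs xsb us).
have [mu_ _ _] := bv.
set m := m_opt k W; set N := (size xs)%:R.
pose good delta eps v := [/\ integrable_on a b v,
  (F_eps k W a b eps v <= m * N%:E + delta%:E)%E &
  (\int[mu]_(t in `]a, b[) (`|v t - u t|)%:E <= delta%:E)%E].
have ex delta : 0 < delta -> exists2 eps0 : R, 0 < eps0 & forall eps, 0 < eps -> eps < eps0 ->
    exists v, good delta eps v.
  move=> d0; pose theta := delta / (N + 1).
  have N1 : 0 < N + 1 by rewrite ltr_wpDl.
  have th0 : 0 < theta by rewrite divr_gt0.
  have thN : N * theta <= delta.
    by rewrite /theta mulrA ler_pdivrMr// mulrC ler_pM2l// lerDl.
  have [C C0 [T _ H]] := recovery_chain k0 cW W0 Wm1 W1 th0.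
  have [e0 e00 {}H] := H b xs s a hs ab pxs xsb.
  have NC0 : 0 < N * C + 1 by rewrite ltr_wpDl// mulr_ge0.
  exists (Num.min e0 (delta / (N * C + 1))); first by rewrite lt_min e00 divr_gt0.
  move=> eps eps0; rewrite lt_min => /andP[ee0 ed].
  have [z [cz _ Ez Lz]] := H eps eps0 ee0.
  have oab : open (`]a, b[%classic : set R) by exact: itv_open.
  have czab : weak_chain `]a, b[ k z by exact: (weak_chainS openT oab (@subsetT _ _) cz).
  exists (z 0%N); split.
  - apply: (@integrableS _ _ _ mu `[a, b]) => //; first exact: subset_itv_oo_cc.
    exact: weak_chain_segment_integrable cz.
  - rewrite (F_eps_energy cW W0 eps0 (weak_chain_sobolevH a b cz) czab)//.
    apply: (le_trans Ez); rewrite -/N -/m ge0_muleDr ?m_opt_ge0 ?lee_fin ?(ltW th0)//.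
    by rewrite muleC leeD2l// -EFinM lee_fin.
  - have [lz _] := cz; have [mz0 _] := lz 0%N (leq0n k).
    have {}mz0 : measurable_fun `]a, b[ (z 0%N) by apply: measurable_funS mz0.
    rewrite (@ge0_ae_eq_integral _ _ _ mu _ _ (fun t => (`|z 0%N t - pwc s xs t|)%:E))//.
    + apply: (le_trans Lz); rewrite lee_fin mulrA (le_trans (_ : _ <= (N * C + 1) * eps))//.
        by rewrite ler_pM2r// lerDl.
      by rewrite mulrC -ler_pdivlMr// ltW.
    + by apply/measurable_EFinP; apply: measurableT_comp => //; apply: measurable_funB.
    + apply/measurable_EFinP; apply: measurableT_comp => //; apply: measurable_funB => //.
      exact: measurable_pwc.
    + move: us; apply: filterS; first exact: (ae_filter_ringOfSetsType mu).
      by move=> t h tab; rewrite h.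
have mono d d' eps v : d <= d' -> good d eps v -> good d' eps v.
  move=> dd [h1 h2 h3]; split => //; first by rewrite (le_trans h2)// leeD2l.
  by rewrite (le_trans h3).
(* Diagonal choice: for each eps, one function that is good for (almost) all the tolerances
   admissible at eps. *)
have pick eps : 0 < eps -> exists v, integrable_on a b v /\
    forall d, 0 < d -> (exists w, good d eps w) -> good (d + eps) eps v.
  move=> e0; pose S := [set d | 0 < d /\ exists w, good d eps w].
  have [S0|S0] := pselect (S !=set0); last first.
    exists (cst 0); split; last by move=> d d0 hd; exfalso; apply: S0; exists d.
    exact: integrable0.
  have hS : has_inf S by split => //; exists 0 => d [/ltW].
  (* The infimum of the admissible tolerances need not be attained; the excess eps tends to 0
     anyway. *)
  have [d [d0 [v hv]] dS] := inf_adherent e0 hS.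
  exists v; split; first by case: hv.
  move=> d' d'0 hd'; apply: mono hv; rewrite ltW// (lt_le_trans dS)// lerD2r.
  by apply: ge_inf; [case: hS|split].
have /choice[u_ hu] eps : exists v, integrable_on a b v /\ (0 < eps ->
    forall d, 0 < d -> (exists w, good d eps w) -> good (d + eps) eps v).
  have [e0|e0] := ltP 0 eps; first by have [v []] := pick eps e0; exists v.
  by exists (cst 0); split => //; exact: integrable0.
exists u_; split => [eps|delta d0]; first by have [] := hu eps.
have d2 : 0 < delta / 2 by rewrite divr_gt0.
have [e0 e00 he] := ex _ d2.
exists (Num.min e0 (delta / 2)); first by rewrite lt_min e00.
move=> eps eps0; rewrite lt_min => /andP[ee0 ed].
have [_ H] := hu eps.
have : good delta eps (u_ eps).
  by apply: mono (H eps0 _ d2 (he _ eps0 ee0)); rewrite [leRHS]splitr lerD2l ltW.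
by case.
Qed.

End recovery.

(** * Equicoercivity *)

Section cells.
Context {R : realType}.
Implicit Types (D A : set R) (z : nat -> R -> R) (a b c d e p q s t x eps : R) (k n : nat)
  (W f : R -> R) (xs : seq R).
Local Notation mu := (@lebesgue_measure R).

Definition double_well W (alpha beta : R) := forall z : R,
  alpha * Num.min ((z + 1) ^+ 2) (Num.min ((z - 1) ^+ 2) beta) <= W z.

Definition off_wells A f e := [set t | A t /\ (e < `|f t - 1| /\ e < `|f t + 1|)].

Lemma measurable_off_wells A f e : measurable A -> measurable_fun A f ->
  measurable (off_wells A f e).
Proof.
move=> mA mf.
have -> : off_wells A f e = [set t | A t /\ e < `|(f \- cst 1) t|] `&`
    [set t | A t /\ e < `|(f \- cst (- 1)) t|].
  apply/seteqP; split=> t /=; rewrite opprK; first by move=> [? []].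
  by move=> [[? ?] [_ ?]].
by apply: measurableI; apply: measurable_superlevel => //; apply: measurable_funB.
Qed.

(** Markov's inequality for W(f): at distance more than e from both wells, W is at least alpha
    min(e^2, beta). *)
Lemma off_wells_measure W alpha beta A f e : continuous W -> (forall x, 0 <= W x) ->
  double_well W alpha beta -> 0 < alpha -> 0 < beta -> 0 < e ->
  measurable A -> measurable_fun A f ->
  ((alpha * Num.min (e ^+ 2) beta)%:E * mu (off_wells A f e) <=
   \int[mu]_(t in A) (W (f t))%:E)%E.
Proof.
move=> cW W0 hW a0 b0 e0 mA mf; set c := _ * _.
have c0 : 0 < c by rewrite mulr_gt0// lt_min exprn_gt0.
have mWf : measurable_fun A (fun t => (W (f t))%:E).
  by apply/measurable_EFinP; apply: measurableT_comp => //; exact: continuous_measurable_fun.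
have -> : (\int[mu]_(t in A) (W (f t))%:E = \int[mu]_(t in A) `|(W (f t))%:E|)%E.
  by apply: eq_integral => t _; rewrite gee0_abs// lee_fin.
apply: le_trans (le_integral_abse mu mA mWf c0).
apply: lee_wpmul2l; first by rewrite lee_fin ltW.
apply: le_measure; rewrite ?inE.
- exact: measurable_off_wells.
- by apply: emeasurable_fun_c_infty => //; exact: measurableT_comp.
- move=> t [At [h1 h2]]; split => //=; rewrite lee_fin ger0_norm//.
  apply: le_trans (hW (f t)); rewrite /c ler_pM2l// !le_min.
  have sq (y : R) : e < `|y| -> e ^+ 2 <= y ^+ 2.
    by move=> h; rewrite -[leRHS]real_normK ?num_real// lerXn2r ?nnegrE// ltW.
  by rewrite !ge_min (sq _ h1) (sq _ h2) lexx ?orbT.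
Qed.

(* Small energy on a cell bounds the jet there, hence the oscillation of z_0 at a small scale
   independent of the energy; as z_0 is near the wells at most points, it never vanishes. *)
Lemma cell_sign W alpha beta k : (0 < k)%N -> continuous W -> (forall x, 0 <= W x) ->
  double_well W alpha beta -> 0 < alpha -> 0 < beta ->
  exists2 delta : R, 0 < delta & forall D z p, open D -> weak_chain D k z ->
  `[p, p + 1] `<=` D -> (energy W k `[p, (p + 1)%R] z <= delta%:E)%E ->
  exists2 s, s = 1 \/ s = -1 & {ae mu, forall t, `[p, p + 1]%classic t -> 0 < s * z 0%N t}.
Proof.
case: k => // n _ cW W0 hW a0 b0.
have [C C0 jet] := @continuous_repr_jet R n.
(* The jet bound will be used with eta = 2 and delta = 1/16, and 2 + 1/16 <= 3. *)
pose L := C * 3; have L0 : 0 <= L by rewrite mulr_ge0.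
pose dl : R := 16^-1; have dl0 : 0 < dl by rewrite invr_gt0.
(* Over a length [r] the bound [L] on the derivative allows a change of at most 1/16; r <= 2^-(n+1)
   lets a set of measure below [r] be exceptional in the jet estimate. *)
pose r := Num.min (16 * (L + 1))^-1 (2^-1 ^+ n.+1 : R).
have L1 : 0 < 16 * (L + 1) by rewrite mulr_gt0// ltr_wpDl.
have r0 : 0 < r by rewrite lt_min invr_gt0 L1 exprn_gt0.
have Lr : L * r <= 16^-1.
  apply: (@le_trans _ _ (L * (16 * (L + 1))^-1)); first by rewrite ler_wpM2l// /r ge_min lexx.
  rewrite ler_pdivrMr// mulrA mulVf// mul1r lerDl//.
have r1 : r <= 1.
  by rewrite /r ge_min exprn_ile1 ?orbT// invr_le1// ?unitfE// ler1n.
pose kap := alpha * Num.min (4^-1 ^+ 2) beta.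
have kap0 : 0 < kap by rewrite mulr_gt0// lt_min b0 exprn_gt0// invr_gt0.
(* The first entry bounds the top derivative in L^2 by 1/16. The second makes the set at distance
   more than 1/4 from both wells smaller than [r]; this set contains the points where |z_0| > 2. *)
exists (Num.min (dl ^+ 2) (kap * (r / 2))).
  by rewrite lt_min exprn_gt0//= mulr_gt0// divr_gt0.
move=> D z p oD cz pD; set E := energy _ _ _ _ => hE.
have hE1 : (E <= (dl ^+ 2)%:E)%E by rewrite (le_trans hE)// lee_fin ge_min lexx.
have hE2 : (E <= (kap * (r / 2))%:E)%E by rewrite (le_trans hE)// lee_fin ge_min lexx orbT.
have [lz _] := cz.
have mz j : (j <= n.+1)%N -> measurable_fun `[p, p + 1] (z j).
  by move=> jn; have [m _] := lz j jn; apply: measurable_funS m => //; exact: open_measurable.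
have pp1 : p < p + 1 by rewrite ltrDl.
have [Z [h1 h2 h3 h4]] := weak_chain_continuous_repr oD pp1 pD cz.
have ch : classical_chain n p (p + 1) Z by split.
have rep : continuous_repr n z p (p + 1) Z by split.
have mWz : measurable_fun `[p, p + 1] (fun t => (W (z 0%N t))%:E).
  apply/measurable_EFinP; apply: measurableT_comp; last exact: mz.
  exact: continuous_measurable_fun.
have mz2 : measurable_fun `[p, p + 1] (fun t => (z n.+1 t ^+ 2)%:E).
  by apply/measurable_EFinP; apply: measurable_funX; exact: mz.
have mE : measurable_fun `[p, p + 1] (fun t => (W (z 0%N t) + z n.+1 t ^+ 2)%:E).
  apply/measurable_EFinP; apply: measurable_funD; first exact/measurable_EFinP.
  exact/measurable_EFinP.
have hz : (\int[mu]_(t in `[p, (p + 1)%R]) (z n.+1 t ^+ 2)%:E <= (dl ^+ 2)%:E)%E.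
  apply: le_trans hE1; apply: ge0_le_integral => //.
  - by move=> t _; rewrite lee_fin sqr_ge0.
  - by move=> t _; rewrite lee_fin lerDr.
pose S := off_wells `[p, p + 1] (z 0%N) 4^-1.
have mS : measurable S by apply: measurable_off_wells => //; exact: mz.
have q4 : 0 < 4^-1 :> R by rewrite invr_gt0.
have hS : (mu S < r%:E)%E.
  have := off_wells_measure cW W0 hW a0 b0 q4 (measurable_itv `[p, (p + 1)%R]) (mz 0%N isT).
  rewrite -/S -/kap => hS.
  have : (kap%:E * mu S <= (kap * (r / 2))%:E)%E.
    apply: (le_trans hS); apply: le_trans hE2; apply: ge0_le_integral => //.
    - by move=> t _; rewrite lee_fin.
    - by move=> t _; rewrite lee_fin lerDl sqr_ge0.
  rewrite (EFinM kap) lee_pmul2l// => /le_lt_trans; apply; rewrite lte_fin.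
  by rewrite ltr_pdivrMr// ltr_pMr// ltr1n.
have h2S : (mu [set t | `[p, (p + 1)%R]%classic t /\ (2 < `|z 0%N t|)%R] < (2^-1 ^+ n.+1)%:E)%E.
  apply: (@lt_le_trans _ _ r%:E); last by rewrite lee_fin /r ge_min lexx orbT.
  apply: le_lt_trans hS; apply: le_measure; rewrite ?inE//.
    by apply: measurable_superlevel => //; exact: mz.
  move=> t [tp ht]; split => //.
  have k1 : `|z 0%N t| <= `|z 0%N t - 1| + 1.
    by have := ler_normD (z 0%N t - 1) 1; rewrite subrK normr1.
  have k2 : `|z 0%N t| <= `|z 0%N t + 1| + 1.
    by have := ler_normB (z 0%N t + 1) 1; rewrite addrK normr1.
  by split; lra.
have jb := jet z p Z 2 dl (ltW (ltr0n R 2)) dl0 rep (mz 0%N isT) (mz _ (leqnn _)) hz h2S.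
have {}jb i t : (i <= n)%N -> p <= t <= p + 1 -> `|Z i t| <= L.
  move=> ik tp; apply: le_trans (jb i t ik tp) _; rewrite ler_wpM2l//.
  by rewrite /dl; lra.
have osc s t : p <= s -> s < t -> t <= p + 1 -> `|Z 0%N t - Z 0%N s| <= L * (t - s) + dl.
  move=> ps st tp; have := continuous_repr_oscillation dl0 rep (mz _ (leqnn _)) hz ps (ltW st) tp.
  (* For k = 1 the function z_0 is itself the top of the chain and its oscillation bound is direct;
     for k > 1 its derivative is part of the jet and bounded by [L]. *)
  case: (posnP n) => [n0|n0].
    by rewrite n0 => h; apply: (le_trans h); rewrite lerDr mulr_ge0// subr_ge0 ltW.
  move=> _; have [x /andP[sx xt] ->] := classical_chain_MVT ch n0 ps st tp.
  rewrite normrM [`|t - s|]gtr0_norm ?subr_gt0//.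
  apply: (@le_trans _ _ (L * (t - s))); last by rewrite lerDl ltW.
  rewrite ler_wpM2r// ?subr_ge0 ?(ltW st)//; apply: jb => //.
  by rewrite (le_trans ps (ltW sx)) (le_trans (ltW xt) tp).
have big t : p <= t -> t <= p + 1 -> 2^-1 < `|Z 0%N t|.
  (* A window of length [r] that contains [t] and stays in the cell also contains a point where
     |z_0| >= 3/4. Between it and [t] the function changes by at most 1/8, and 3/4 - 1/8 > 1/2. *)
  move=> pt tp; pose c := Num.min t (p + 1 - r).
  have [c1 c2] : c <= t /\ c <= p + 1 - r by rewrite /c !ge_min !lexx orbT.
  have pc : p <= c by rewrite /c le_min pt; lra.
  have tc : t <= c + r by rewrite /c; case: (leP t (p + 1 - r)) => ?; lra.
  have [s [/andP[cs scr] sS zZ]] := exists_outside c r0 mS hS (h1 0%N (leq0n n)).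
  have ps : p < s by exact: le_lt_trans pc cs.
  have sp : s < p + 1 by lra.
  have {}zZ : z 0%N s = Z 0%N s by apply: zZ; rewrite /= in_itv/= ps.
  have dist : `|Z 0%N t - Z 0%N s| <= 16^-1 + dl.
    have key d' : d' <= r -> L * d' + dl <= 16^-1 + dl.
      by move=> h; rewrite lerD2r (le_trans _ Lr)// ler_wpM2l.
    case: (ltgtP s t) => [st|ts|->]; last by rewrite subrr normr0 addr_ge0// ltW.
      by apply: le_trans (osc s t (ltW ps) st tp) _; apply: key; lra.
    by rewrite distrC; apply: le_trans (osc t s pt ts (ltW sp)) _; apply: key; lra.
  have near1 : 3 / 4 <= `|Z 0%N s|.
    rewrite -zZ leNgt; apply/negP => hlt; apply: sS; split.
      by rewrite /= in_itv/= (ltW ps) (ltW sp).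
    move: hlt; rewrite ltr_norml => /andP[g1 g2].
    split; first by rewrite lter_normr; apply/orP; right; lra.
    by rewrite lter_normr; apply/orP; left; lra.
  have := ler_dist_dist (Z 0%N t) (Z 0%N s); rewrite ler_norml => /andP[g1 _].
  by move: dist; rewrite /dl => dist; lra.
have p0 : 2^-1 < `|Z 0%N p| by apply: big => //; rewrite ltW.
pose s := Num.sg (Z 0%N p).
have hs : s = 1 \/ s = -1.
  rewrite /s; case: (sgrP (Z 0%N p)) p0 => //; [|by left|by right].
  by rewrite invr_lt0 ltrn0.
have pos t : p <= t -> t <= p + 1 -> 0 < s * Z 0%N t.
  move=> pt tp; rewrite ltNge; apply/negP => hle.
  have cont : {within `[p, t], continuous (Z 0%N)}.
    by have [c0 _] := classical_chainS (lexx p) tp ch; exact: c0.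
  have [|x] := @IVT R (Z 0%N) p t 0 pt cont.
    have h0 : 0 < s * Z 0%N p.
      by rewrite /s -normrEsg (lt_trans _ p0)// invr_gt0.
    move: h0 hle; rewrite ge_min le_max; case: hs => ->; rewrite ?mul1r ?mulN1r => g1 g2.
      by rewrite g2 orbT (ltW g1).
    by move: g1 g2; rewrite oppr_gt0 oppr_le0 => g1 ->; rewrite (ltW g1) orbT.
  rewrite in_itv/= => /andP[px xt] Zx.
  by have := big x px (le_trans xt tp); rewrite Zx normr0 invr_lt0 ltrn0.
exists s => //; have [N [mN N0 hN]] := h1 0%N (leq0n n).
exists (N `|` ([set p] `|` [set p + 1])); split.
- by do 2 apply: measurableU => //.
- rewrite (@measureU0 _ _ _ mu)//; first exact: measurableU.
  by rewrite (@measureU0 _ _ _ mu)//; exact: lebesgue_measure_set1.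
move=> t /= h; have [->|tp] := eqVneq t p; first by right; left.
have [->|tp1] := eqVneq t (p + 1); first by right; right.
left; apply: hN => /= h'; apply: h; rewrite in_itv/= => /andP[t1 t2].
rewrite h'; first exact: pos.
by rewrite /= in_itv/= lt_neqAle eq_sym tp t1 lt_neqAle tp1 t2.
Qed.

End cells.

(** * Approximation by step functions on unit cells *)

Section piecewise_constant_approximation.
Context {R : realType}.
Implicit Types (D A : set R) (z : nat -> R -> R) (a b c d e p q s t x eps M : R) (k n m i : nat)
  (W : R -> R) (xs : seq R) (sigma : nat -> R).
Local Notation mu := (@lebesgue_measure R).

Definition sign_changes c sigma m : seq R :=
  [seq c + i%:R | i <- iota 1 m & sigma i != sigma i.-1].

Lemma sign_changesS c sigma m : sign_changes c sigma m.+1 =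
  if sigma m.+1 != sigma m then rcons (sign_changes c sigma m) (c + m.+1%:R)
  else sign_changes c sigma m.
Proof.
rewrite /sign_changes.
have -> : iota 1 m.+1 = rcons (iota 1 m) m.+1 by rewrite -[in LHS](addn1 m) iotaD cats1 add1n.
by rewrite filter_rcons/=; case: ifP; rewrite ?map_rcons.
Qed.

Lemma sign_changes_bound c sigma m : all (fun x => x <= c + m%:R) (sign_changes c sigma m).
Proof.
apply/allP => x /mapP[i + ->]; rewrite mem_filter mem_iota add1n ltnS => /and3P[_ _ im].
by rewrite lerD2l ler_nat.
Qed.

Lemma sign_changes_ge c sigma m : all (fun x => c <= x) (sign_changes c sigma m).
Proof. by apply/allP => x /mapP[i _ ->]; rewrite lerDl. Qed.

(** No jump lies beyond the last cell, so its sign persists to the right; the alternative i = m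
    records this and is what the induction uses. *)
Lemma pwc_sign_changes c sigma m i t : (forall i, sigma i = 1 \/ sigma i = -1) ->
  (i <= m)%N -> c + i%:R <= t -> (t < c + i.+1%:R \/ i = m) ->
  pwc (sigma 0%N) (sign_changes c sigma m) t = sigma i.
Proof.
move=> hs; elim: m i t => [|m ih] i t im it hi.
  by move: im; rewrite leqn0 => /eqP ->.
have bnd : all (fun x => x <= c + m.+1%:R) (sign_changes c sigma m).
  apply: sub_all (sign_changes_bound c sigma m) => x /le_trans; apply.
  by rewrite lerD2l ler_nat.
rewrite sign_changesS; move: im; rewrite leq_eqVlt => /predU1P[ei|]; last first.
  rewrite ltnS => im.
  have ti : t < c + i.+1%:R by case: hi => // ei; move: im; rewrite ei ltnn.
  have e : pwc (sigma 0%N) (sign_changes c sigma m) t = sigma i by apply: ih => //; left.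
  case: ifP => // _; rewrite pwc_rcons// e ifT//.
  by rewrite (lt_le_trans ti)// lerD2l ler_nat.
rewrite ei in it *.
have e : pwc (sigma 0%N) (sign_changes c sigma m) t = sigma m.
  by apply: ih => //; [rewrite (le_trans _ it)// lerD2l ler_nat|right].
case: ifP => [ne|/negbFE/eqP ->//]; rewrite pwc_rcons// e ltNge it/=.
by move: ne; case: (hs m) => ->; case: (hs m.+1) => ->; rewrite ?eqxx ?opprK.
Qed.

(** Each change of sign is charged to the energy of the two cells that meet there. *)
Lemma size_sign_changes c sigma m (E : nat -> R) (delta : R) :
  (forall i, (i < m)%N -> sigma i.+1 != sigma i -> delta <= E i + E i.+1) ->
  (forall i, 0 <= E i) ->
  (size (sign_changes c sigma m))%:R * delta <= \sum_(i < m) (E i + E i.+1).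
Proof.
move=> h E0; elim: m h => [|m ih] h; first by rewrite big_ord0 mul0r.
rewrite big_ord_recr/= sign_changesS.
have {}ih := ih (fun i im => h i (ltnW im)).
case: ifP => ne; last by rewrite (le_trans ih)// lerDl addr_ge0.
by rewrite size_rcons -natr1 mulrDl mul1r lerD// h.
Qed.

Lemma half_cell_subset (q : R) : let p := q + 2^-1 in
  [/\ `[p, p + 1] `<=` `[q, q + 2%:R], `]p, q + 1[ `<=` `[q, q + 1],
    `]p, q + 1[ `<=` `[p, p + 1], `]q + 1, p + 1[ `<=` `[q + 1, q + 1 + 1] &
    `]q + 1, p + 1[ `<=` `[p, p + 1]].
Proof.
by split=> t; rewrite /= !in_itv/= => /andP[h1 h2]; apply/andP; split; lra.
Qed.

(** Each cell belongs to at most two neighbouring pairs, so the charges for the sign changes total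
    at most 2M. As for the measure, a cell with energy above [delta] is discarded entirely, at cost
    E / delta; on any other cell only the points off both wells count. *)
Lemma cells_pwc W alpha beta k : (0 < k)%N -> continuous W -> (forall x, 0 <= W x) ->
  double_well W alpha beta -> 0 < alpha -> 0 < beta ->
  exists2 delta : R, 0 < delta & forall D z c n M, open D -> weak_chain D k z ->
  `[c, c + n%:R] `<=` D -> (energy W k `[c, (c + n%:R)%R] z <= M%:E)%E ->
  exists s xs, [/\ s = 1 \/ s = -1, all (fun x => c <= x <= c + n%:R) xs,
    (size xs)%:R * delta <= 2 * M &
    forall e, 0 < e -> e <= 1 ->
    (mu [set t | `[c, (c + n%:R)%R[%classic t /\ (e < `|z 0%N t - pwc s xs t|)%R] <=
     (M * (delta^-1 + (alpha * Num.min (e ^+ 2) beta)^-1))%:E)%E].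
Proof.
move=> k0 cW W0 hW a0 b0.
have [d2 d20 sgn] := cell_sign k0 cW W0 hW a0 b0.
pose delta := d2 / 2; have dl0 : 0 < delta by rewrite divr_gt0.
exists delta => // D z c n M oD cz cD hE.
case: n cD hE => [|m] cD hE.
  have M0 : 0 <= M.
    rewrite -lee_fin; apply: le_trans hE; apply: integral_ge0 => t _.
    by rewrite lee_fin addr_ge0// sqr_ge0.
  exists 1, [::]; split; [by left|by []|by rewrite mul0r mulr_ge0|].
  move=> e e0 e1; rewrite (_ : [set _ | _] = set0); last first.
    apply/seteqP; split => // t [/=]; rewrite in_itv/= addr0 => /andP[h1 h2].
    by move: (le_lt_trans h1 h2); rewrite ltxx.
  rewrite measure0 lee_fin mulr_ge0// addr_ge0// invr_ge0 ?ltW// mulr_gt0// lt_min b0 andbT.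
  by rewrite exprn_gt0.
pose f t := (W (z 0%N t) + z k t ^+ 2)%:E.
have f0 t : (0 <= f t)%E by rewrite /f lee_fin addr_ge0// sqr_ge0.
have [lz _] := cz.
have mzA j A : (j <= k)%N -> measurable A -> A `<=` D -> measurable_fun A (z j).
  move=> jn mA AD; have [mm _] := lz j jn; apply: measurable_funS mm => //.
  exact: open_measurable.
have mf A : measurable A -> A `<=` D -> measurable_fun A f.
  move=> mA AD; apply/measurable_EFinP; apply: measurable_funD.
    apply: measurableT_comp; last exact: mzA.
    exact: continuous_measurable_fun.
  by apply: measurable_funX; exact: mzA.
pose Ei i := (\int[mu]_(t in `[(c + i%:R)%R, (c + i%:R + 1)%R]) f t)%E.
have cell i : (i < m.+1)%N -> `[c + i%:R, c + i%:R + 1] `<=` `[c, c + m.+1%:R].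
  move=> im t; rewrite /= !in_itv/= -addrA natr1 => /andP[h1 h2].
  by rewrite (le_trans _ h1) ?lerDl//= (le_trans h2)// lerD2l ler_nat.
have sumE : (\sum_(i < m.+1) Ei i <= M%:E)%E.
  by rewrite -cell_integral_sum//; exact: mf.
have Ei0 i : (0 <= Ei i)%E by exact: integral_ge0.
have Efin i : (i < m.+1)%N -> Ei i \is a fin_num.
  move=> im; rewrite ge0_fin_numE//; apply: (@le_lt_trans _ _ M%:E); last exact: ltry.
  apply: le_trans sumE; rewrite (bigD1 (Ordinal im))//= leeDl//.
  exact: sume_ge0.
pose E i := fine (Ei i).
have E0 i : 0 <= E i by exact: fine_ge0.
have EE i : (i < m.+1)%N -> Ei i = (E i)%:E by move=> im; rewrite fineK// Efin.
have {}sumE : \sum_(i < m.+1) E i <= M.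
  rewrite -lee_fin -sumEFin; apply: le_trans sumE; rewrite le_eqVlt; apply/orP; left; apply/eqP.
  by apply: eq_bigr => i _; rewrite EE.
have dl2 : delta <= d2 by rewrite /delta ler_pdivrMr// ler_peMr ?ler1n// ltW.
(* Cells with too much energy receive the arbitrary sign 1: a wrong sign there only adds jumps and
   measure already paid for. *)
have /choice[sigma hsig] i : exists s, (s = 1 \/ s = -1) /\ ((i < m.+1)%N -> E i <= delta ->
    {ae mu, forall t, `[c + i%:R, c + i%:R + 1]%classic t -> 0 < s * z 0%N t}).
  have [/andP[im Ed]|h] := boolP ((i < m.+1)%N && (E i <= delta)); last first.
    by exists 1; split; [left|move=> h1 h2; rewrite h1 h2 in h].
  have [||s hs ae] := sgn D z (c + i%:R) oD cz.
  - by apply: subset_trans cD; exact: cell.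
  - by rewrite [X in (X <= _)%E](EE i im) lee_fin (le_trans Ed).
  by exists s; split.
have hs i : sigma i = 1 \/ sigma i = -1 by case: (hsig i).
have same (s s' : R) p q : p < q -> s = 1 \/ s = -1 -> s' = 1 \/ s' = -1 ->
    {ae mu, forall t, `]p, q[%classic t -> 0 < s * z 0%N t} ->
    {ae mu, forall t, `]p, q[%classic t -> 0 < s' * z 0%N t} -> s = s'.
  move=> pq h1 h2 ae1 ae2.
  have : {ae mu, forall t, `]p, q[%classic t -> 0 < s * z 0%N t /\ 0 < s' * z 0%N t}.
    move: ae1 ae2; apply: filterS2; first exact: (ae_filter_ringOfSetsType mu).
    by move=> t g1 g2 tpq; split; [exact: g1|exact: g2].
  move=> /(ae_exists pq)[t tpq /(_ tpq)].
  case: h1 => ->; case: h2 => -> //; rewrite mul1r mulN1r oppr_gt0 => -[g1 g2];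
    by have := lt_trans g1 g2; rewrite ltxx.
have aeS (s : R) (I J : set R) : I `<=` J -> {ae mu, forall t, J t -> 0 < s * z 0%N t} ->
    {ae mu, forall t, I t -> 0 < s * z 0%N t}.
  move=> IJ; apply: filterS; first exact: (ae_filter_ringOfSetsType mu).
  by move=> t h /IJ; exact: h.
have adj i : (i < m)%N -> sigma i.+1 != sigma i -> delta <= E i + E i.+1.
  move=> im; apply: contraNT; rewrite -ltNge => lt.
  have im1 : (i < m.+1)%N by rewrite ltnS ltnW.
  have g1 : E i <= delta by rewrite ltW// (le_lt_trans _ lt)// lerDl.
  have g2 : E i.+1 <= delta by rewrite ltW// (le_lt_trans _ lt)// lerDr.
  have [_ /(_ im1 g1) ae1] := hsig i.
  have [_ /(_ im g2) ae2] := hsig i.+1.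
  (* The cell shifted by 1/2 has small energy too and overlaps both neighbours. *)
  pose p := c + i%:R + 2^-1.
  have pc : p = c + i%:R + 2^-1 by [].
  have iS : c + i.+1%:R = c + i%:R + 1 by rewrite -addrA natr1.
  have two : `[c + i%:R, c + i%:R + 2%:R] `<=` D.
    apply: subset_trans cD => t; rewrite /= !in_itv/= => /andP[h1 h2].
    rewrite (le_trans _ h1) ?lerDl//= (le_trans h2)// -addrA -natrD lerD2l ler_nat.
    by rewrite addn2.
  have [psub s1 s2 s3 s4] := half_cell_subset (c + i%:R).
  rewrite -/p in psub s1 s2 s3 s4.
  have Ep : (energy W k `[p, (p + 1)%R] z <= d2%:E)%E.
    apply: (@le_trans _ _ (\int[mu]_(t in `[(c + i%:R)%R, (c + i%:R + 2%:R)%R]) f t)%E).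
      apply: (@ge0_subset_integral _ _ _ mu); [exact: measurable_itv|exact: measurable_itv| | |exact: psub].
        exact: (mf _ (measurable_itv _) two).
      by move=> t _; exact: f0.
    rewrite cell_integral_sum//; last by apply: mf.
    rewrite big_ord_recr big_ord1/= addr0 -/(Ei i) -iS -/(Ei i.+1) !EE// -EFinD lee_fin.
    by rewrite (le_trans (ltW lt)).
  have [s' hs' ae'] := sgn D z p oD cz (subset_trans psub two) Ep.
  have pq1 : p < c + i%:R + 1 by rewrite pc ltrD2l invf_lt1// ltr1n.
  have pq2 : c + i%:R + 1 < p + 1 by rewrite pc ltrD2r ltrDl.
  apply/eqP; transitivity s'; last first.
    by apply: (same _ _ p (c + i%:R + 1)) => //; [exact: aeS ae'|exact: aeS ae1].
  apply: (same _ _ (c + i%:R + 1) (p + 1)) => //; last exact: aeS ae'.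
  by rewrite iS in ae2; exact: aeS ae2.
exists (sigma 0%N), (sign_changes c sigma m); split => //.
- apply/allP => x xs; rewrite (allP (sign_changes_ge c sigma m))//=.
  by rewrite (le_trans (allP (sign_changes_bound c sigma m) _ xs))// lerD2l ler_nat.
- apply: le_trans (size_sign_changes c adj E0) _; rewrite big_split/= mulr2n mulrDl mul1r.
  apply: lerD; apply: le_trans sumE.
    by rewrite big_ord_recr/= lerDl.
  by rewrite big_ord_recl/= lerDr.
move=> e e0 e1; set kap := alpha * _; set K := delta^-1 + _.
have kap0 : 0 < kap by rewrite mulr_gt0// lt_min b0 exprn_gt0.
have K0 : 0 <= K by rewrite addr_ge0// invr_ge0 ltW.
set w := pwc _ _.
have msub A : measurable A -> A `<=` `[c, c + m.+1%:R] ->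
    measurable [set t | A t /\ e < `|z 0%N t - w t|].
  move=> mA AD; apply: (@measurable_superlevel _ A (z 0%N \- w)) => //.
  apply: measurable_funB; last exact: measurable_pwc.
  by apply: mzA => //; exact: subset_trans cD.
have half i : (i < m.+1)%N -> `[c + i%:R, c + i.+1%:R[ `<=` `[c + i%:R, c + i%:R + 1].
  by move=> im t; rewrite /= !in_itv/= -addrA natr1 => /andP[-> /ltW].
have onecell i : (i < m.+1)%N ->
    (mu [set t | `[(c + i%:R)%R, (c + i.+1%:R)%R[%classic t /\ (e < `|z 0%N t - w t|)%R] <= (E i * K)%:E)%E.
  move=> im; have mI := msub _ (measurable_itv `[c + i%:R, c + i.+1%:R[)
    (subset_trans (half i im) (cell i im)).
  have [bad|good] := ltP delta (E i).
    apply: (@le_trans _ _ (mu `[c + i%:R, c + i.+1%:R[%classic)).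
      by apply: le_measure; rewrite ?inE// => t [].
    rewrite lebesgue_measure_itv/= lte_fin ltrD2l ltr_nat ltnSn -EFinD lee_fin.
    have -> : c + i.+1%:R - (c + i%:R) = 1 by rewrite -natr1; ring.
    apply: (@le_trans _ _ (E i * delta^-1)); first by rewrite ler_pdivlMr// mul1r ltW.
    by rewrite ler_wpM2l// lerDl invr_ge0 ltW.
  have mO : measurable (off_wells `[c + i%:R, c + i%:R + 1] (z 0%N) e).
    by apply: measurable_off_wells => //; apply: mzA => //; exact: subset_trans (cell i im) cD.
  have [_ /(_ im good)[N [mN N0 hN]]] := hsig i.
  apply: (@le_trans _ _ (mu (off_wells `[c + i%:R, c + i%:R + 1] (z 0%N) e `|` N))).
    apply: le_measure; rewrite ?inE//; first exact: measurableU.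
    move=> t [ti ht]; have [Nt|Nt] := pselect (N t); [by right|left].
    have pos : 0 < sigma i * z 0%N t.
      apply: contrapT => h; apply: Nt; apply: hN => /= /(_ (half i im t ti)).
      exact: h.
    have wt : w t = sigma i.
      move: ti; rewrite /= in_itv/= => /andP[t1 t2].
      by apply: pwc_sign_changes => //; left.
    split; first exact: half.
    (* Having the sign of the cell puts the point at distance more than 1 >= e from the opposite
       well, so a point far from its own well is off both wells. *)
    move: ht pos; rewrite wt; case: (hs i) => ->; rewrite ?mul1r ?mulN1r ?opprK => ht pos.
      by split=> //; rewrite gtr0_norm ?addr_gt0//; lra.
    split=> //; rewrite ltr0_norm; last by lra.
    by lra.
  rewrite (@measureU0 _ _ _ mu)//.
  have := off_wells_measure cW W0 hW a0 b0 e0 (measurable_itv `[c + i%:R, c + i%:R + 1])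
    (mzA 0%N _ isT (measurable_itv _) (subset_trans (cell i im) cD)).
  rewrite -/kap => h.
  have : (kap%:E * mu (off_wells `[(c + i%:R)%R, (c + i%:R + 1)%R] (z 0%N) e) <= (E i)%:E)%E.
    apply: (le_trans h); rewrite -EE//; apply: ge0_le_integral => //.
    - by move=> t _; rewrite lee_fin.
    - apply/measurable_EFinP; apply: measurableT_comp.
        exact: continuous_measurable_fun.
      by apply: mzA => //; exact: subset_trans (cell i im) cD.
    - by apply: mf => //; exact: subset_trans (cell i im) cD.
    - by move=> t _; rewrite lee_fin lerDl sqr_ge0.
  rewrite -lee_pdivlMl// => /le_trans; apply; rewrite -EFinM lee_fin mulrC ler_wpM2l//.
  by rewrite lerDr invr_ge0 ltW.
have all j : (j <= m.+1)%N ->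
    (mu [set t | `[c, (c + j%:R)%R[%classic t /\ (e < `|z 0%N t - w t|)%R] <=
     ((\sum_(i < j) E i) * K)%:E)%E.
  elim: j => [|j ih] jm.
    rewrite big_ord0 mul0r (_ : [set _ | _] = set0) ?measure0//.
    apply/seteqP; split => // t [/=]; rewrite in_itv/= addr0 => /andP[h1 h2].
    by move: (le_lt_trans h1 h2); rewrite ltxx.
  have jsub : `[c, c + j%:R[ `<=` `[c, c + m.+1%:R].
    move=> t; rewrite /= !in_itv/= => /andP[-> /ltW/le_trans]; apply.
    by rewrite lerD2l ler_nat ltnW.
  have m1 := msub _ (measurable_itv `[c, c + j%:R[) jsub.
  have m2 := msub _ (measurable_itv `[c + j%:R, c + j.+1%:R[) (subset_trans (half j jm) (cell j jm)).
  have -> : [set t | `[c, (c + j.+1%:R)%R[%classic t /\ (e < `|z 0%N t - w t|)%R] =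
     [set t | `[c, (c + j%:R)%R[%classic t /\ (e < `|z 0%N t - w t|)%R] `|`
     [set t | `[(c + j%:R)%R, (c + j.+1%:R)%R[%classic t /\ (e < `|z 0%N t - w t|)%R].
    apply/seteqP; split=> t /=; rewrite !in_itv/=.
      move=> [/andP[-> ->] h]; rewrite andbT.
      by case: (ltP t (c + j%:R)) => _; [left|right].
    case=> [[/andP[-> h1] ->]|[/andP[h1 ->] ->]]; split => //.
      by rewrite (lt_trans h1)// ltrD2l ltr_nat.
    by rewrite andbT (le_trans _ h1)// lerDl.
  apply: (le_trans (@measureU2 _ _ _ mu _ _ m1 m2)); rewrite big_ord_recr/= mulrDl EFinD.
  by apply: leeD; [exact: ih (ltnW jm)|exact: onecell].
by apply: (le_trans (all _ (leqnn _))); rewrite lee_fin ler_wpM2r.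
Qed.

End piecewise_constant_approximation.

(** * Compactness of bounded lists of jumps *)

Section compactness.
Context {R : realType}.
Implicit Types (D A : set R) (z : nat -> R -> R) (a b c d e s t x eps M delta : R) (k n m i j N : nat)
  (W u : R -> R) (xs ys : seq R).
Local Notation mu := (@lebesgue_measure R).

(** Induction through the Jordan decomposition of the tail: a nondecreasing function stays
    nondecreasing when its value at [a] is subtracted and it is then set to 0 before x. The
    remaining jump at x is split into positive and negative parts. *)
Lemma bounded_variation_pwc a b s xs : a < b ->
  exists v, bounded_variation a b v /\ forall t, a <= t <= b -> pwc s xs t = v t.
Proof.
move=> ab; elim: xs s => [|x xs ih] s.
  by exists (cst s); split=> //; apply: nondecreasing_bounded_variation => ? ? _ _ _.
have [v [bv hv]] := ih (- s).
pose f := fine \o pos_tv a v; pose g := fine \o neg_tv a v.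
have vE : {in `[a, b], v =1 f \- g} := bounded_variation_pos_neg_tvE bv.
have ndg : {in `[a, b] &, {homo g : s t / s <= t}} := fine_neg_tv_nondecreasing bv.
have ndf : {in `[a, b] &, {homo f : s t / s <= t}}.
  exact: (fine_neg_tv_nondecreasing (bounded_variationN bv)).
have cut (h : R -> R) : {in `[a, b] &, {homo h : s t / s <= t}} ->
    bounded_variation a b (fun t => if t < x then 0 else h t - h a).
  move=> nd; apply: nondecreasing_bounded_variation => p q pab qab pq.
  have ha p' : p' \in `[a, b] -> 0 <= h p' - h a.
    move=> pab'; rewrite subr_ge0; apply: nd => //; first by rewrite in_itv/= lexx ltW.
    by move: pab'; rewrite in_itv/= => /andP[].
  case: (ltP p x) => px; case: (ltP q x) => qx //; first exact: ha.
    by move: (lt_le_trans qx px); rewrite ltNge pq.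
  by rewrite lerD2r nd.
have step (c : R) : 0 <= c -> bounded_variation a b (fun t => if t < x then 0 else c).
  move=> c0; apply: nondecreasing_bounded_variation => p q pab qab pq.
  case: (ltP p x) => px; case: (ltP q x) => qx //.
  by move: (lt_le_trans qx px); rewrite ltNge pq.
have BVD (h1 h2 : R -> R) : bounded_variation a b h1 -> bounded_variation a b h2 ->
  bounded_variation a b (fun t => h1 t + h2 t) by exact: bounded_variationD.
have BVN (h : R -> R) : bounded_variation a b h -> bounded_variation a b (fun t => - h t).
  by exact: bounded_variationN.
(* The height that restores, after x, the values subtracted at [a] and the constant s. *)
pose c := f a - g a - s.
pose w t := ((if t < x then 0 else f t - f a) + - (if t < x then 0 else g t - g a)) +
  ((if t < x then 0 else Num.max c 0) + - (if t < x then 0 else Num.max (- c) 0)) + s.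
exists w; split.
  apply: (BVD); last by apply: nondecreasing_bounded_variation => ? ? _ _ _.
  apply: (BVD); apply: (BVD).
  - exact: cut.
  - by apply: (BVN); exact: cut.
  - by apply: step; rewrite le_max lexx orbT.
  - by apply: (BVN); apply: step; rewrite le_max lexx orbT.
move=> t tab; rewrite /w /=; case: (ltP t x) => tx; first by rewrite !subrr !add0r.
rewrite hv// vE//=; have -> : Num.max c 0 - Num.max (- c) 0 = c.
  by case: (leP c 0) => hc; [rewrite max_l ?oppr_ge0// sub0r opprK|rewrite max_r ?subr0// oppr_le0 ltW].
by rewrite /c; ring.
Qed.

Lemma BV_pm1_of_pwc a b s xs : a < b -> s = 1 \/ s = -1 -> BV_pm1 a b (pwc s xs).
Proof.
move=> ab hs; split.
- exact: measurable_pwc.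
- have [v [bv hv]] := bounded_variation_pwc s xs ab; exists v; split => //.
  apply: aeW => t; rewrite in_itv/= => /andP[h1 h2].
  by apply: hv; rewrite !ltW.
- by apply: aeW => t _; exact: pwc_pm1.
Qed.

Lemma increasing_seq_ge (f : nat -> nat) j : increasing_seq f -> (j <= f j)%N.
Proof.
move=> fi; elim: j => // j; have := fi j.+1 j; rewrite leEnat ltnn => /negbT.
by rewrite -ltnNge => g1 /leq_ltn_trans; exact.
Qed.

Lemma cvg_infty_ge_id (f : nat -> nat) : (forall j, (j <= f j)%N) -> f @ \oo --> \oo.
Proof.
move=> fj; apply/cvgnyPge => n; near=> j.
by rewrite (leq_trans _ (fj j))//; near: j; exact: nbhs_infty_ge.
Unshelve. all: by end_near. Qed.

Lemma bolzano_weierstrass_seq N (xs : nat -> seq R) (B : R) :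
  (forall j, size (xs j) = N) -> (forall j, all (fun x => `|x| <= B) (xs j)) ->
  exists2 f : nat -> nat, increasing_seq f & exists2 ys, size ys = N &
    forall delta, 0 < delta ->
      \forall j \near \oo, all2 (fun x y => `|x - y| <= delta) (xs (f j)) ys.
Proof.
elim: N xs => [|N ih] xs hsz hB.
  exists id; first by move=> i j.
  exists [::] => // delta _; apply: nearW => j.
  by have := hsz j; case: (xs j).
have xsE j : xs j = head 0 (xs j) :: behead (xs j) by have := hsz j; case: (xs j).
have bnd : bounded_fun (fun j => head 0 (xs j)).
  exists B; split; first exact: num_real.
  move=> M BM j _ /=; have := hB j; rewrite (xsE j)/= => /andP[h _].
  exact: le_trans h (ltW BM).
have [f fi /cvg_ex[/= y hy]] := bolzano_weierstrass bnd.
have [||g gi [ys ysz hys]] := ih (fun j => behead (xs (f j))).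
- by move=> j; rewrite size_behead hsz.
- by move=> j; have := hB (f j); rewrite (xsE (f j))/= => /andP[].
exists (f \o g); first by move=> i j /=; rewrite fi; exact: gi.
exists (y :: ys) => [/=|delta d0]; first by rewrite ysz.
have h1 : \forall j \near \oo, `|head 0 (xs (f j)) - y| <= delta.
  by move/cvgrPdist_le : hy => /(_ _ d0); apply: filterS => j; rewrite distrC.
have h2 : \forall j \near \oo, `|head 0 (xs (f (g j))) - y| <= delta.
  have [n _ hn] := h1; exists n => // j /= nj; apply: hn => /=.
  exact: leq_trans nj (increasing_seq_ge j gi).
move: h2 (hys _ d0); apply: filterS2 => j h2 h3.
by rewrite /= (xsE (f (g j)))/= h2.
Qed.

(** Outside the segment of radius [delta] about the first jump, both functions are on the same side
    of it, and the comparison passes to the tails. Each jump thus costs at most 2 delta. *)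
Lemma pwc_diff_measure s delta xs ys : 0 <= delta ->
  all2 (fun x y => `|x - y| <= delta) xs ys ->
  (mu [set t | setT t /\ (0 < `|pwc s xs t - pwc s ys t|)%R] <=
   ((size ys)%:R * (2 * delta))%:E)%E.
Proof.
move=> d0; elim: xs ys s => [|x xs ih] [|y ys] s //.
  move=> _; rewrite mul0r (_ : [set _ | _] = set0) ?measure0//.
  by apply/seteqP; split => // t [_] /=; rewrite subrr normr0 ltxx.
move=> /= /andP[xy hall]; have {}ih := ih _ (- s) hall.
have mS s' xs' ys' : measurable [set t | setT t /\ 0 < `|pwc s' xs' t - pwc s' ys' t|].
  apply: (@measurable_superlevel _ setT (pwc s' xs' \- pwc s' ys')) => //.
  by apply: measurable_funB; exact: measurable_pwc.
have ml : (mu `[(y - delta)%R, (y + delta)%R]%classic <= (2 * delta)%:E)%E.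
  rewrite lebesgue_measure_itv/=; case: ifP => _; rewrite ?lee_fin ?mulr_ge0//.
  by lra.
apply: (@le_trans _ _ (mu (`[y - delta, y + delta] `|`
    [set t | setT t /\ 0 < `|pwc (- s) xs t - pwc (- s) ys t|]))).
  apply: le_measure; rewrite ?inE.
  - exact: (mS s (x :: xs) (y :: ys)).
  - by apply: measurableU => //; exact: mS.
  - move=> t [_ ht].
    have [tin|tout] := pselect (`[y - delta, y + delta]%classic t); [by left|right].
    split=> //; move: ht.
    have [h1 h2] : - delta <= x - y /\ x - y <= delta.
      by move: xy; rewrite ler_norml => /andP[].
    case: (ltP t x) => tx; case: (ltP t y) => ty //; first by rewrite subrr normr0 ltxx.
      by exfalso; apply: tout; rewrite /= in_itv/=; apply/andP; split; lra.
    by exfalso; apply: tout; rewrite /= in_itv/=; apply/andP; split; lra.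
apply: (le_trans (@measureU2 _ _ _ mu _ _ (measurable_itv _) (mS _ _ _))).
rewrite -nat1r mulrDl mul1r EFinD; apply: leeD; last exact: ih.
exact: ml.
Qed.

(* A jump at a encodes the initial sign -1, and jumps at b are padding; lists of fixed length
   have convergent subsequences. *)
Lemma pwc_normalize a b s xs N : s = 1 \/ s = -1 -> all (fun x => a <= x <= b) xs -> a <= b ->
  (size xs <= N)%N -> exists ys, [/\ size ys = N.+1, all (fun x => a <= x <= b) ys &
    forall t, a < t < b -> pwc s xs t = pwc 1 ys t].
Proof.
move=> hs xab ab xN.
have pad s' n t : t < b -> pwc s' (xs ++ nseq n b) t = pwc s' xs t.
  move=> tb; elim: (xs) s' => [|x xs' ih] s' /=; last by case: ifP.
  by case: n => //= n; rewrite tb.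
have nab n : all (fun x => a <= x <= b) (nseq n b).
  by apply/allP => x /nseqP[-> _]; rewrite ab lexx.
case: hs => ->.
  exists (xs ++ nseq (N.+1 - size xs) b); split.
  - by rewrite size_cat size_nseq subnKC// leqW.
  - by rewrite all_cat xab nab.
  - by move=> t /andP[_ tb]; rewrite pad.
exists (a :: xs ++ nseq (N - size xs) b); split.
- by rewrite /= size_cat size_nseq subnKC.
- by rewrite /= lexx ab all_cat xab nab.
- by move=> t /andP[at' tb] /=; rewrite ltNge (ltW at')/= pad.
Qed.

Lemma pwc_affine c d s xs t : 0 < c -> pwc s (map (affine c d) xs) (affine c d t) = pwc s xs t.
Proof.
move=> c0; elim: xs s => [//|x xs ih] s /=; rewrite ih.
by rewrite /affine ltrD2r ltr_pM2l.
Qed.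

(** The blow-up by eps turns ]a, b[ into an interval of length L = (b - a) / eps. Full cells fill it
    except for a length 1 at the left and at most 2 at the right, which accounts for the term 3
    eps. *)
Lemma pwc_approximation W alpha beta k a b : (0 < k)%N -> continuous W -> (forall x, 0 <= W x) ->
  double_well W alpha beta -> 0 < alpha -> 0 < beta -> a < b ->
  exists2 delta : R, 0 < delta & forall M, 0 <= M -> exists N, forall eps u, 0 < eps ->
    3 * eps <= b - a -> sobolevH `]a, b[ k u -> (F_eps k W a b eps u <= M%:E)%E ->
    exists ys, [/\ size ys = N, all (fun x => a <= x <= b) ys & forall e, 0 < e -> e <= 1 ->
    (mu [set t | (t \in `]a, b[) /\ (e < `|u t - pwc 1 ys t|)%R] <=
     (eps * (M * (delta^-1 + (alpha * Num.min (e ^+ 2) beta)^-1) + 3))%:E)%E].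
Proof.
move=> k0 cW W0 hW a0 b0 ab.
have [delta dl0 H] := cells_pwc k0 cW W0 hW a0 b0.
(* At most 2M / delta sign changes occur; one more entry is reserved for encoding the initial
   sign. *)
exists delta => // M M0; pose N := Num.truncn (2 * M / delta).
exists N.+1 => eps u eps0 eab hu hF.
have oab : open (`]a, b[%classic : set R) by exact: itv_open.
have [z cz zu] := sobolevH_weak_chain oab hu.
have eps1 : eps != 0 by rewrite gt_eqF.
pose T := affine eps a; pose D := T @^-1` `]a, b[.
have oD : open D by exact: open_preimage_affine.
pose v := rescale eps a z.
have cv : weak_chain D k v by exact: weak_chain_affine.
pose L := (b - a) / eps.
have L3 : 3 <= L by rewrite ler_pdivlMr.
have DE t : D t <-> 0 < t < L.
  rewrite /D /T /affine /= in_itv/= /L ltr_pdivlMr// ltrDr pmulr_rgt0//.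
  by rewrite -ltrBrDr mulrC.
(* Two less than the integer part of [L], so that [1, 1 + n] lies strictly inside the open interval,
   where the chain is defined. *)
have [n n1 n2] : exists2 n : nat, 1 + n%:R < L & L <= n%:R + 3.
  have L0 : 0 <= L by apply: le_trans L3.
  have h1 : (Num.truncn L)%:R <= L by rewrite truncn_le.
  have h2 := truncnS_gt L.
  exists (Num.truncn L - 2)%N.
    have : (2 <= Num.truncn L)%N by rewrite -ltnS -(ltr_nat R) (le_lt_trans _ h2)// (le_trans _ L3)// ler_nat.
    move=> h3; rewrite natrB//; lra.
  have : (Num.truncn L)%:R <= (Num.truncn L - 2)%:R + 2 :> R.
    by rewrite -natrD ler_nat addnC -leq_subLR.
  by move: h2; rewrite -natr1; lra.
have sD : `[1, 1 + n%:R] `<=` D.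
  move=> t; rewrite /= in_itv/= => /andP[t1 t2]; apply/DE.
  by rewrite (lt_le_trans _ t1)//= (le_lt_trans t2).
have hE : (energy W k `[1%R, (1 + n%:R)%R] v <= M%:E)%E.
  apply: (@le_trans _ _ (energy W k D v)).
    apply: ge0_subset_integral => //.
    - exact: open_measurable.
    - have := @measurable_energy_density R W k D D v 1 1 oD (open_measurable oD) (@subset_refl _ _) cv cW.
      by apply: eq_measurable_fun => t _; rewrite !mul1r.
    - by move=> t _; rewrite lee_fin addr_ge0// sqr_ge0.
  rewrite (rescale_energy a oab cz cW W0 k0 eps0 erefl)//.
  by rewrite -(F_eps_energy cW W0 eps0 hu cz zu).
have [s [xs [hs hxs szx hm]]] := H D v 1 n M oD cv sD hE.
have szN : (size xs <= N)%N.
  have h : (size xs)%:R <= 2 * M / delta by rewrite ler_pdivlMr.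
  by rewrite /N truncn_ge_nat// (le_trans _ h).
have xab : all (fun x => a <= x <= b) (map T xs).
  apply/allP => x /mapP[y /(allP hxs)/andP[y1 y2] ->].
  have /DE/andP[] : D y by apply: sD; rewrite /= in_itv/= y1.
  move=> /ltW g1 /ltW; rewrite /L ler_pdivlMr// mulrC /T /affine => g2; apply/andP; split.
    by rewrite lerDr mulr_ge0// ltW.
  by rewrite -lerBrDr.
have [|ys [ysz yab ypwc]] := @pwc_normalize a b s (map T xs) N hs xab (ltW ab).
  by rewrite size_map.
exists ys; split => // e e0 e1.
set K := _ + _^-1 in hm *.
set S := [set t | _].
have mS : measurable S.
  have m1 : measurable_fun `]a, b[%classic (u \- pwc 1 ys).
    apply: measurable_funB; last exact: measurable_pwc.
    have [lz _] := cz; have [m _] := lz 0%N (leq0n k).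
    by rewrite -zu; apply: measurable_funS m.
  by have := @measurable_superlevel _ `]a, b[%classic _ e (measurable_itv _) m1.
have mv : measurable [set t | `[1, 1 + n%:R[%classic t /\ e < `|v 0%N t - pwc s xs t|].
  apply: (@measurable_superlevel _ `[1, 1 + n%:R[%classic (v 0%N \- pwc s xs)) => //.
  apply: measurable_funB; last exact: measurable_pwc.
  have [lv _] := cv; have [m _] := lv 0%N (leq0n k).
  apply: measurable_funS m => //; first exact: open_measurable.
  by apply: subset_trans sD => t; rewrite /= !in_itv/= => /andP[-> /ltW].
have -> : (mu S = eps%:E * mu (T @^-1` S))%E.
  rewrite lebesgue_measure_affine// gtr0_norm// muleA -EFinM mulfV//.
  by rewrite mul1e.
rewrite EFinM; apply: lee_wpmul2l; first by rewrite lee_fin ltW.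
apply: (@le_trans _ _ (mu ([set t | `[1, (1 + n%:R)%R[%classic t /\ (e < `|v 0%N t - pwc s xs t|)%R]
    `|` (`[0%R, 1%R] `|` `[(1 + n%:R)%R, L]%classic)))).
  apply: le_measure; rewrite ?inE.
  - exact: measurable_preimage_affine.
  - by apply: measurableU => //; exact: measurableU.
  - move=> t [Tt ht]; have Tab : a < T t < b by move: Tt; rewrite in_itv.
    have /DE/andP[t0 tL] : D t by [].
    have [t1|t1] := leP t 1; first by right; left; rewrite /= in_itv/= ltW.
    have [t2|t2] := ltP t (1 + n%:R); last by right; right; rewrite /= in_itv/= t2 ltW.
    left; split; first by rewrite /= in_itv/= (ltW t1).
    rewrite /v /rescale expr0 mul1r zu -(pwc_affine a s xs t eps0) -/T ypwc//.
have l01 : (mu `[0%R, 1%R]%classic <= 1%:E)%E.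
  by rewrite lebesgue_measure_itv/= lte_fin ltr01 oppr0 adde0.
have lL : (mu `[(1 + n%:R)%R, L]%classic <= 2%:E)%E.
  by rewrite lebesgue_measure_itv/= lte_fin n1 -EFinD lee_fin; lra.
have m01 : measurable (`[0, 1] : set R) by exact: measurable_itv.
have mL : measurable `[1 + n%:R, L]%classic by exact: measurable_itv.
apply: (le_trans (@measureU2 _ _ _ mu _ _ mv (measurableU _ _ m01 mL))).
rewrite EFinD; apply: leeD; first exact: hm.
apply: (le_trans (@measureU2 _ _ _ mu _ _ m01 mL)).
have -> : 3%:E = (1%:E + 2%:E)%E :> \bar R by rewrite -EFinD -natr1 addrC.
by apply: leeD; [exact: l01|exact: lL].
Qed.

End compactness.

(** * Convergent subsequences, and the lower bound outside BV *)

Section equicoercivity.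
Context {R : realType}.
Implicit Types (a b c e eps M : R) (k n j : nat) (W u v w : R -> R) (xs ys : seq R).
Local Notation mu := (@lebesgue_measure R).

Lemma cvge0P (I : Type) (G : set_system I) {FG : Filter G} (f : I -> \bar R) :
  (forall i, (0 <= f i)%E) ->
  (forall e, 0 < e -> \forall i \near G, (f i <= e%:E)%E) <-> f i @[i --> G] --> 0%E.
Proof.
move=> f0; split=> [h|h e e0].
  apply/fine_cvgP; split.
    move: (h 1 ltr01); apply: filterS => i fi.
    by rewrite ge0_fin_numE// (le_lt_trans fi)// ltry.
  apply/cvgrPdist_le => e e0; move: (h e e0); apply: filterS => i fi.
  have fin : f i \is a fin_num by rewrite ge0_fin_numE// (le_lt_trans fi)// ltry.
  by rewrite /= sub0r normrN ger0_norm ?fine_ge0// -lee_fin fineK.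
have e0' : (0 < e%:E)%E by rewrite lte_fin.
have h1 : \forall i \near G, (f i < e%:E)%E := h _ (open_ereal_lt' e0').
by move: h1; apply: filterS => i /ltW.
Qed.

Lemma measurable_bad_set a b e u v : measurable_fun `]a, b[ u -> measurable_fun `]a, b[ v ->
  measurable [set t | (t \in `]a, b[) /\ e < `|u t - v t|].
Proof.
move=> hu hv; have m1 : measurable_fun `]a, b[%classic (u \- v) by exact: measurable_funB.
by have := @measurable_superlevel _ `]a, b[%classic _ e (measurable_itv _) m1.
Qed.

(** By the triangle inequality the set where |u - w| > e is covered by the two exceptional sets at
    level e / 2, so it is null; the levels 1 / (n + 1) exhaust the set where u and w differ. *)
Lemma cvg_in_measure_ae_unique a b (u_ : nat -> R -> R) u w :
  (forall j, measurable_fun `]a, b[ (u_ j)) -> measurable_fun `]a, b[ u -> measurable_fun `]a, b[ w ->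
  cvg_in_measure \oo a b u_ u -> cvg_in_measure \oo a b u_ w ->
  {ae mu, forall t, t \in `]a, b[ -> u t = w t}.
Proof.
move=> mu_ hu hw cu cw.
have null e : 0 < e -> mu [set t | (t \in `]a, b[) /\ (e < `|u t - w t|)%R] = 0%E.
  move=> e0; have e2 : 0 < e / 2 by rewrite divr_gt0.
  apply/eqP; rewrite -measure_le0; apply/lee_addgt0Pr => d d0; rewrite add0e.
  have d2 : 0 < d / 2 by rewrite divr_gt0.
  have h1 := (@cvge0P _ _ (@filter_filter _ _ eventually_filter) _ (fun j => measure_ge0 mu _)).2 (cu _ e2) _ d2.
  have h2 := (@cvge0P _ _ (@filter_filter _ _ eventually_filter) _ (fun j => measure_ge0 mu _)).2 (cw _ e2) _ d2.
  have [j [j1 j2]] := filter_ex (filterI h1 h2).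
  have m1 := measurable_bad_set (e / 2) (mu_ j) hu.
  have m2 := measurable_bad_set (e / 2) (mu_ j) hw.
  rewrite [d]splitr EFinD; apply: le_trans (leeD j1 j2).
  apply: le_trans (@measureU2 _ _ _ mu _ _ m1 m2).
  apply: le_measure; rewrite ?inE; [exact: measurable_bad_set|exact: measurableU|].
  move=> t [tab ht]; apply: contrapT => no.
  have g1 : `|u_ j t - u t| <= e / 2.
    by rewrite leNgt; apply/negP => h; apply: no; left.
  have g2 : `|u_ j t - w t| <= e / 2.
    by rewrite leNgt; apply/negP => h; apply: no; right.
  have := ler_distD (u_ j t) (u t) (w t); rewrite [`|u t - u_ j t|]distrC => g3.
  by move: ht; rewrite ltNge (le_trans g3)// [leRHS]splitr lerD.
have : mu.-negligible (\bigcup_n [set t | (t \in `]a, b[) /\ n.+1%:R^-1 < `|u t - w t|]).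
  apply: negligible_bigcup => n; exists [set t | (t \in `]a, b[) /\ n.+1%:R^-1 < `|u t - w t|].
  by split; [exact: measurable_bad_set|apply: null; rewrite invr_gt0|].
move=> [N [mN N0 hN]]; exists N; split => // t /= ht; apply: hN.
have [tab ne] : (t \in `]a, b[) /\ u t <> w t.
  by split; [apply: contrapT => h; apply: ht => /h|move=> h; apply: ht].
have pos : 0 < `|u t - w t| by rewrite normr_gt0 subr_eq0; exact/eqP.
exists (Num.truncn (`|u t - w t|^-1)) => //; split => //=.
by rewrite invf_plt ?posrE// truncnS_gt.
Qed.

Lemma cvg_in_measure_subseq a b (u_ : nat -> R -> R) u (f : nat -> nat) :
  f @ \oo --> \oo -> cvg_in_measure \oo a b u_ u -> cvg_in_measure \oo a b (u_ \o f) u.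
Proof.
move=> fy cu e e0.
exact: (@cvg_comp _ _ _ f (fun j => mu [set t | (t \in `]a, b[) /\ (e < `|u_ j t - u t|)%R])
  _ _ _ fy (cu e e0)).
Qed.

Lemma BV_pm1_ae_eq a b u w : measurable_fun `]a, b[ u ->
  {ae mu, forall t, t \in `]a, b[ -> u t = w t} -> BV_pm1 a b w -> BV_pm1 a b u.
Proof.
move=> hu uw [_ [v [bv wv]] wpm]; split => //.
  exists v; split => //; move: uw wv; apply: filterS2; first exact: (ae_filter_ringOfSetsType mu).
  by move=> t h1 h2 tab; rewrite h1// h2.
move: uw wpm; apply: filterS2; first exact: (ae_filter_ringOfSetsType mu).
by move=> t h1 h2 tab; rewrite h1//; exact: h2.
Qed.

Lemma sobolevH_measurable a b k u : sobolevH `]a, b[ k u -> measurable_fun `]a, b[ u.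
Proof. by move=> [[]]. Qed.

Lemma F_eps_ge0 W k a b eps u : (forall x, 0 <= W x) -> 0 < eps ->
  (0 <= F_eps k W a b eps u)%E.
Proof.
move=> W0 e0; rewrite /F_eps; case: ifP => _; last exact: leey.
apply: integral_ge0 => t _; rewrite lee_fin; apply: addr_ge0; apply: mulr_ge0 => //.
- by rewrite invr_ge0 ltW.
- by rewrite exprn_ge0// ltW.
- exact: sqr_ge0.
Qed.

Lemma F_eps_equicoercive W alpha beta k a b (eps : nat -> R) (u_ : nat -> R -> R) M :
  (0 < k)%N -> continuous W -> (forall x, 0 <= W x) ->
  double_well W alpha beta -> 0 < alpha -> 0 < beta -> a < b ->
  (forall j, 0 < eps j) -> eps @ \oo --> (0 : R) ->
  (forall j, sobolevH `]a, b[ k (u_ j)) -> (forall j, (F_eps k W a b (eps j) (u_ j) <= M%:E)%E) ->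
  exists w, BV_pm1 a b w /\ exists2 f : nat -> nat, increasing_seq f &
    cvg_in_measure \oo a b (fun j => u_ (f j)) w.
Proof.
move=> k0 cW W0 hW a0 b0 ab eps0 epsc hu hF.
have M0 : 0 <= M.
  rewrite -lee_fin; apply: le_trans (hF 0%N).
  exact: F_eps_ge0.
have [delta dl0 /(_ M M0)[N H]] := pwc_approximation k0 cW W0 hW a0 b0 ab.
pose K e := M * (delta^-1 + (alpha * Num.min (e ^+ 2) beta)^-1) + 3.
have /choice[xs hxs] j : exists ys, [/\ size ys = N, all (fun x => a <= x <= b) ys &
    3 * eps j <= b - a -> forall e, 0 < e -> e <= 1 ->
    (mu [set t | (t \in `]a, b[) /\ (e < `|u_ j t - pwc 1 ys t|)%R] <= (eps j * K e)%:E)%E].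
  have [h|h] := leP (3 * eps j) (b - a).
    by have [ys [y1 y2 y3]] := H (eps j) (u_ j) (eps0 j) h (hu j) (hF j); exists ys; split.
  (* A placeholder for the finitely many indices at which eps is too large for the approximation. *)
  exists (nseq N a); split; first by rewrite size_nseq.
    by apply/allP => x /nseqP[-> _]; rewrite lexx ltW.
  by [].
have [||f fi [ys ysz hys]] := @bolzano_weierstrass_seq R N xs (`|a| + `|b|).
- by move=> j; have [] := hxs j.
- move=> j; have [_ h _] := hxs j; apply: sub_all h => x /andP[h1 h2].
  have := ler_norm b; have := ler_norm (- a); rewrite normrN => g1 g2.
  have g3 := normr_ge0 a; have g4 := normr_ge0 b.
  by rewrite ler_norml; apply/andP; split; lra.
have fy : f @ \oo --> \oo by apply: cvg_infty_ge_id => j; exact: increasing_seq_ge.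
have epsf : (eps \o f) @ \oo --> (0 : R) by exact: cvg_comp epsc.
exists (pwc 1 ys); split; first by apply: BV_pm1_of_pwc => //; left.
exists f => // e e0; apply/cvge0P => // rho rho0.
(* The approximation is available for tolerances up to 1; a smaller tolerance only enlarges the
   exceptional set. *)
pose e' := Num.min e 1; have e'0 : 0 < e' by rewrite lt_min e0 ltr01.
have e'1 : e' <= 1 by rewrite /e' ge_min lexx orbT.
have kap0 : 0 < alpha * Num.min (e' ^+ 2) beta by rewrite mulr_gt0// lt_min b0 exprn_gt0.
have K0 : 0 < K e'.
  by rewrite /K ltr_wpDl// mulr_ge0// addr_ge0// invr_ge0 ltW.
(* Moving the [N] jumps by at most [d] costs N times 2d, at most rho / 2. *)
pose d := rho / (4 * (N%:R + 1)).
have N1 : 0 < 4 * (N%:R + 1) :> R by rewrite mulr_gt0// ltr_wpDl.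
have d0 : 0 < d by rewrite divr_gt0.
have Nd : N%:R * (2 * d) <= rho / 2.
  have -> : rho / 2 = (N%:R + 1) * (2 * d) by rewrite /d; field; rewrite gt_eqF// ltr_wpDl.
  by rewrite ler_pM2r ?mulr_gt0// lerDl.
have ba : 0 < (b - a) / 3 by rewrite divr_gt0// subr_gt0.
have rK : 0 < rho / 2 / K e' by rewrite !divr_gt0.
have n1 : \forall j \near \oo, eps (f j) <= (b - a) / 3.
  move/cvgrPdist_le : epsf => /(_ _ ba); apply: filterS => j.
  by rewrite sub0r normrN /=; apply: le_trans; exact: ler_norm.
have n2 : \forall j \near \oo, eps (f j) <= rho / 2 / K e'.
  move/cvgrPdist_le : epsf => /(_ _ rK); apply: filterS => j.
  by rewrite sub0r normrN /=; apply: le_trans; exact: ler_norm.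
move: n1 n2 (hys _ d0); apply: filterS3 => j j1 j2 j3.
have [_ _ /(_ _ _ e'0 e'1)] := hxs (f j).
have -> : (3 * eps (f j) <= b - a) by move: j1; rewrite ler_pdivlMr// mulrC.
move=> /(_ isT) hm.
have mdiff : measurable [set t | setT t /\ 0 < `|pwc 1 (xs (f j)) t - pwc 1 ys t|].
  apply: (@measurable_superlevel _ setT (pwc 1 (xs (f j)) \- pwc 1 ys)) => //.
  by apply: measurable_funB; exact: measurable_pwc.
have mw := @measurable_pwc R 1 (xs (f j)) `]a, b[%classic.
have mw' := @measurable_pwc R 1 ys `]a, b[%classic.
have muj := sobolevH_measurable (hu (f j)).
have m1 := measurable_bad_set e' muj mw.
apply: (@le_trans _ _ (mu ([set t | (t \in `]a, b[) /\ (e' < `|u_ (f j) t - pwc 1 (xs (f j)) t|)%R] `|`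
   [set t | setT t /\ (0 < `|pwc 1 (xs (f j)) t - pwc 1 ys t|)%R]))).
  apply: le_measure; rewrite ?inE; [exact: measurable_bad_set|exact: measurableU|].
  move=> t [tab ht]; have [eq|ne] := eqVneq (pwc 1 (xs (f j)) t) (pwc 1 ys t).
    by left; split => //; rewrite eq (le_lt_trans _ ht)// /e' ge_min lexx.
  by right; split => //; rewrite normr_gt0 subr_eq0.
apply: (le_trans (@measureU2 _ _ _ mu _ _ m1 mdiff)).
rewrite [rho]splitr EFinD; apply: leeD.
  by apply: (le_trans hm); rewrite lee_fin -ler_pdivlMr.
apply: (le_trans (pwc_diff_measure _ (ltW d0) j3)).
by rewrite ysz lee_fin.
Qed.

(** Otherwise the energies would be bounded by some c at arbitrarily large indices. Along these a
    subsequence converges in measure to a BV function with values 1 and -1, which by uniqueness of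
    the limit equals u almost everywhere. *)
Lemma F_eps_liminf_not_BV W alpha beta k a b (eps : nat -> R) (u_ : nat -> R -> R) u :
  (0 < k)%N -> continuous W -> (forall x, 0 <= W x) ->
  double_well W alpha beta -> 0 < alpha -> 0 < beta -> a < b ->
  (forall j, 0 < eps j) -> eps @ \oo --> (0 : R) ->
  (forall j, measurable_fun `]a, b[ (u_ j)) -> measurable_fun `]a, b[ u ->
  cvg_in_measure \oo a b u_ u -> ~ BV_pm1 a b u ->
  (+oo <= limn_einf (fun j => F_eps k W a b (eps j) (u_ j)))%E.
Proof.
move=> k0 cW W0 hW a0 b0 ab eps0 epsc mu_ hu cu nbv.
apply: (@limf_einf_ge _ _ _ \oo) => c _; apply: contrapT => hc.
(* Only g(n) >= n is required, not monotonicity: convergence in measure needs no more than indices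
   tending to infinity. *)
have /choice[g hg] n : exists j, (n <= j)%N /\ (F_eps k W a b (eps j) (u_ j) <= c%:E)%E.
  apply: contrapT => h; apply: hc; exists n => // j /= nj; rewrite leNgt; apply/negP => /ltW lt.
  by apply: h; exists j.
have gy : g @ \oo --> \oo by apply: cvg_infty_ge_id => j; have [] := hg j.
have hsob j : sobolevH `]a, b[ k (u_ (g j)).
  apply: contrapT => h; have [_] := hg j.
  by rewrite /F_eps asboolF.
have epsg : (fun j => eps (g j)) @ \oo --> (0 : R) by apply: cvg_comp epsc.
have [w [bvw [f fi cw]]] := F_eps_equicoercive k0 cW W0 hW a0 b0 ab
  (fun j => eps0 (g j)) epsg hsob (fun j => (hg j).2).
have fy : f @ \oo --> \oo by apply: cvg_infty_ge_id => j; exact: increasing_seq_ge.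
apply: nbv; apply: (BV_pm1_ae_eq hu _ bvw).
apply: (@cvg_in_measure_ae_unique a b (fun j => u_ (g (f j)))) => //.
  by have [] := bvw.
by apply: (@cvg_in_measure_subseq a b u_ u (g \o f)) => //; exact: cvg_comp fy gy.
Qed.

End equicoercivity.

Theorem theorem2p1 (R : realType) (k : nat) (a b : R) (W : R -> R)
    (alphaW betaW : R)
    (hk : (1 <= k)%N) (hab : a < b)
    (hWc : continuous W) (hW0 : forall z : R, 0 <= W z)
    (hWm1 : W (-1) = 0) (hW1 : W 1 = 0)
    (halpha : 0 < alphaW) (hbeta : 0 < betaW)
    (hW : forall z : R, alphaW * Num.min ((z + 1) ^+ 2)
                               (Num.min ((z - 1) ^+ 2) betaW) <= W z) :
  (* equicoercivity *)
  (forall (eps : nat -> R) (u_ : nat -> R -> R),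
     (forall j, 0 < eps j) -> eps @ \oo --> 0 ->
     (forall j, sobolevH `]a, b[ k (u_ j)) ->
     (ereal_sup (range (fun j => F_eps k W a b (eps j) (u_ j))) < +oo)%E ->
     exists u, BV_pm1 a b u /\
       exists s : nat -> nat, (forall i j, (i < j)%N -> (s i < s j)%N) /\
         cvg_in_measure \oo a b (fun j => u_ (s j)) u) /\
  (* Gamma-convergence with respect to convergence in measure *)
  Gamma_cvg [set u | measurable_fun `]a, b[ u] (cvg_in_measure \oo a b)
    (F_eps k W a b) (F_lim k W a b) /\
  (* Gamma-convergence with respect to convergence in L^1(a, b) *)
  Gamma_cvg [set u | integrable_on a b u] (cvg_in_L1 \oo a b)
    (F_eps k W a b) (F_lim k W a b) /\
  (forall u, BV_pm1 a b u ->
     (* (i) *)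
     (forall u_ : R -> R -> R,
        (forall eps : R, 0 < eps -> measurable_fun `]a, b[ (u_ eps)) ->
        cvg_in_measure 0^'+ a b u_ u ->
        (m_opt k W * counting (jump_set a b u) <=
         limf_einf (fun eps => F_eps k W a b eps (u_ eps)) 0^'+)%E) /\
     (* (ii) *)
     (exists u_ : R -> R -> R,
        [/\ forall eps : R, 0 < eps -> integrable_on a b (u_ eps),
            cvg_in_L1 0^'+ a b u_ u &
            limf_esup (fun eps => F_eps k W a b eps (u_ eps)) 0^'+ =
            (m_opt k W * counting (jump_set a b u))%E])).
Proof.
have hW' : double_well W alphaW betaW by [].
have at0 (d : R) : 0 < d -> \forall eps \near (0 : R)^'+, 0 < eps < d.
  move=> d0; near=> e; apply/andP; split; first by near: e; exact: nbhs_right_gt.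
  by near: e; exact: nbhs_right_lt.
have seq0 (eps : nat -> R) : (forall j, 0 < eps j) -> eps @ \oo --> (0 : R) ->
    forall d, 0 < d -> \forall j \near \oo, 0 < eps j < d.
  move=> eps0 epsc d d0; move/cvgrPdist_lt : epsc => /(_ _ d0); apply: filterS => j.
  by rewrite sub0r normrN gtr0_norm// => ->; rewrite eps0.
(* Stated for arbitrary filters, in order to serve both sequences eps_j and the limit eps tending to
   0 from the right. *)
have recover u : BV_pm1 a b u -> exists u_ : R -> R -> R,
    [/\ forall eps, integrable_on a b (u_ eps),
    forall (I : Type) (G : set_system I) (FG : Filter G) (e : I -> R),
      (forall d, 0 < d -> \forall i \near G, 0 < e i < d) ->
      cvg_in_L1 G a b (fun i => u_ (e i)) u &
    forall (T : choiceType) (I : filteredType T) (G : set_system I) (FG : ProperFilter G) (e : I -> R),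
      (forall d, 0 < d -> \forall i \near G, 0 < e i < d) ->
      (limf_esup (fun i => F_eps k W a b (e i) (u_ (e i))) G <=
       m_opt k W * counting (jump_set a b u))%E].
  move=> bv; have [u_ [ui hu]] := recovery_family hk hWc hW0 hWm1 hW1 hab bv.
  exists u_; split => //.
    move=> I G FG e he; apply/cvge0P => [i|d d0]; first exact: integral_ge0.
    have [e0 e00 h] := hu _ d0; have := he _ e00; apply: filterS => i /andP[i1 i2].
    by have [] := h _ i1 i2.
  move=> T I G FG e he; apply: limf_esup_le => c hc.
  have [d d0 hd] : exists2 d : R, 0 < d &
      (m_opt k W * counting (jump_set a b u) + d%:E <= c%:E)%E.
    move: hc; case: (m_opt k W * _)%E => [p| |] //.
      by rewrite lte_fin => pc; exists (c - p); rewrite ?subr_gt0// -EFinD lee_fin addrC subrK.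
    by exists 1.
  have [e0 e00 h] := hu _ d0; have := he _ e00; apply: filterS => i /andP[i1 i2].
  by have [h1 _] := h _ i1 i2; exact: le_trans h1 hd.
have L1_measurable u : integrable_on a b u -> measurable_fun `]a, b[ u.
  by move=> /measurable_int/measurable_EFinP.
have liminf (eps : nat -> R) (u : R -> R) (u_ : nat -> R -> R) :
    (forall j, 0 < eps j) -> eps @ \oo --> (0 : R) -> measurable_fun `]a, b[ u ->
    (forall j, measurable_fun `]a, b[ (u_ j)) -> cvg_in_measure \oo a b u_ u ->
    (F_lim k W a b u <= limn_einf (fun j => F_eps k W a b (eps j) (u_ j)))%E.
  move=> eps0 epsc mu mu_ cu; rewrite /F_lim; case: asboolP => bv.
    apply: F_eps_liminf => //; first exact: seq0.
    exact: nearW.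
  exact: (F_eps_liminf_not_BV hk hWc hW0 hW' halpha hbeta hab eps0 epsc mu_ mu cu bv).
split; last split; last split.
- move=> eps u_ eps0 epsc hu hM; set S := ereal_sup _ in hM.
  have Fle j : (F_eps k W a b (eps j) (u_ j) <= S)%E.
    by apply: ereal_sup_ubound; exists j.
  have Sfin : S \is a fin_num.
    rewrite ge0_fin_numE//; apply: le_trans (Fle 0%N).
    exact: F_eps_ge0.
  have FM j : (F_eps k W a b (eps j) (u_ j) <= (fine S)%:E)%E by rewrite fineK.
  have [w [bvw [f fi cw]]] := F_eps_equicoercive hk hWc hW0 hW' halpha hbeta hab eps0 epsc hu FM.
  exists w; split => //; exists f; split => // i j ij.
  by have := fi j i; rewrite leEnat [in RHS]leqNgt ij => /negbT; rewrite -ltnNge.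
- move=> eps eps0 epsc u mu; split; first by move=> u_ mu_; exact: liminf.
  rewrite /F_lim; case: asboolP => bv; last first.
    (* Where the limit functional is infinite, the constant sequence is a recovery sequence. *)
    exists (fun=> u); split => //; last exact: leey.
    move=> e e0; apply/cvge0P => [j|d d0]; first exact: measure_ge0.
    apply: nearW => j; rewrite (_ : [set _ | _] = set0) ?measure0 ?lee_fin ?ltW//.
    by apply/seteqP; split => // t [_]; rewrite subrr normr0 => /(lt_trans e0); rewrite ltxx.
  have [u_ [ui ucv ul]] := recover u bv.
  exists (fun j => u_ (eps j)); split.
  + by move=> j; exact: L1_measurable.
  + apply: cvg_in_L1_measure => //; last by apply: ucv; exact: seq0.
    by apply: nearW => j; exact: L1_measurable.
  + by apply: ul; exact: seq0.
- move=> eps eps0 epsc u iu; split.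
    move=> u_ iu_ cu.
    have mu_ j : measurable_fun `]a, b[ (u_ j) by exact: (L1_measurable _ (iu_ j)).
    have mu0 : measurable_fun `]a, b[ u by exact: (L1_measurable _ iu).
    apply: liminf => //; apply: cvg_in_L1_measure => //.
    exact: nearW.
  rewrite /F_lim; case: asboolP => bv; last first.
    exists (fun=> u); split => //; last exact: leey.
    apply/cvge0P => [j|d d0]; first exact: integral_ge0.
    apply: nearW => j; rewrite integral0_eq ?lee_fin ?ltW// => t _.
    by rewrite subrr normr0.
  have [u_ [ui ucv ul]] := recover u bv.
  exists (fun j => u_ (eps j)); split.
  + by move=> j; exact: ui.
  + by apply: ucv; exact: seq0.
  + by apply: ul; exact: seq0.
move=> u bv; have [mu _ _] := bv; split.
  move=> u_ mu_ cu; apply: F_eps_liminf => //.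
  by near=> e; apply: mu_; near: e; exact: nbhs_right_gt.
have [u_ [ui ucv ul]] := recover u bv.
exists u_; split => //; first exact: (ucv _ _ _ id at0).
(* The limit superior is bounded above by the recovery property and below by the limit inferior, to
   which the lower bound applies because L^1 convergence implies convergence in measure. *)
apply/eqP; rewrite eq_le (ul _ _ _ _ id at0)/=.
apply: (@le_trans _ _ (limf_einf (fun eps : R => F_eps k W a b eps (u_ eps)) 0^'+));
  last exact: limf_einf_le_esup.
apply: F_eps_liminf => //.
  by apply: nearW => e; exact: L1_measurable.
apply: cvg_in_L1_measure => //; last exact: (ucv _ _ _ id at0).
by apply: nearW => e; exact: L1_measurable.
Unshelve. all: by end_near. Qed.
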